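(* Let $\lambda=|\lambda|e^{i\alpha}\in\mathbb{C}$ with $|\lambda|<1$, let $\tau(z)=\dfrac{z(\lambda-z)}{1-\overline{\lambda}z}$ on $\mathbb{T}$, and let $T$ be the interval map on $I=[-1,1]$ arising from $\tau$ with the endpoint $-1$ corresponding to the fixed point $z_0=(\lambda-1)/(1-\overline{\lambda})$ of $\tau$, with inverse branches $\Phi_1,\Phi_2$. Then a bounded topological disk $D\subset\mathbb{C}$ containing $I$ can be chosen, with $\Phi_k$ extending holomorphically to $D$ and $\mathrm{cl}(\Phi_k(D))$ a compact subset of $D$ for $k=1,2$, such that the compact transfer operator $\mathcal{L}_I:H^\infty(D)\to H^\infty(D)$, $\mathcal{L}_If=\sum_{k=1}^{2}\Phi_k'\cdot(f\circ\Phi_k)$, has spectrum \[\sigma(\mathcal{L}_I)=\Big(\{\lambda^n:n\in\mathbb{N}_0\}\cup\{\overline{\lambda}^n:n\in\mathbb{N}\}\cup\{0\}\Big)\cup\Big\{\Big(\frac{|\lambda|^2-1}{2(|\lambda|\cos(\alpha)-1)}\Big)^n:n\in\mathbb{N}\Big\}.\] Moreover, $\Phi_1,\Phi_2:D\to D$ are contracting holomorphic maps whose unique fixed points $z_k^*$ in $D$ lie in $D\cap\mathbb{R}$ and for which $\Phi_k'(z_k^* )$ is real; but if $\lambda\notin\mathbb{R}$, then $\mathcal{L}_I$ has countably infinitely many non-real eigenvalues of arbitrarily small modulus. Consequently the following assertion is false: ''If $\Omega\subset\mathbb{C}$ is a bounded domain with $\Omega_{\mathbb{R}}=\Omega\cap\mathbb{R}\neq\emptyset$,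 and $\Phi_k:\Omega\to\Omega$ ($k=1,\dots,K$) are contracting holomorphic mappings with their unique fixed points $z_k^*$ in $\Omega_{\mathbb{R}}$ and with all $\Phi_k'(z_k^* )$ real, then all eigenvalues of the transfer operator $(\mathcal{L}f)(z)=\sum_{k=1}^K\Phi_k'(z)\,(f\circ\Phi_k)(z)$ with small enough modulus are real.''
   Context: $\mathbb{N}=\{1,2,\dots\}$, $\mathbb{N}_0=\mathbb{N}\cup\{0\}$, $\mathbb{T}=\{z\in\mathbb{C}:|z|=1\}$. $H^\infty(D)$ is the Banach space of bounded holomorphic functions on the open set $D$ with the supremum norm; $\mathrm{cl}$ denotes closure. For $|\lambda|<1$ the map $\tau$ above is analytic in a neighbourhood of $\mathbb{T}$, maps $\mathbb{T}$ to $\mathbb{T}$, satisfies $\inf_{z\in\mathbb{T}}|\tau'(z)|>1$, and is an orientation-preserving twofold covering of $\mathbb{T}$ with fixed point $z_0=(\lambda-1)/(1-\overline\lambda)\in\mathbb{T}$. Let $p(x)=e^{i\pi(x+1)+i\arg z_0}$, so $p(-1)=p(1)=z_0$. The interval map $T:I\to I$, $I=[-1,1]$, arising from $\tau$ is the full-branch map with $p\circ T=\tau\circ p$ and two increasing real-analytic inverse branches $\Phi_1,\Phi_2:I\to I$ (so $\tau\circ p\circ\Phi_k=p$), with $\Phi_1(-1)=-1$, $\Phi_1(1)=\Phi_2(-1)$, $\Phi_2(1)=1$. The holomorphic extensions of $\Phi_k$ to neighbourhoods of $I$ are denoted by the same symbols. One has $T'(-1)=\tau'(z_0)=\frac{2(|\lambda|\cos(\alpha)-1)}{|\lambda|^2-1}$.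 *)

(* Defs.v *)
From HB Require Import structures.
From mathcomp Require Import all_boot all_order all_algebra complex.
From mathcomp Require Import all_classical all_reals all_analysis.

Set Implicit Arguments.
Unset Strict Implicit.
Unset Printing Implicit Defensive.

Import Order.TTheory GRing.Theory Num.Theory numFieldNormedType.Exports.
Local Open Scope classical_set_scope.
Local Open Scope ring_scope.

(* [R[i]] packed as a [numClosedFieldType], so that it carries the topology and
   the normed module structure that the library puts on such fields. *)
Definition Cplx (R : realType) : numClosedFieldType := R[i]%C.

Definition ofR (R : realType) (x : R) : Cplx R := x%:C%C.

Definition expi (R : realType) (t : R) : Cplx R := Complex (cos t) (sin t).

Section Spectral.
Variables (K : numFieldType) (V : normedModType K).
Implicit Type L : {linear V -> V}.

Definition resolvent_set L : set K :=
  [set mu | exists S : {linear V -> V}, [/\ continuous S,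
     forall v, S (mu *: v - L v) = v & forall v, mu *: S v - L (S v) = v]].

Definition spectrum L : set K := ~` resolvent_set L.

Definition eigenvalues L : set K :=
  [set mu | exists2 v : V, v != 0 & L v = mu *: v].

Definition compact_operator L : Prop :=
  compact (closure (L @` [set v : V | `|v| <= 1])).

End Spectral.

Section Domains.
Variable R : realType.
Local Notation C := (Cplx R).

Definition holomorphic (D : set C) (f : C -> C) : Prop :=
  forall z, D z -> derivable f z 1.

Definition homeomorphic_sets (A B : set C) : Prop :=
  exists f g : C -> C,
    [/\ forall z, A z -> B (f z), forall w, B w -> A (g w),
        forall z, A z -> g (f z) = z & forall w, B w -> f (g w) = w]
    /\ {within A, continuous f} /\ {within B, continuous g}.

Definition bounded_topological_disk (D : set C) : Prop :=
  [/\ open D, bounded_set D & homeomorphic_sets D [set z : C | `|z| < 1]].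

Definition bounded_domain (D : set C) : Prop :=
  [/\ open D, connected D, D !=set0 & bounded_set D].

Definition maps_compactly_into (D : set C) (phi : C -> C) : Prop :=
  compact (closure (phi @` D)) /\ closure (phi @` D) `<=` D.

(* For self-maps of a domain, "contracting" is used both in the sense of the
   Earle-Hamilton theorem (the image is relatively compact in the domain) and in
   the metric sense; both are required here.  A statement refuted for maps that
   are contracting in this sense is thus refuted for either of the two. *)
Definition contracting (D : set C) (phi : C -> C) : Prop :=
  maps_compactly_into D phi /\
  exists2 c : C, 0 <= c < 1 &
    forall z w, D z -> D w -> `|phi z - phi w| <= c * `|z - w|.

Definition real_fixed_point_and_multiplier (D : set C) (phi : C -> C) : Prop :=
  exists z : C, [/\ D z, phi z = z, forall w, D w -> phi w = w -> w = z,
    z \is Num.real & derive1 phi z \is Num.real].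

End Domains.


(* [Hinf D] is the space of bounded holomorphic functions on [D].  Its elements
   are functions on the whole plane that vanish outside [D], so that equality in
   [Hinf D] is equality of functions on [D]. *)
Section BoundedHolomorphic.
Variable R : realType.
Local Notation C := (Cplx R).
Variable D : set C.

Definition hinf : {pred C -> C} := fun f : C -> C =>
  `[< [/\ holomorphic D f, [bounded f z | z in D] &
          forall z, ~ D z -> f z = 0] >].

Lemma hinfP (f : C -> C) : reflect [/\ holomorphic D f, [bounded f z | z in D] &
  forall z, ~ D z -> f z = 0] (f \in hinf).
Proof. exact: asboolP. Qed.

Lemma bounded_onP (f : C -> C) :
  [bounded f z | z in D] <-> exists M : R, forall z, D z -> `|f z| <= ofR M.
Proof.
split=> [[M0 [M0r M0P]]|[M MP]].
  exists (complex.Re M0 + 1) => z Dz; apply: (M0P (ofR _)) => //.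
  by rewrite -[M0 in X in X < _](RRe_real M0r) ltcR ltrDl.
exists (ofR M); split.
  by rewrite realE -[0]/((0 : R)%:C%C) !lecR le_total.
by move=> x Mx z Dz; apply: le_trans (MP z Dz) (ltW Mx).
Qed.

Record Hinf : Type := MkHinf { Hinf_fun :> C -> C; _ : Hinf_fun \in hinf }.

Lemma hinf_submod_closed : submod_closed hinf.
Proof.
split.
  apply/hinfP; split.
  - by move=> z _; exact: (derivable_cst (0 : C)).
  - by apply/bounded_onP; exists 0 => z _; rewrite normr0.
  - by [].
move=> a f g /hinfP[fh /bounded_onP[M fb] f0] /hinfP[gh /bounded_onP[N gb] g0].
apply/hinfP; split.
- move=> z Dz; apply: derivableD; last exact: gh.
  by apply: derivableZ; exact: fh.
- apply/bounded_onP; exists (complex.Re `|a| * M + N) => z Dz.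
  rewrite /ofR rmorphD rmorphM/= (RRe_real (normr_real a)).
  rewrite (le_trans (ler_normD _ _))// lerD ?gb// normrM.
  by rewrite ler_wpM2l ?fb.
- by move=> z nDz; rewrite !fctE f0// g0// scaler0 addr0.
Qed.

HB.instance Definition _ := [isSub for Hinf_fun].
HB.instance Definition _ := [Choice of Hinf by <:].
HB.instance Definition _ := GRing.isSubmodClosed.Build C (C -> C) hinf
  hinf_submod_closed.
HB.instance Definition _ := [SubChoice_isSubLmodule of Hinf by <:].

Definition Hinf_norm (f : Hinf) : C :=
  ofR (sup [set complex.Re `|f z| | z in D]).

Lemma Hinf_norm_ub (f : Hinf) z : D z -> `|f z| <= Hinf_norm f.
Proof.
move=> Dz; rewrite -[`|f z|](RRe_real (normr_real (f z))) lecR.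
apply: ub_le_sup; last by exists z.
have /hinfP[_ /bounded_onP[M MP] _] := valP f.
exists M => _ [w Dw <-].
by have := MP w Dw; rewrite -[`|_|](RRe_real (normr_real (f w))) lecR.
Qed.

Lemma Hinf_norm_ge0 (f : Hinf) : 0 <= Hinf_norm f.
Proof.
rewrite -[0]/((0 : R)%:C%C) lecR.
have [D0|/set0P[z Dz]] := eqVneq D set0; first by rewrite D0 image_set0 sup0.
have := le_trans (normr_ge0 _) (Hinf_norm_ub f Dz).
by rewrite -[0]/((0 : R)%:C%C) lecR.
Qed.

Lemma Hinf_norm_le (f : Hinf) (M : C) :
  0 <= M -> (forall z, D z -> `|f z| <= M) -> Hinf_norm f <= M.
Proof.
move=> M0 fM; have MR := RRe_real (ger0_real M0).
rewrite -MR lecR; have [D0|/set0P[z Dz]] := eqVneq D set0.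
  by rewrite D0 image_set0 sup0; move: M0; rewrite -MR -[0]/((0 : R)%:C%C) lecR.
apply: sup_le_ub; first by exists (complex.Re `|f z|); exists z.
move=> _ [w Dw <-]; have := fM w Dw.
by rewrite -MR -[`|_|](RRe_real (normr_real (f w))) lecR.
Qed.

Lemma Hinf_normD (f g : Hinf) : Hinf_norm (f + g) <= Hinf_norm f + Hinf_norm g.
Proof.
apply: Hinf_norm_le => [|z Dz]; first by rewrite addr_ge0 ?Hinf_norm_ge0.
by rewrite (le_trans (ler_normD _ _))// lerD ?Hinf_norm_ub.
Qed.

Let Hinf_normZ_le (a : C) (f : Hinf) : Hinf_norm (a *: f) <= `|a| * Hinf_norm f.
Proof.
apply: Hinf_norm_le => [|z Dz]; first by rewrite mulr_ge0 ?Hinf_norm_ge0.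
have -> : (a *: f) z = a * f z by [].
by rewrite normrM ler_wpM2l ?Hinf_norm_ub.
Qed.

Lemma Hinf_normZ (a : C) (f : Hinf) : Hinf_norm (a *: f) = `|a| * Hinf_norm f.
Proof.
apply/eqP; rewrite eq_le Hinf_normZ_le/=.
have [->|a0] := eqVneq a 0; first by rewrite normr0 mul0r Hinf_norm_ge0.
rewrite -[f in X in X <= _]scale1r -(mulVf a0) -scalerA.
rewrite (le_trans (ler_wpM2l _ (Hinf_normZ_le _ _)))//.
by rewrite mulrA -normrM mulfV// normr1 mul1r.
Qed.

Lemma Hinf_norm_eq0 (f : Hinf) : Hinf_norm f = 0 -> f = 0.
Proof.
move=> f0; apply/val_inj/funext => z /=.
have [Dz|nDz] := pselect (D z); last first.
  by have /hinfP[_ _ ->] := valP f.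
by apply/eqP; rewrite -normr_le0 -f0 Hinf_norm_ub.
Qed.

HB.instance Definition _ := Lmodule_isNormed.Build C Hinf
  Hinf_normD Hinf_normZ Hinf_norm_eq0.

End BoundedHolomorphic.

Section TransferOperator.
Variable R : realType.
Local Notation C := (Cplx R).

Definition is_transfer_operator (D : set C) (K : nat) (Phi : 'I_K -> C -> C)
    (L : {linear Hinf D -> Hinf D}) : Prop :=
  forall (f : Hinf D) (z : C), D z ->
    L f z = \sum_(k < K) derive1 (Phi k) z * f (Phi k z).

Definition small_eigenvalues_real_assertion : Prop :=
  forall (Omega : set C) (K : nat) (Phi : 'I_K -> C -> C)
      (L : {linear Hinf Omega -> Hinf Omega}),
    bounded_domain Omega ->
    (exists x : R, Omega (ofR x)) ->
    (0 < K)%N ->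
    (forall k, [/\ holomorphic Omega (Phi k), contracting Omega (Phi k) &
                   real_fixed_point_and_multiplier Omega (Phi k)]) ->
    is_transfer_operator Phi L ->
    exists2 e : C, 0 < e &
      forall mu, eigenvalues L mu -> `|mu| < e -> mu \is Num.real.

End TransferOperator.

Section IntervalMap.
Variable R : realType.
Local Notation C := (Cplx R).

Definition tau (lambda z : C) : C := z * (lambda - z) / (1 - lambda^* * z).

Definition z0 (lambda : C) : C := (lambda - 1) / (1 - lambda^*).

(* [`|z0 lambda| = 1], so the factor e^{i arg z0} is [z0 lambda] itself. *)
Definition circle_param (lambda : C) (x : R) : C :=
  expi (pi * (x + 1)) * z0 lambda.

Definition real_analytic_on (A : set R) (f : R -> R) : Prop :=
  forall x, A x -> exists a : nat -> R, exists2 r : R, 0 < r &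
    forall y, A y -> `|y - x| < r -> pseries a (y - x) @ \oo --> f y.

(* [T] on I = [-1, 1] with its inverse branches.  The value of [T] at the break
   point [Phi ord0 1] is only constrained by [im_semiconj], that is, to be -1
   or 1, since [circle_param] identifies these two points. *)
Record interval_map (lambda : C) (T : R -> R) (Phi : 'I_2 -> R -> R) : Prop :=
  IntervalMap {
    im_maps : forall x, x \in `[-1, 1] -> T x \in `[-1, 1];
    im_semiconj : forall x, x \in `[-1, 1] ->
      circle_param lambda (T x) = tau lambda (circle_param lambda x);
    im_left : T (-1) = -1;
    im_right : T 1 = 1;
    im_branch_maps : forall k x, x \in `[-1, 1] -> Phi k x \in `[-1, 1];
    im_branch_incr : forall k, {in `[-1, 1] &, {homo Phi k : x y / x < y}};
    im_branch_analytic : forall k, real_analytic_on `[-1, 1]%classic (Phi k);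
    im_branch_inv : forall k x, x \in `]-1, 1[ -> T (Phi k x) = x;
    im_branch_tau : forall k x, x \in `[-1, 1] ->
      tau lambda (circle_param lambda (Phi k x)) = circle_param lambda x;
    im_branch_left : Phi ord0 (-1) = -1;
    im_branch_mid : Phi ord0 1 = Phi ord_max (-1);
    im_branch_right : Phi ord_max 1 = 1
  }.

End IntervalMap.

(* Main.v *)
(** The operator is compact, so its non-zero spectrum consists of eigenvalues.
    Suppose [nu h - L h = f].  Near the fixed point -1 the jump
    [g(z) = h(z + 2) - h(z)] satisfies [nu g = Phi_1' (g o Phi_1)] up to the jump
    of [f].  With [mu = Phi_1'(-1)], comparing Taylor coefficients at -1 shows that
    [g = 0] if [f] is 2-periodic and [nu] is no [mu^n], [n >= 1], and that the
    equation with [nu = mu^n] has no solution when the jump of [f] vanishes exactly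
    to order [n - 1].

    For 2-periodic [h], let [l_h(G)] be the integral of [h (G o P)] over one period
    in the upper half of [D], where [P] is the circle parameter and [G] is
    holomorphic in the unit disc.  Since [tau o P o Phi_k = P], a change of
    variables gives [nu l_h(G) = l_h(G o tau) + l_f(G)].  As [tau] contracts the
    disc to 0 with multiplier [lambda], for [f = 0] this forces [l_h = 0] unless
    [nu] is a power of [lambda].  In the lower half of [D], [1/P] and the conjugate
    of [lambda] play these roles.  If both functionals vanish, Cauchy's formula
    over a period shows that [h = 0] on the interval, hence on [D].  Conversely
    [f = P^-n] satisfies [l_f(z^n) <> 0] but [l_f(G) = 0] whenever [G] vanishes to
    order [n + 1] at 0, so [lambda^n - L] is not onto.

    Each such integral is the difference of a primitive, on a convex set, between
    two end points. *)
Require Import Defs.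
From mathcomp Require Import all_boot all_order all_algebra complex.
From mathcomp Require Import all_classical all_reals all_analysis.
From mathcomp Require Import ring lra.
From HB Require Import structures.
Import Order.TTheory GRing.Theory Num.Theory numFieldNormedType.Exports.
Local Open Scope classical_set_scope.
Local Open Scope ring_scope.

Set Implicit Arguments.
Unset Strict Implicit.

(** Let s^2 be the given point of the circle and Z = s W. Then tau Z = s^2 becomes W^2 - 2 q W + 1 =
    0 with q = (conj(lambda) s + lambda / s) / 2, so W = q -+ i sqrt(1 - q^2), and in the circle
    parameter the branches are z/2 +- arcsin(q)/pi up to constants. On a thin strip |q| stays below
    some radius less than 1, one holomorphic arcsine serves both branches, and their derivatives
    stay within kap/2 < 1/2 of 1/2. This single estimate gives the contraction, the monotonicity on
    the interval and the invariance of both half planes. A flat ellipse inside the strip is mapped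
    well into itself because its length absorbs the bounded real shift. A power of lambda may
    coincide with a power of the multiplier mu, and then solutions of the resolvent equation cannot
    be shown periodic. Non-surjectivity avoids any discussion of eigenfunctions here: a coinciding
    power is settled by the jump argument, any other by the period functional. The exponent 0 is
    settled by the constant eigenfunction, and 0 belongs to the spectrum because the eigenvalues
    mu^n tend to 0. *)

(** * Complex numbers through real and imaginary parts, modulus and derivative *)

Section ComplexPlane.
Variable R : realType.
Local Notation C := (Cplx R).
Implicit Types (z w : C) (x y : R).

Definition re z : R := complex.Re z.
Definition im z : R := complex.Im z.
Definition cpx x y : C := Complex x y.
Definition ci : C := cpx 0 1.

Lemma cplx_ext z w : re z = re w -> im z = im w -> z = w.
Proof. by case: z => a b; case: w => c d /= -> ->. Qed.

Lemma reD z w : re (z + w) = re z + re w. Proof. by case: z; case: w. Qed.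
Lemma imD z w : im (z + w) = im z + im w. Proof. by case: z; case: w. Qed.
Lemma reN z : re (- z) = - re z. Proof. by case: z. Qed.
Lemma imN z : im (- z) = - im z. Proof. by case: z. Qed.
Lemma reB z w : re (z - w) = re z - re w. Proof. by rewrite reD reN. Qed.
Lemma imB z w : im (z - w) = im z - im w. Proof. by rewrite imD imN. Qed.
Lemma reM z w : re (z * w) = re z * re w - im z * im w.
Proof. by case: z; case: w. Qed.
Lemma imM z w : im (z * w) = re z * im w + im z * re w.
Proof. by case: z; case: w. Qed.
Lemma re_ofR x : re (ofR x) = x. Proof. by []. Qed.
Lemma im_ofR x : im (ofR x) = 0. Proof. by []. Qed.
Lemma re_cpx x y : re (cpx x y) = x. Proof. by []. Qed.
Lemma im_cpx x y : im (cpx x y) = y. Proof. by []. Qed.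
Lemma re_ci : re ci = 0. Proof. by []. Qed.
Lemma im_ci : im ci = 1. Proof. by []. Qed.
Lemma re0 : re 0 = 0. Proof. by []. Qed.
Lemma im0 : im 0 = 0. Proof. by []. Qed.
Lemma re1 : re 1 = 1. Proof. by []. Qed.
Lemma im1 : im 1 = 0. Proof. by []. Qed.
Lemma reMn z n : re (z *+ n) = re z *+ n.
Proof. by elim: n => // n IH; rewrite !mulrS reD IH. Qed.
Lemma imMn z n : im (z *+ n) = im z *+ n.
Proof. by elim: n => // n IH; rewrite !mulrS imD IH. Qed.
Lemma re_conj z : re (z^*) = re z. Proof. by case: z. Qed.
Lemma im_conj z : im (z^*) = - im z. Proof. by case: z. Qed.

Definition reimE := (reD, imD, reN, imN, reM, imM, re_ofR, im_ofR, re_cpx,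
  im_cpx, re_ci, im_ci, re_conj, im_conj, reMn, imMn, re1, im1, re0, im0).

Lemma ofRD x y : ofR (x + y) = ofR x + ofR y.
Proof. by apply: cplx_ext; rewrite !reimE ?addr0. Qed.
Lemma ofRN x : ofR (- x) = - ofR x.
Proof. by apply: cplx_ext; rewrite !reimE ?oppr0. Qed.
Lemma ofRB x y : ofR (x - y) = ofR x - ofR y.
Proof. by rewrite ofRD ofRN. Qed.
Lemma ofRM x y : ofR (x * y) = ofR x * ofR y.
Proof. by apply: cplx_ext; rewrite !reimE; ring. Qed.
Lemma ofR0 : ofR (0 : R) = 0. Proof. by []. Qed.
Lemma ofR1 : ofR (1 : R) = 1. Proof. by []. Qed.
Lemma ofRn n : ofR (n%:R : R) = n%:R.
Proof. by apply: cplx_ext; rewrite !reimE //= mul0rn. Qed.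
Lemma ofRX x n : ofR (x ^+ n) = ofR x ^+ n.
Proof. by elim: n => [|n IH]; rewrite ?expr0 // !exprS ofRM IH. Qed.
Lemma ofR_inj : injective (@ofR R).
Proof. by move=> x y [->]. Qed.
Lemma ofRV x : ofR x^-1 = (ofR x)^-1.
Proof.
have [->|x0] := eqVneq x 0; first by rewrite invr0 ofR0 invr0.
have h : ofR x != 0 by apply/eqP => /ofR_inj /eqP; rewrite (negbTE x0).
by apply: (mulfI h); rewrite -ofRM !divff.
Qed.
Definition ofRE := (ofRD, ofRN, ofRM, ofRV, ofRX, ofRn, ofR0, ofR1).

Lemma cpxE z : z = ofR (re z) + ofR (im z) * ci.
Proof. by apply: cplx_ext; rewrite !reimE; ring. Qed.
Lemma ci2 : ci * ci = -1.
Proof. by apply: cplx_ext; rewrite !reimE; ring. Qed.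
Lemma ci_neq0 : ci != 0.
Proof. by apply/eqP => -[] /eqP; rewrite oner_eq0. Qed.
Lemma ciV : ci^-1 = - ci.
Proof. by apply: (mulfI ci_neq0); rewrite divff ?ci_neq0// mulrN ci2 opprK. Qed.

Lemma lecR' x y : (ofR x <= ofR y) = (x <= y). Proof. exact: lecR. Qed.
Lemma ltcR' x y : (ofR x < ofR y) = (x < y). Proof. exact: ltcR. Qed.

(** The norm takes its values in [C]; a copy with values in [R] makes every estimate a statement of
    real arithmetic. *)
Definition cn z : R := re `|z|.

Lemma cnE z : `|z| = ofR (cn z).
Proof. by rewrite /cn /ofR /re (RRe_real (normr_real z)). Qed.
Lemma cn_sqr z : cn z ^+ 2 = re z ^+ 2 + im z ^+ 2.
Proof.
case: z => a b; rewrite /cn /re normc_def /= sqr_sqrtr //.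
by rewrite addr_ge0 ?sqr_ge0.
Qed.
Lemma cn_ge0 z : 0 <= cn z.
Proof. by rewrite -lecR' -cnE ofR0 normr_ge0. Qed.
Lemma cn_le z x : (`|z| <= ofR x) = (cn z <= x).
Proof. by rewrite cnE lecR'. Qed.
Lemma cn_lt z x : (`|z| < ofR x) = (cn z < x).
Proof. by rewrite cnE ltcR'. Qed.
Lemma cn0 : cn 0 = 0. Proof. by rewrite /cn normr0. Qed.
Lemma cn1 : cn 1 = 1. Proof. by rewrite /cn normr1. Qed.
Lemma cnN z : cn (- z) = cn z. Proof. by rewrite /cn normrN. Qed.
Lemma cnM z w : cn (z * w) = cn z * cn w.
Proof. by apply: ofR_inj; rewrite ofRM -!cnE normrM. Qed.
Lemma cnX z n : cn (z ^+ n) = cn z ^+ n.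
Proof. by elim: n => [|n IH]; rewrite ?cn1 // !exprS cnM IH. Qed.
Lemma cnV z : cn z^-1 = (cn z)^-1.
Proof. by apply: ofR_inj; rewrite ofRV -!cnE normfV. Qed.
Lemma cn_ofR x : cn (ofR x) = `|x|.
Proof.
by apply/eqP; rewrite -(@eqrXn2 _ 2) ?cn_ge0// cn_sqr !reimE expr0n addr0 real_normK ?num_real.
Qed.
Lemma cn_ci : cn ci = 1.
Proof. by apply/eqP; rewrite -(@eqrXn2 _ 2) ?cn_ge0// cn_sqr !reimE; apply/eqP; ring. Qed.
Lemma cnD z w : cn (z + w) <= cn z + cn w.
Proof. by rewrite -lecR' ofRD -!cnE ler_normD. Qed.
Lemma cnB z w : cn (z - w) <= cn z + cn w.
Proof. by rewrite -(cnN w) cnD. Qed.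
Lemma cnC z w : cn (z - w) = cn (w - z).
Proof. by rewrite -cnN opprB. Qed.
Lemma cnDB z w t : cn (z - w) <= cn (z - t) + cn (t - w).
Proof. by rewrite -lecR' ofRD -!cnE ler_distD. Qed.
Lemma cn_ge z w : cn z - cn w <= cn (z - w).
Proof. by rewrite lerBlDr -{1}(subrK w z) cnD. Qed.
Lemma cn_eq0 z : (cn z == 0) = (z == 0).
Proof. by rewrite -(normr_eq0 z) cnE -ofR0 (inj_eq ofR_inj). Qed.
Lemma cn_gt0 z : (0 < cn z) = (z != 0).
Proof. by rewrite lt_def cn_ge0 andbT cn_eq0. Qed.
Lemma cn_le0 z : cn z <= 0 -> z = 0.
Proof. by move=> h; apply/eqP; rewrite -cn_eq0 eq_le h cn_ge0. Qed.
Lemma cn_conj z : cn (z^*) = cn z.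
Proof. by rewrite /cn norm_conjC. Qed.
Lemma re_le_cn z : `|re z| <= cn z.
Proof.
by rewrite -(@ler_pXn2r _ 2) ?nnegrE ?cn_ge0// cn_sqr real_normK ?num_real// lerDl sqr_ge0.
Qed.
Lemma im_le_cn z : `|im z| <= cn z.
Proof.
by rewrite -(@ler_pXn2r _ 2) ?nnegrE ?cn_ge0// cn_sqr real_normK ?num_real// lerDr sqr_ge0.
Qed.
Lemma cn_le_reim z : cn z <= `|re z| + `|im z|.
Proof.
rewrite {1}(cpxE z); apply: le_trans (cnD _ _) _.
by rewrite cnM cn_ci mulr1 !cn_ofR.
Qed.

Lemma cn_sum (I : Type) (r : seq I) (P : pred I) (F : I -> C) :
  cn (\sum_(i <- r | P i) F i) <= \sum_(i <- r | P i) cn (F i).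
Proof.
elim/big_rec2: _ => [|i u v _ h]; first by rewrite cn0.
by apply: le_trans (cnD _ _) _; rewrite lerD2l.
Qed.

Lemma cplx_realP z : (z \is Num.real) = (im z == 0).
Proof. by case: z => a b; rewrite complex_real. Qed.

Lemma conjcofR x : (ofR x)^* = ofR x.
Proof. by apply: cplx_ext; rewrite !reimE ?oppr0. Qed.
Lemma mulcconj z : z * z^* = ofR (cn z ^+ 2).
Proof. by apply: cplx_ext; rewrite !reimE ?cn_sqr; ring. Qed.

Lemma cpos_ofR (e : C) : 0 < e -> exists2 x : R, 0 < x & e = ofR x.
Proof.
move=> e0; have er : e \is Num.real by rewrite gtr0_real.
have E : e = ofR (re e) by rewrite /ofR /re RRe_real.
by exists (re e) => //; rewrite -ltcR' -E.
Qed.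

Lemma cnbhsP z (A : set C) :
  nbhs z A <-> exists2 e : R, 0 < e & forall w, cn (w - z) < e -> A w.
Proof.
split=> [/nbhs_ballP[e /= /cpos_ofR[x x0 ->] h]|[e e0 h]].
  by exists x => // w hw; apply: h; rewrite -ball_normE /= distrC cnE ltcR'.
apply/nbhs_ballP; exists (ofR e) => /=; first by rewrite -ofR0 ltcR'.
by move=> w; rewrite -ball_normE /= distrC cnE ltcR' => /h.
Qed.

Lemma copenP (D : set C) : open D <->
  forall z, D z -> exists2 e : R, 0 < e & forall w, cn (w - z) < e -> D w.
Proof.
rewrite openE; split=> h z /h; first by move/cnbhsP.
by move=> ?; apply/cnbhsP.
Qed.

Lemma ccontP (f : C -> C) z : {for z, continuous f} <->
  forall e : R, 0 < e -> exists2 d : R, 0 < d &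
    forall w, cn (w - z) < d -> cn (f w - f z) < e.
Proof.
split=> [h e e0|h].
  have /h : nbhs (f z) [set w | cn (w - f z) < e] by apply/cnbhsP; exists e.
  by move=> /cnbhsP[d d0 hd]; exists d.
move=> A /cnbhsP[e e0 he]; apply/cnbhsP.
by have [d d0 hd] := h _ e0; exists d => // w /hd /he.
Qed.

(** First-order expansion in place of a difference quotient: the point w = z needs no exception,
    which keeps the chain rule and the estimates along segments free of case distinctions. *)
Definition cder (f : C -> C) z (d : C) :=
  forall e : R, 0 < e -> exists2 a : R, 0 < a & forall w, cn (w - z) < a ->
    cn (f w - f z - d * (w - z)) <= e * cn (w - z).

Lemma is_derive_cder (f : C -> C) z (d : C) : is_derive z 1 f d -> cder f z d.
Proof.
move=> [dv dE] e e0.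
have h : (fun h0 : C => h0^-1 *: (f (h0 *: (1:C) + z) - f z)) @ 0^' --> d.
  by rewrite -dE; exact: dv.
have /h : nbhs d [set w | cn (w - d) < e] by apply/cnbhsP; exists e.
rewrite /= /dnbhs /within /= => /cnbhsP[a a0 ha]; exists a => // w hw.
have [->|wz] := eqVneq w z; first by rewrite !subrr mulr0 subrr cn0 mulr0.
have wz0 : w - z != 0 by rewrite subr_eq0.
have := ha (w - z); rewrite subr0 => /(_ hw wz0) /=.
rewrite [(w - z) *: 1]mulr1 subrK => H.
rewrite -[f w - f z](mulVKf wz0) [(w-z) * _]mulrC -mulrBl cnM.
by apply: ler_wpM2r; rewrite ?cn_ge0// ltW.
Qed.

Lemma cder_is_derive (f : C -> C) z (d : C) : cder f z d -> is_derive z 1 f d.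
Proof.
move=> h.
have H : (fun h0 : C => h0^-1 *: (f (h0 *: (1:C) + z) - f z)) @ 0^' --> d.
  move=> A /cnbhsP[e e0 he]; rewrite /= /dnbhs /within; apply/cnbhsP.
  have [a a0 ha] := h (e / 2) ltac:(by rewrite divr_gt0).
  exists a => // w; rewrite subr0 => wa w0; apply: he.
  rewrite [w *: 1]mulr1; have := ha (w + z); rewrite addrK => /(_ wa) H.
  have -> : w^-1 *: (f (w + z) - f z) - d = w^-1 * (f (w + z) - f z - d * w).
    by rewrite mulrBr [d * w]mulrC mulKf.
  rewrite cnM cnV ltr_pdivrMl ?cn_gt0//; apply: le_lt_trans H _.
  by rewrite mulrC ltr_pM2l ?cn_gt0// ltr_pdivrMr// ltr_pMr// ltr1n.
split; first by apply/cvg_ex; exists d.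
exact/cvg_lim.
Qed.

Lemma cderP (f : C -> C) z (d : C) : is_derive z 1 f d <-> cder f z d.
Proof. by split; [exact: is_derive_cder|exact: cder_is_derive]. Qed.

End ComplexPlane.
Arguments ci {R}.

(** * Rules of differentiation and the mean value inequality *)

Section ComplexCalculus.
Variable R : realType.
Local Notation C := (Cplx R).
Implicit Types (f g : C -> C) (z w : C).

Lemma cder_cst (c z : C) : cder (fun=> c) z 0.
Proof. by apply/cderP; exact: is_derive_cst. Qed.

Lemma cder_id z : cder (fun w => w) z 1.
Proof. by apply/cderP; exact: is_derive_id. Qed.

Lemma cderD f g z df dg : cder f z df -> cder g z dg ->
  cder (fun w => f w + g w) z (df + dg).
Proof. by move=> /cderP hf /cderP hg; apply/cderP; exact: is_deriveD. Qed.

Lemma cderN f z df : cder f z df -> cder (fun w => - f w) z (- df).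
Proof. by move=> /cderP hf; apply/cderP; exact: is_deriveN. Qed.

Lemma cderB f g z df dg : cder f z df -> cder g z dg ->
  cder (fun w => f w - g w) z (df - dg).
Proof. by move=> hf hg; apply: cderD => //; apply: cderN. Qed.

Lemma cderM f g z df dg : cder f z df -> cder g z dg ->
  cder (fun w => f w * g w) z (f z * dg + g z * df).
Proof. by move=> /cderP hf /cderP hg; apply/cderP; exact: is_deriveM. Qed.

Lemma cder_eq f z d d' : cder f z d -> d = d' -> cder f z d'.
Proof. by move=> h <-. Qed.

Lemma cderZ f z df c : cder f z df -> cder (fun w => c * f w) z (c * df).
Proof.
move=> h; apply: cder_eq (cderM (cder_cst c z) h) _.
by rewrite mulr0 addr0.
Qed.

Lemma cder_cont f z d : cder f z d -> forall e : R, 0 < e ->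
  exists2 a : R, 0 < a & forall w, cn (w - z) < a -> cn (f w - f z) < e.
Proof.
move=> h e e0; have [a a0 ha] := h 1 ltr01.
have M0 : 0 < cn d + 1 by rewrite ltr_wpDl ?cn_ge0.
exists (Num.min a (e / (cn d + 1))); first by rewrite lt_min a0 divr_gt0.
move=> w; rewrite lt_min => /andP[/ha h1 h2].
have -> : f w - f z = (f w - f z - d * (w - z)) + d * (w - z) by rewrite subrK.
apply: le_lt_trans (cnD _ _) _; rewrite cnM.
move: h2; rewrite ltr_pdivlMr// => h2; apply: le_lt_trans h2.
by move: h1; lra.
Qed.

Lemma cder_comp f g z df dg : cder f z df -> cder g (f z) dg ->
  cder (fun w => g (f w)) z (dg * df).
Proof.
move=> hf hg e e0.
have M0 : 0 < cn df + 1 by rewrite ltr_wpDl ?cn_ge0.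
have N0 : 0 < cn dg + 1 by rewrite ltr_wpDl ?cn_ge0.
have [a a0 ha] := hg (e / 2 / (cn df + 1)) ltac:(by rewrite !divr_gt0).
have [b b0 hb] := hf (Num.min 1 (e / 2 / (cn dg + 1))) ltac:(by rewrite lt_min ltr01 !divr_gt0).
have [c c0 hc] := cder_cont hf a0.
exists (Num.min b c); first by rewrite lt_min b0.
move=> w; rewrite lt_min => /andP[/hb h1 /hc/ha h2].
have -> : g (f w) - g (f z) - dg * df * (w - z) =
  (g (f w) - g (f z) - dg * (f w - f z)) + dg * (f w - f z - df * (w - z)) by ring.
apply: le_trans (cnD _ _) _; rewrite cnM.
set x := cn (w - z) in h1 *.
have x0 : 0 <= x by exact: cn_ge0.
have h3 : cn (f w - f z) <= (cn df + 1) * x.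
  have -> : f w - f z = (f w - f z - df * (w - z)) + df * (w - z) by rewrite subrK.
  apply: le_trans (cnD _ _) _; rewrite cnM mulrDl mul1r addrC lerD2l.
  by apply: le_trans h1 _; rewrite ler_piMl// ge_min lexx.
have h4 : cn (f w - f z - df * (w - z)) <= e / 2 / (cn dg + 1) * x.
  by apply: le_trans h1 _; rewrite ler_wpM2r// ge_min lexx orbT.
have -> : e * x = e / 2 * x + e / 2 * x by field.
apply: lerD.
  apply: le_trans h2 _.
  apply: le_trans (ler_wpM2l _ h3) _; first by rewrite !divr_ge0 ?ltW.
  by rewrite mulrA divfK ?gt_eqF.
apply: le_trans (ler_wpM2l (cn_ge0 _) h4) _.
rewrite mulrA ler_wpM2r// mulrCA ler_piMr ?divr_ge0 ?ltW//.
by rewrite ltr_pdivrMr// mul1r ltrDl.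
Qed.

Lemma cder_inv z : z != 0 -> cder (fun w => w^-1) z (- z^-2).
Proof.
move=> z0 e e0; have x0 : 0 < cn z by rewrite cn_gt0.
(* The remainder is exactly (w - z)^2 / (w z^2). The first bound gives |w| >= |z|/2, the second then
   makes the remainder at most e |w - z|. *)
exists (Num.min (cn z / 2) (e * cn z ^+ 3 / 2)).
  by rewrite lt_min !divr_gt0// mulr_gt0// exprn_gt0.
move=> w; rewrite lt_min => /andP[h1 h2].
have hw : cn z / 2 <= cn w.
  by have := @cn_ge R z w; rewrite cnC => h; lra.
have w0 : w != 0 by rewrite -cn_gt0; apply: lt_le_trans hw; rewrite divr_gt0.
have -> : w^-1 - z^-1 - - z^-2 * (w - z) = (w - z) * (w - z) * (w * z ^+ 2)^-1.
  by field; rewrite z0 w0.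
rewrite 2!cnM -mulrA [leLHS]mulrC. rewrite ler_wpM2r ?cn_ge0//.
rewrite cnV cnM cnX ler_pdivrMr; last first.
  by rewrite mulr_gt0 ?exprn_gt0// cn_gt0.
apply/ltW; apply: lt_le_trans h2 _.
have -> : e * cn z ^+ 3 / 2 = e * ((cn z / 2) * cn z ^+ 2) by field.
by apply: ler_wpM2l; [exact: ltW|apply: ler_wpM2r => //; exact: sqr_ge0].
Qed.

Lemma cderV f z df : f z != 0 -> cder f z df ->
  cder (fun w => (f w)^-1) z (- df / f z ^+ 2).
Proof.
move=> f0 h; apply: cder_eq (cder_comp h (cder_inv f0)) _.
by rewrite mulNr mulNr mulrC.
Qed.

Lemma cder_near f g z d : (exists2 a : R, 0 < a & forall w, cn (w - z) < a -> f w = g w) ->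
  cder f z d -> cder g z d.
Proof.
move=> [a a0 h] hf e /hf[b b0 hb]; exists (Num.min a b); first by rewrite lt_min a0.
move=> w; rewrite lt_min => /andP[wa /hb].
by rewrite !h// subrr cn0.
Qed.

Lemma cderX f z df n : cder f z df ->
  cder (fun w => f w ^+ n) z (n%:R * f z ^+ n.-1 * df).
Proof.
move=> h; elim: n => [|n IH]; first by rewrite !mul0r; exact: cder_cst.
rewrite [fun w => _](_ : _ = fun w => f w * f w ^+ n); last first.
  by apply/funext => w; rewrite exprS.
apply: cder_eq (cderM h IH) _ => /=; rewrite -natr1.
case: n {IH} => [|n]; first by rewrite !expr0; ring.
by rewrite /= exprS; ring.
Qed.

Lemma cder_derive1 f z d : cder f z d -> derive1 f z = d.
Proof. by move=> /cderP[_ <-]; rewrite derive1E. Qed.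

Definition rder (g : R -> C) (t : R) (d : C) :=
  forall e : R, 0 < e -> exists2 a : R, 0 < a & forall s, `|s - t| < a ->
    cn (g s - g t - d * ofR (s - t)) <= e * `|s - t|.

Lemma real_derP (f : R -> R) (x d : R) : is_derive x 1 f d <->
  forall e : R, 0 < e -> exists2 a : R, 0 < a & forall y, `|y - x| < a ->
    `|f y - f x - d * (y - x)| <= e * `|y - x|.
Proof.
split=> [[dv dE] e e0|h].
  have h : (fun h0 : R => h0^-1 *: (f (h0 *: (1:R) + x) - f x)) @ 0^' --> d.
    by rewrite -dE; exact: dv.
  have /h : nbhs d [set w | `|d - w| < e] by exact: nbhsx_ballx.
  rewrite /= /dnbhs /within /= => /nbhs_ballP[a /= a0 ha]; exists a => // w hw.
  have [->|wz] := eqVneq w x; first by rewrite !subrr mulr0 subrr normr0 mulr0.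
  have wz0 : w - x != 0 by rewrite subr_eq0.
  have := ha (w - x); rewrite -ball_normE /= sub0r normrN => /(_ hw wz0) /=.
  rewrite [(w - x) *: 1]mulr1 subrK => H.
  rewrite -[f w - f x](mulVKf wz0) [(w-x) * _]mulrC -mulrBl normrM.
  by apply: ler_wpM2r; rewrite// distrC ltW.
have H : (fun h0 : R => h0^-1 *: (f (h0 *: (1:R) + x) - f x)) @ 0^' --> d.
  move=> A /nbhs_ballP[e /= e0 he]; rewrite /= /dnbhs /within; apply/nbhs_ballP.
  have [a a0 ha] := h (e / 2) ltac:(by rewrite divr_gt0).
  exists a => // w; rewrite -ball_normE /= sub0r normrN => wa w0; apply: he.
  rewrite [w *: 1]mulr1; have := ha (w + x); rewrite addrK => /(_ wa) H.
  rewrite -ball_normE /= distrC.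
  have -> : w^-1 *: (f (w + x) - f x) - d = w^-1 * (f (w + x) - f x - d * w).
    by rewrite mulrBr [d * w]mulrC mulKf.
  rewrite normrM normfV ltr_pdivrMl ?normr_gt0//; apply: le_lt_trans H _.
  by rewrite mulrC ltr_pM2l ?normr_gt0// ltr_pdivrMr// ltr_pMr// ltr1n.
split; first by apply/cvg_ex; exists d.
exact/cvg_lim.
Qed.

Lemma rder_re (g : R -> C) t d (c : C) : rder g t d ->
  is_derive t 1 (fun s => re (c * g s)) (re (c * d)).
Proof.
move=> h; apply/real_derP => e e0; have M0 : 0 < cn c + 1 by rewrite ltr_wpDl ?cn_ge0.
have [a a0 ha] := h (e / (cn c + 1)) ltac:(by rewrite divr_gt0).
exists a => // s /ha H.
have -> : re (c * g s) - re (c * g t) - re (c * d) * (s - t) =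
  re (c * (g s - g t - d * ofR (s - t))) by rewrite !reimE; ring.
apply: le_trans (re_le_cn _) _; rewrite cnM.
apply: le_trans (ler_wpM2l (cn_ge0 _) H) _.
rewrite mulrA ler_wpM2r// mulrCA ler_piMr ?ltW//.
by rewrite ltr_pdivrMr// mul1r ltrDl.
Qed.

Lemma rder_pair (u v : R -> R) (t du dv : R) : is_derive t 1 u du -> is_derive t 1 v dv ->
  rder (fun s => cpx (u s) (v s)) t (cpx du dv).
Proof.
move=> /real_derP hu /real_derP hv e e0.
have [a a0 ha] := hu (e / 2) ltac:(by rewrite divr_gt0).
have [b b0 hb] := hv (e / 2) ltac:(by rewrite divr_gt0).
exists (Num.min a b); first by rewrite lt_min a0.
move=> s; rewrite lt_min => /andP[/ha h1 /hb h2].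
apply: le_trans (cn_le_reim _) _; rewrite !reimE !mulr0 subr0 add0r.
by apply: le_trans (lerD h1 h2) _; rewrite -mulrDl -splitr.
Qed.

Lemma rderD (g h : R -> C) t dg dh : rder g t dg -> rder h t dh ->
  rder (fun s => g s + h s) t (dg + dh).
Proof.
move=> hg hh e e0.
have [a a0 ha] := hg (e / 2) ltac:(by rewrite divr_gt0).
have [b b0 hb] := hh (e / 2) ltac:(by rewrite divr_gt0).
exists (Num.min a b); first by rewrite lt_min a0.
move=> s; rewrite lt_min => /andP[/ha h1 /hb h2].
have -> : g s + h s - (g t + h t) - (dg + dh) * ofR (s - t) =
  (g s - g t - dg * ofR (s - t)) + (h s - h t - dh * ofR (s - t)) by ring.
apply: le_trans (cnD _ _) _.
by apply: le_trans (lerD h1 h2) _; rewrite -mulrDl -splitr.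
Qed.

Lemma rder_cder f (a b : C) t d : cder f (a + ofR t * b) d ->
  rder (fun s => f (a + ofR s * b)) t (d * b).
Proof.
move=> h e e0; have M0 : 0 < cn b + 1 by rewrite ltr_wpDl ?cn_ge0.
have [c c0 hc] := h (e / (cn b + 1)) ltac:(by rewrite divr_gt0).
exists (c / (cn b + 1)); first by rewrite divr_gt0.
move=> s; rewrite ltr_pdivlMr// => hs.
have E : a + ofR s * b - (a + ofR t * b) = ofR (s - t) * b by rewrite !ofRE; ring.
have := hc (a + ofR s * b); rewrite E cnM cn_ofR => H.
have {}H := H (le_lt_trans _ hs).
rewrite -mulrA [b * _]mulrC; apply: le_trans (H _) _.
  by rewrite ler_wpM2l// lerDl.
rewrite mulrCA mulrC ler_wpM2r// mulrAC -mulrA ler_piMr ?ltW//.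
by rewrite ltr_pdivrMr// mul1r ltrDl.
Qed.

(** The mean value theorem fails for complex values, so it is applied to the real function
    Re(conj(v) g) with v = g(1) - g(0): its increment is |v|^2 and its derivative is at most |v|
    M. *)
Lemma rder_mvi (g : R -> C) (dg : R -> C) (M : R) :
  (forall t : R, 0 <= t <= 1 -> rder g t (dg t)) ->
  (forall t : R, 0 <= t <= 1 -> cn (dg t) <= M) -> cn (g 1 - g 0) <= M.
Proof.
move=> hd hM; set v := g 1 - g 0.
have hphi (t : R) : 0 <= t <= 1 -> is_derive t 1 (fun s => re (v^* * g s)) (re (v^* * dg t)).
  by move=> /hd/rder_re; apply.
have := @MVT_segment R (fun s => re (v^* * g s)) (fun t => re (v^* * dg t)) 0 1 ler01.
case.
- by move=> x; rewrite in_itv /= => /andP[x0 x1]; apply: hphi; rewrite !ltW.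
- apply/continuous_in_subspaceT => x; rewrite inE /= in_itv /= => /hphi[dx _].
  exact/differentiable_continuous/derivable1_diffP.
move=> c; rewrite in_itv /= => hc; rewrite subr0 mulr1 => E.
have E2 : re (v^* * g 1) - re (v^* * g 0) = cn v ^+ 2.
  by rewrite -reB -mulrBr mulrC mulcconj.
have [->|v0] := eqVneq v 0; first by rewrite cn0; apply: le_trans (hM 0 _); rewrite ?cn_ge0// lexx ler01.
rewrite -(@ler_pM2l _ (cn v)) ?cn_gt0// -expr2 -E2 E.
apply: le_trans (ler_norm _) _; apply: le_trans (re_le_cn _) _.
by rewrite cnM cn_conj ler_wpM2l ?cn_ge0// hM.
Qed.

Definition cconvex (D : set C) := forall a b (t : R), D a -> D b -> 0 <= t <= 1 ->
  D (a + ofR t * (b - a)).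

Lemma mvi (D : set C) f (df : C -> C) (M : R) a b : cconvex D ->
  (forall z, D z -> cder f z (df z)) -> (forall z, D z -> cn (df z) <= M) ->
  D a -> D b -> cn (f b - f a) <= M * cn (b - a).
Proof.
move=> cD hd hM Da Db.
have := @rder_mvi (fun t => f (a + ofR t * (b - a)))
  (fun t => df (a + ofR t * (b - a)) * (b - a)) (M * cn (b - a)).
rewrite ofR1 mul1r ofR0 mul0r addr0 [a + (b - a)]addrC subrK; apply.
- by move=> t ht; apply: rder_cder; apply: hd; exact: cD.
- by move=> t ht; rewrite cnM ler_wpM2r ?cn_ge0// hM//; exact: cD.
Qed.

Lemma cder0_const (D : set C) f a b : cconvex D ->
  (forall z, D z -> cder f z 0) -> D a -> D b -> f b = f a.
Proof.
move=> cD h Da Db; apply/eqP; rewrite -subr_eq0; apply/eqP/cn_le0.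
rewrite -(mul0r (cn (b - a))); apply: (@mvi D f (fun=> 0)) => // z _.
by rewrite cn0.
Qed.

End ComplexCalculus.

(** * Integrals along segments *)

Section Primitives.
Variable R : realType.
Local Notation C := (Cplx R).
Implicit Types (f g : C -> C) (z w : C).

Definition ccont f z := forall e : R, 0 < e ->
  exists2 a : R, 0 < a & forall w, cn (w - z) < a -> cn (f w - f z) < e.

Lemma real_primitive (k : R -> R) : continuous k ->
  exists K : R -> R, forall t : R, 0 <= t <= 1 -> is_derive t 1 K (k t).
Proof.
(* Integrating from -1 inside [-1, 2] keeps both ends of [0, 1] in the interior, where the
   fundamental theorem gives a two-sided derivative. *)
move=> ck; exists (fun x => (\int[lebesgue_measure]_(t in `[(-1 : R), x]) k t)%R) => t /andP[t0 t1].
have [||||d1 d2] := @continuous_FTC1_closed R k (-1) t 2.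
- by lra.
- apply: continuous_compact_integrable; first exact: segment_compact.
  exact: continuous_subspaceT.
- by lra.
- exact: ck.
by split; [exact: d1|rewrite -derive1E; exact: d2].
Qed.

Lemma complex_primitive (k : R -> C) :
  (forall t (e : R), 0 < e -> exists2 a : R, 0 < a & forall s, `|s - t| < a -> cn (k s - k t) < e) ->
  exists K : R -> C, forall t : R, 0 <= t <= 1 -> rder K t (k t).
Proof.
move=> ck.
have cr (h : C -> R) : (forall a b, `|h a - h b| <= cn (a - b)) -> continuous (h \o k).
  move=> hh t A /nbhs_ballP[e /= e0 he]; apply/nbhs_ballP.
  have [a a0 ha] := ck t e e0; exists a => // s; rewrite -ball_normE /= distrC => /ha hs.
  by apply: he; rewrite -ball_normE /= distrC; apply: le_lt_trans hs.
have [K hK] := real_primitive (cr (@re R) ltac:(by move=> a b; rewrite -reB re_le_cn)).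
have [L hL] := real_primitive (cr (@im R) ltac:(by move=> a b; rewrite -imB im_le_cn)).
exists (fun t => cpx (K t) (L t)) => t t01.
have -> : k t = cpx ((@re R \o k) t) ((@im R \o k) t) by apply: cplx_ext.
by apply: rder_pair; [exact: hK|exact: hL].
Qed.

(** Retraction of the line onto [0, 1]. It extends a function along a segment continuously to all
    real parameters, as [complex_primitive] requires. *)
Definition clamp (t : R) : R := Num.max 0 (Num.min 1 t).

Lemma clamp01 t : 0 <= clamp t <= 1.
Proof. by rewrite /clamp le_max lexx /= ge_max ler01 ge_min lexx. Qed.

Lemma clamp_id (t : R) : 0 <= t <= 1 -> clamp t = t.
Proof. by move=> /andP[t0 t1]; rewrite /clamp (min_idPr t1) (max_idPr t0). Qed.

Lemma clamp_lip (s t : R) : `|clamp s - clamp t| <= `|s - t|.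
Proof.
rewrite /clamp /Num.max /Num.min.
have h5 := ler_norm (s - t); have h6 := ler_norm (t - s); rewrite distrC in h6.
rewrite ler_norml;
case: (ltP 1 s) => h1; case: (ltP 1 t) => h2;
case: (ltP 0 s) => h3; case: (ltP 0 t) => h4;
rewrite ?ltr01 /=; apply/andP; split; lra.
Qed.

(** The line integral of f from a to b, described by a primitive [K] of the pulled-back integrand;
    the increment of [K] is multiplied by the velocity b - a. *)
Definition segI f a b (I : C) := exists2 K : R -> C,
  (forall t : R, 0 <= t <= 1 -> rder K t (f (a + ofR t * (b - a)))) &
  I = (b - a) * (K 1 - K 0).

Lemma segI_exists (D : set C) f a b : cconvex D -> (forall z, D z -> ccont f z) ->
  D a -> D b -> exists I, segI f a b I.
Proof.
move=> cD cf Da Db.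
have [|K hK] := @complex_primitive (fun t => f (a + ofR (clamp t) * (b - a))).
  move=> t e e0.
  have [d d0 hd] := cf _ (cD _ _ _ Da Db (clamp01 t)) e e0.
  have M0 : 0 < cn (b - a) + 1 by rewrite ltr_wpDl ?cn_ge0.
  exists (d / (cn (b - a) + 1)); first by rewrite divr_gt0.
  move=> s; rewrite ltr_pdivlMr// => hs; apply: hd.
  have -> : a + ofR (clamp s) * (b - a) - (a + ofR (clamp t) * (b - a)) =
    ofR (clamp s - clamp t) * (b - a) by rewrite !ofRE; ring.
  rewrite cnM cn_ofR; apply: le_lt_trans hs.
  by apply: ler_pM; rewrite ?cn_ge0 ?clamp_lip ?lerDl.
exists ((b - a) * (K 1 - K 0)); exists K => // t t01.
by have := hK t t01; rewrite clamp_id.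
Qed.

Lemma rder_eq (g : R -> C) t d d' : rder g t d -> d = d' -> rder g t d'.
Proof. by move=> h <-. Qed.

Lemma rder_poly2 (c d : C) (t : R) :
  rder (fun s => c * ofR s + d * ofR s ^+ 2) t (c + 2 * d * ofR t).
Proof.
have h : cder (fun z => c * z + d * z ^+ 2) (0 + ofR t * 1) (c + 2 * d * ofR t).
  rewrite add0r mulr1; apply: cder_eq (cderD (cderZ c (cder_id _)) (cderZ d (cderX 2 (cder_id _)))) _.
  by rewrite /=; ring.
have := rder_cder h; rewrite mulr1.
by under [X in rder X]eq_fun do rewrite add0r mulr1.
Qed.

Lemma rderN (g : R -> C) t dg : rder g t dg -> rder (fun s => - g s) t (- dg).
Proof.
move=> h e /h[a a0 ha]; exists a => // s /ha.
by rewrite -cnN; congr (cn _ <= _); ring.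
Qed.

(** The affine function c + d z has an explicit quadratic primitive; subtracting it from [K] leaves
    a function whose derivative is at most M. Goursat's argument uses d = f'(x), the construction of
    primitives uses d = 0. *)
Lemma segI_est f a b I (c d : C) (M : R) : segI f a b I ->
  (forall t : R, 0 <= t <= 1 -> cn (f (a + ofR t * (b - a)) - (c + d * (a + ofR t * (b - a)))) <= M) ->
  cn (I - (c * (b - a) + d * (b ^+ 2 - a ^+ 2) / 2)) <= M * cn (b - a).
Proof.
move=> [K hK ->] hM.
pose g t := K t + - ((c + d * a) * ofR t + (d * (b - a) / 2) * ofR t ^+ 2).
have := @rder_mvi R g (fun t => f (a + ofR t * (b - a)) - (c + d * (a + ofR t * (b - a)))) M.
rewrite /g !ofRE => /(_ _ hM) H.
have -> : (b - a) * (K 1 - K 0) - (c * (b - a) + d * (b ^+ 2 - a ^+ 2) / 2) =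
  (K 1 - ((c + d * a) * 1 + d * (b - a) / 2 * 1 ^+ 2) -
      (K 0 - ((c + d * a) * 0 + d * (b - a) / 2 * 0 ^+ 2))) * (b - a) by field.
rewrite cnM; apply: ler_wpM2r; first exact: cn_ge0.
apply: H => t t01; apply: rder_eq (rderD (hK t t01) (rderN (rder_poly2 _ _ _))) _.
by field.
Qed.

Lemma segI_sub f a b K (u v : R) :
  (forall t : R, 0 <= t <= 1 -> rder K t (f (a + ofR t * (b - a)))) ->
  0 <= u <= 1 -> 0 <= v <= 1 ->
  segI f (a + ofR u * (b - a)) (a + ofR v * (b - a)) ((b - a) * (K v - K u)).
Proof.
move=> hK u01 v01.
(* The affine change of parameter divides by v - u, so the degenerate segment is integrated
   separately, with a constant integrand. *)
have [->|uv] := eqVneq u v.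
  exists (fun t => f (a + ofR v * (b - a)) * ofR t + 0 * ofR t ^+ 2).
    move=> t _; rewrite subrr mulr0 addr0.
    by apply: rder_eq (rder_poly2 _ _ _) _; ring.
  by rewrite !subrr mulr0 mul0r.
have vu0 : v - u != 0 by rewrite subr_eq0 eq_sym.
have cvu0 : ofR (v - u) != 0 by rewrite -cn_eq0 cn_ofR normr_eq0.
exists (fun t => K (u + (v - u) * t) / ofR (v - u)); last first.
  rewrite mulr1 mulr0 addr0 [u + _]addrC subrK; rewrite !ofRE in cvu0 *.
  by field.
move=> t /andP[t0 t1].
have h : 0 <= u + (v - u) * t <= 1.
  by move: u01 v01 => /andP[? ?] /andP[? ?]; apply/andP; split; nra.
move=> e e0; have := hK _ h (e) e0 => -[c c0 hc].
exists (c / `|v - u|); first by rewrite divr_gt0// normr_gt0.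
move=> s; rewrite ltr_pdivlMr ?normr_gt0// -normrM => hs.
have := hc (u + (v - u) * s).
have -> : u + (v - u) * s - (u + (v - u) * t) = (s - t) * (v - u) by ring.
move=> /(_ hs); set z1 := K _; set z2 := K _.
have -> : a + ofR u * (b - a) + ofR t * (a + ofR v * (b - a) - (a + ofR u * (b - a)))
   = a + ofR (u + (v - u) * t) * (b - a) by rewrite !ofRE; ring.
set F := f _ => H.
have -> : z1 / ofR (v - u) - z2 / ofR (v - u) - F * ofR (s - t) =
  (z1 - z2 - F * ofR ((s - t) * (v - u))) / ofR (v - u).
  rewrite !ofRE in cvu0 *; by field.
rewrite cnM cnV cn_ofR ler_pdivrMr ?normr_gt0//.
by rewrite -mulrA -normrM.
Qed.

Lemma segI_uniq f a b I J : segI f a b I -> segI f a b J -> I = J.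
Proof.
move=> [K hK ->] [L hL ->]; congr (_ * _).
have := @rder_mvi R (fun t => K t + - L t) (fun=> 0) 0.
move=> H; apply/eqP; rewrite -subr_eq0; apply/eqP/cn_le0.
have -> : K 1 - K 0 - (L 1 - L 0) = K 1 - L 1 - (K 0 - L 0) by ring.
apply: H => t t01; last by rewrite cn0.
by apply: rder_eq (rderD (hK t t01) (rderN (hL t t01))) _; rewrite subrr.
Qed.

Definition segint f a b : C := xget 0 (segI f a b).

Section OnConvex.
Variables (D : set C) (f : C -> C).
Hypotheses (cD : cconvex D) (cf : forall z, D z -> ccont f z).

Lemma segintP a b : D a -> D b -> segI f a b (segint f a b).
Proof.
by move=> Da Db; have [I hI] := segI_exists cD cf Da Db; exact: (xgetPex 0 (ex_intro _ I hI)).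
Qed.

Lemma segint_uniq a b I : segI f a b I -> segint f a b = I.
Proof. by move=> h; apply: (segI_uniq _ h); exact: (xgetPex 0 (ex_intro _ I h)). Qed.

Lemma segint_mid a b : D a -> D b ->
  segint f a b = segint f a ((a + b) / 2) + segint f ((a + b) / 2) b.
Proof.
move=> Da Db; have [I [K hK _]] := segI_exists cD cf Da Db.
have h0 : 0 <= (0 : R) <= 1 by rewrite lexx ler01.
have h1 : 0 <= (1 : R) <= 1 by rewrite lexx ler01.
have h2 : 0 <= (2^-1 : R) <= 1 by apply/andP; split; lra.
have := segI_sub hK h0 h2; have := segI_sub hK h2 h1; have := segI_sub hK h0 h1.
rewrite !ofRE !mul0r !addr0 !mul1r [a + (b - a)]addrC !subrK.
have -> : a + 2^-1 * (b - a) = (a + b) / 2 by field.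
move=> /segint_uniq -> /segint_uniq -> /segint_uniq ->; ring.
Qed.

Lemma segint_sym a b : D a -> D b -> segint f b a = - segint f a b.
Proof.
move=> Da Db; have [I [K hK _]] := segI_exists cD cf Da Db.
have h0 : 0 <= (0 : R) <= 1 by rewrite lexx ler01.
have h1 : 0 <= (1 : R) <= 1 by rewrite lexx ler01.
have := segI_sub hK h1 h0; have := segI_sub hK h0 h1.
rewrite !ofRE !mul0r !addr0 !mul1r [a + (b - a)]addrC !subrK.
move=> /segint_uniq -> /segint_uniq ->; ring.
Qed.

End OnConvex.

(** Bolzano-Weierstrass, from the compactness of the square with half side M in the plane of real
    and imaginary parts. *)
Lemma bounded_cluster (u : nat -> C) (M : R) : (forall n, cn (u n) <= M) ->
  exists x, forall e : R, 0 < e -> forall N, exists2 n, (N <= n)%N & cn (u n - x) < e.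
Proof.
move=> hu.
have cK := @compact_setX R R `[-M, M] `[-M, M] (@segment_compact R _ _) (@segment_compact R _ _).
have hF : ((fun n => (re (u n), im (u n))) @ \oo)
    ((`[-M, M] : set R) `*` (`[-M, M] : set R)).
  exists 0%N => // n _ /=; rewrite !in_itv /= -!ler_norml.
  by split; apply: le_trans (hu n); [exact: re_le_cn|exact: im_le_cn].
have [[x y] [_ hc]] := cK _ _ hF.
exists (cpx x y) => e e0 N.
have h1 : nbhs (x, y) (ball x (e/2) `*` ball y (e/2)).
  exists (ball x (e/2), ball y (e/2)) => //=.
  by split; apply: nbhsx_ballx; rewrite divr_gt0.
have h2 : ((fun n => (re (u n), im (u n))) @ \oo) [set p | exists2 n, (N <= n)%N & p = (re (u n), im (u n))].
  by exists N => // n /= Nn; exists n.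
have [p [[n Nn ->]]] := hc _ _ h2 h1.
rewrite /= -!ball_normE /= => -[b1 b2]; exists n => //.
apply: le_lt_trans (cn_le_reim _) _; rewrite !reimE.
by rewrite [e]splitr; apply: ltrD; rewrite distrC.
Qed.

End Primitives.

(** * Goursat's theorem and primitives on convex sets *)

Section Goursat.
Variable R : realType.
Local Notation C := (Cplx R).
Variables (D : set C) (f : C -> C).
Hypotheses (cD : cconvex D) (hf : forall z, D z -> exists d, cder f z d).

Lemma holo_ccont z : D z -> ccont f z.
Proof. by move=> /hf[d hd]; exact: cder_cont hd. Qed.
Let cf := holo_ccont.

Lemma half_lt_eps (M d : R) : 0 < d -> exists n : nat, M * 2^-1 ^+ n < d.
Proof.
move=> d0; have M0 : 0 < `|M| + 1 by rewrite ltr_wpDl.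
have [n hn] : exists n : nat, (`|M| + 1) / d < n%:R.
  exists (Num.trunc ((`|M| + 1) / d)).+1; exact: truncnS_gt.
exists n; rewrite exprVn; apply: (@le_lt_trans _ _ (`|M| / 2 ^+ n)).
  by apply: ler_wpM2r; rewrite ?invr_ge0 ?exprn_ge0// ler_norm.
rewrite ltr_pdivrMr ?exprn_gt0//; move: hn; rewrite ltr_pdivrMr// => hn.
have : (n%:R : R) <= 2 ^+ n by rewrite -natrX ler_nat ltnW// ltn_expl.
by nra.
Qed.

Section Triangle.
Variables (a b c : C).
Hypotheses (Da : D a) (Db : D b) (Dc : D c).

(** Affine map sending the reference triangle 0, 1, i to a, b, c. Subdivision and sizes are handled
    in the reference triangle, so a degenerate triangle a, b, c is no exception. *)
Let A (z : C) : C := a + ofR (re z) * (b - a) + ofR (im z) * (c - a).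
Let Dl (z : C) := [/\ 0 <= re z, 0 <= im z & re z + im z <= 1].
Let S z w := segint f (A z) (A w).
Let T (t : C * C * C) := S t.1.1 t.1.2 + S t.1.2 t.2 + S t.2 t.1.1.
Let in3 (t : C * C * C) := [/\ Dl t.1.1, Dl t.1.2 & Dl t.2].
Let sides (r : R) (t : C * C * C) :=
  [/\ cn (t.1.1 - t.1.2) <= r, cn (t.1.2 - t.2) <= r & cn (t.2 - t.1.1) <= r].

Let DA z : Dl z -> D (A z).
Proof.
move=> [s0 t0 st]; rewrite /A; set s := re z in s0 st *; set t := im z in t0 st *.
have [st0|st0] := eqVneq (s + t) 0.
  have [-> ->] : s = 0 /\ t = 0 by split; lra.
  by rewrite !mul0r !addr0.
have stp : 0 < s + t by rewrite lt_def st0 addr_ge0.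
have cst0 : ofR (s + t) != 0 by rewrite -cn_eq0 cn_ofR normr_eq0.
(* The point lies on the segment from a to a point of the side bc, so convexity is used twice. *)
have -> : a + ofR s * (b - a) + ofR t * (c - a) =
   a + ofR (s + t) * ((b + ofR (t / (s + t)) * (c - b)) - a).
  by rewrite !ofRE in cst0 *; field.
apply: cD => //; last by rewrite ltW.
apply: cD => //; rewrite divr_ge0 ?(ltW stp)//= ler_pdivrMr// mul1r lerDr//.
Qed.

Let mid (z w : C) := (z + w) / 2.

Let Amid z w : A (mid z w) = (A z + A w) / 2.
Proof.
rewrite /A /mid.
have h (u : C) : re (u / 2) = re u / 2 /\ im (u / 2) = im u / 2.
  rewrite -(ofRn R 2) -ofRV !reimE; split; ring.
by rewrite !(h _).1 !(h _).2 !reimE !ofRE; field.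
Qed.

Let Dmid z w : Dl z -> Dl w -> Dl (mid z w).
Proof.
move=> [a1 a2 a3] [b1 b2 b3]; rewrite /mid.
by split; rewrite -(ofRn R 2) -ofRV !reimE; lra.
Qed.

Let Smid z w : Dl z -> Dl w -> S z w = S z (mid z w) + S (mid z w) w.
Proof. by move=> hz hw; rewrite /S Amid -(segint_mid cD cf (DA hz) (DA hw)). Qed.

Let Ssym z w : Dl z -> Dl w -> S w z = - S z w.
Proof. by move=> hz hw; rewrite /S (segint_sym cD cf (DA hz) (DA hw)). Qed.

Let cn_half (z : C) : cn (z / 2) = cn z / 2.
Proof. by rewrite -(ofRn R 2) -ofRV cnM cn_ofR ger0_norm ?invr_ge0. Qed.

(** The midpoints cut a triangle into four whose inner sides cancel, so one of them carries at least
    a quarter of the integral. The hypothesis [in3 t] stands below the existential so that [choice]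
    yields a total function to iterate. *)
Let step t : exists t', in3 t -> in3 t' /\ cn (T t) <= 4 * cn (T t') /\
  forall r, sides r t -> sides (r / 2) t' /\ cn (t'.1.1 - t.1.1) <= r.
Proof.
case: t => -[z1 z2] z3; rewrite /in3 /=.
have [[h1 h2 h3]|h] := pselect [/\ Dl z1, Dl z2 & Dl z3]; last by exists (z1, z2, z3).
have m12 := Dmid h1 h2; have m23 := Dmid h2 h3; have m31 := Dmid h3 h1.
have E : T (z1, z2, z3) = T (z1, mid z1 z2, mid z3 z1) + T (mid z1 z2, z2, mid z2 z3)
  + T (mid z3 z1, mid z2 z3, z3) + T (mid z2 z3, mid z3 z1, mid z1 z2).
  rewrite /T /= (Smid h1 h2) (Smid h2 h3) (Smid h3 h1).
  rewrite (Ssym m12 m23) (Ssym m23 m31) (Ssym m31 m12); ring.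
have Hs (t' : C * C * C) : in3 t' -> cn (T (z1, z2, z3)) <= 4 * cn (T t') ->
  (forall r, sides r (z1, z2, z3) -> sides (r / 2) t' /\ cn (t'.1.1 - z1) <= r) ->
  exists t', [/\ Dl z1, Dl z2 & Dl z3] -> in3 t' /\ cn (T (z1, z2, z3)) <= 4 * cn (T t') /\
    forall r, sides r (z1, z2, z3) -> sides (r / 2) t' /\ cn (t'.1.1 - z1) <= r.
  by move=> *; exists t' => _; split.
have half (x : C) r : cn x <= r -> cn (x / 2) <= r / 2.
  by move=> h; rewrite cn_half ler_wpM2r.
have halfs (x y : C) r : cn x <= r -> y = x / 2 -> cn y <= r / 2.
  by move=> h ->; exact: half.
have r0 r : sides r (z1, z2, z3) -> 0 <= r.
  by move=> [h _ _]; apply: le_trans h; exact: cn_ge0.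
have hle (r : R) : 0 <= r -> r / 2 <= r by lra.
have [g1|g1] := leP (cn (T (z1, z2, z3))) (4 * cn (T (z1, mid z1 z2, mid z3 z1))).
  apply: (Hs (z1, mid z1 z2, mid z3 z1)) => // r hr; have r00 := r0 _ hr; case: hr => /= s1 s2 s3.
  split; last by rewrite subrr cn0.
  split => /=; [apply: (halfs _ _ _ s1)|apply: (halfs _ _ _ s2)|apply: (halfs _ _ _ s3)];
    rewrite /mid; by field.
have [g2|g2] := leP (cn (T (z1, z2, z3))) (4 * cn (T (mid z1 z2, z2, mid z2 z3))).
  apply: (Hs (mid z1 z2, z2, mid z2 z3)) => // r hr; have r00 := r0 _ hr; case: hr => /= s1 s2 s3.
  split; last first.
    apply: le_trans (hle _ r00); rewrite cnC; apply: (halfs _ _ _ s1); rewrite /mid; by field.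
  split => /=; [apply: (halfs _ _ _ s1)|apply: (halfs _ _ _ s2)|apply: (halfs _ _ _ s3)];
    rewrite /mid; by field.
have [g3|g3] := leP (cn (T (z1, z2, z3))) (4 * cn (T (mid z3 z1, mid z2 z3, z3))).
  apply: (Hs (mid z3 z1, mid z2 z3, z3)) => // r hr; have r00 := r0 _ hr; case: hr => /= s1 s2 s3.
  split; last first.
    apply: le_trans (hle _ r00); apply: (halfs _ _ _ s3); rewrite /mid; by field.
  split => /=; [apply: (halfs _ _ _ s1)|apply: (halfs _ _ _ s2)|apply: (halfs _ _ _ s3)];
    rewrite /mid; by field.
(* Only the middle triangle is left: if it failed as well, the four integrals together would be too
   small. *)
apply: (Hs (mid z2 z3, mid z3 z1, mid z1 z2)) => //.
  rewrite leNgt; apply/negP => g4.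
  have := cnD (T (z1, mid z1 z2, mid z3 z1) + T (mid z1 z2, z2, mid z2 z3)
    + T (mid z3 z1, mid z2 z3, z3)) (T (mid z2 z3, mid z3 z1, mid z1 z2)).
  have := cnD (T (z1, mid z1 z2, mid z3 z1) + T (mid z1 z2, z2, mid z2 z3))
    (T (mid z3 z1, mid z2 z3, z3)).
  have := cnD (T (z1, mid z1 z2, mid z3 z1)) (T (mid z1 z2, z2, mid z2 z3)).
  rewrite -E; lra.
move=> r hr; have r00 := r0 _ hr; case: hr => /= s1 s2 s3; split; last first.
  have -> : mid z2 z3 - z1 = (z2 - z1) / 2 + (z3 - z1) / 2 by rewrite /mid; by field.
  rewrite cnC in s1; apply: le_trans (cnD _ _) _; rewrite !cn_half; lra.
by split => /=; rewrite cnC; [apply: (halfs _ _ _ s1)|apply: (halfs _ _ _ s2)|apply: (halfs _ _ _ s3)];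
    rewrite /mid; by field.
Qed.

Lemma triangle_zero : segint f a b + segint f b c + segint f c a = 0.
Proof.
have [st hst] := choice step.
pose t0 : C * C * C := (0, 1, ci).
have A0 : A 0 = a by rewrite /A !reimE !ofRE; ring.
have A1 : A 1 = b by rewrite /A !reimE !ofRE; ring.
have A2 : A ci = c by rewrite /A !reimE !ofRE; ring.
have T0 : segint f a b + segint f b c + segint f c a = T t0 by rewrite /T /S /= A0 A1 A2.
have in0 : in3 t0 by split; split; rewrite /t0 /= ?reimE; lra.
have sd0 : sides 2 t0.
  split; rewrite /t0 /=; apply: le_trans (cnB _ _) _; rewrite ?cn_ci ?cn0 ?cn1; lra.
pose t n := iter n st t0; pose rho n : R := 2 * 2^-1 ^+ n.
have rhoS n : rho n.+1 = rho n / 2 by rewrite /rho exprS; field.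
have tin n : in3 (t n) by elim: n => // n /hst[].
have tsd n : sides (rho n) (t n).
  elim: n => [|n IH]; first by rewrite /rho expr0 mulr1.
  by have [_ [_ /(_ _ IH)[]]] := hst _ (tin n); rewrite rhoS.
have tmv n : cn ((t n.+1).1.1 - (t n).1.1) <= rho n.
  by have [_ [_ /(_ _ (tsd n))[]]] := hst _ (tin n).
have tT n : cn (T t0) <= 4 ^+ n * cn (T (t n)).
  elim: n => [|n IH]; first by rewrite expr0 mul1r.
  apply: le_trans IH _; rewrite exprSr -mulrA; apply: ler_wpM2l; first exact: exprn_ge0.
  by have [_ []] := hst _ (tin n).
(* Since [rho] halves at each step, the displacements telescope; letting j grow puts the limit point
   within 2 [rho n] of the n-th vertex. *)
have tmv2 n j : cn ((t (n + j)%N).1.1 - (t n).1.1) <= 2 * rho n - 2 * rho (n + j)%N.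
  elim: j => [|j IH]; first by rewrite addn0 !subrr cn0.
  apply: le_trans (cnDB _ _ (t (n + j)%N).1.1) _.
  rewrite addnS rhoS; have := tmv (n + j)%N; lra.
have rho0 n : 0 < rho n by rewrite /rho mulr_gt0// exprn_gt0// invr_gt0.
have [x hx] : exists x, forall e : R, 0 < e -> forall N, exists2 n, (N <= n)%N & cn ((t n).1.1 - x) < e.
  apply: (@bounded_cluster R (fun n => (t n).1.1) 4) => n.
  have := tmv2 0%N n; rewrite add0n /= subr0 => h.
  by apply: le_trans h _; have := rho0 n; rewrite /rho expr0; lra.
have xt n : cn (x - (t n).1.1) <= 2 * rho n.
  apply/ler_addgt0Pr => e e0; have [m nm hm] := hx e e0 n.
  apply: le_trans (cnDB _ _ (t m).1.1) _; rewrite cnC.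
  have := tmv2 n (m - n)%N; rewrite subnKC// => h; have := rho0 m; lra.
have Dx : Dl x.
  (* The reference triangle is cut out by three Lipschitz inequalities, and each of them passes to
     the limit point. *)
  have lim (g : C -> R) (k : R) : (forall u v, g u - g v <= k * cn (u - v)) -> 0 <= k ->
      (forall u, Dl u -> 0 <= g u) -> 0 <= g x.
    move=> gl k0 gp; rewrite leNgt; apply/negP => gx.
    have [n _ hn] := hx (- g x / (k + 1)) ltac:(by rewrite divr_gt0 ?oppr_gt0 ?ltr_wpDl) 0%N.
    have [h1 _ _] := tin n; have h2 := gl (t n).1.1 x; have h3 := gp _ h1.
    move: hn; rewrite ltr_pdivlMr ?ltr_wpDl//.
    have := cn_ge0 ((t n).1.1 - x); nra.
  have hre (u v : C) : `|re u - re v| <= cn (u - v) by rewrite -reB re_le_cn.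
  have him (u v : C) : `|im u - im v| <= cn (u - v) by rewrite -imB im_le_cn.
  split.
  - apply: (lim (@re R) 1) => // [u v|u []//].
    by rewrite mul1r; exact: le_trans (ler_norm _) (hre _ _).
  - apply: (lim (@im R) 1) => // [u v|u []//].
    by rewrite mul1r; exact: le_trans (ler_norm _) (him _ _).
  - rewrite -subr_ge0; apply: (lim (fun z => 1 - (re z + im z)) 2) => // [u v|u [_ _]]; last by lra.
    have := hre u v; have := him u v; rewrite !ler_norml => /andP[? ?] /andP[? ?]; lra.
have [d hd] := hf (DA Dx).
rewrite T0; apply: cn_le0.
pose M := cn (b - a) + cn (c - a) + 1.
have M0 : 0 < M by rewrite /M; have := cn_ge0 (b - a); have := cn_ge0 (c - a); lra.
have Alip z w : cn (A z - A w) <= M * cn (z - w).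
  have -> : A z - A w = ofR (re (z - w)) * (b - a) + ofR (im (z - w)) * (c - a).
    by rewrite /A !reimE !ofRE; ring.
  apply: le_trans (cnD _ _) _; rewrite !cnM !cn_ofR.
  have := re_le_cn (z - w); have := im_le_cn (z - w).
  rewrite /M; move: (cn_ge0 (b - a)) (cn_ge0 (c - a)) (cn_ge0 (z - w)); nra.
apply/ler_addgt0Pr => e' e'0; rewrite add0r.
(* 48 = 3 * 4 * 4: three sides, points at distance up to 4 [rho n] from the limit point, and 4^n
   ([rho n])^2 = 4. *)
have [e e0 eE] : exists2 e : R, 0 < e & 48 * e * M ^+ 2 = e'.
  exists (e' / 48 / M ^+ 2); first by rewrite ?divr_gt0 ?exprn_gt0 ?ltr0n.
  have Mn : M != 0 by rewrite gt_eqF.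
  by field.
have [dl dl0 hdl] := hd e e0.
have [n hn] := half_lt_eps (M * 8) dl0.
have hn' : M * (4 * rho n) < dl by move: hn; rewrite /rho; congr (_ < _); ring.
have [i1 i2 i3] := tin n; have [s1 s2 s3] := tsd n.
move: (xt n) (tT n) i1 i2 i3 s1 s2 s3.
case: (t n) => -[z1 z2] z3 /= hx1 hT i1 i2 i3 s1 s2 s3.
have side u v : Dl u -> Dl v -> cn (u - v) <= rho n -> cn (z1 - u) <= rho n ->
  cn (S u v - ((f (A x) - d * A x) * (A v - A u) + d * (A v ^+ 2 - A u ^+ 2) / 2)) <=
  e * (M * (4 * rho n)) * (M * rho n).
  move=> hu hv uv zu.
  apply: le_trans (segI_est (M := e * (M * (4 * rho n))) (segintP cD cf (DA hu) (DA hv)) _) _.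
    move=> s /andP[s0 s1'].
    set p := A u + ofR s * (A v - A u).
    have pE : p = A (u + ofR s * (v - u)) by rewrite /p /A !reimE !ofRE; ring.
    have -> : f p - (f (A x) - d * A x + d * p) = f p - f (A x) - d * (p - A x) by ring.
    have px : cn (p - A x) <= M * (4 * rho n).
      rewrite pE; apply: le_trans (Alip _ _) _; rewrite ler_pM2l//.
      (* The three summands are at most [rho n], 2 [rho n] and [rho n]. *)
      have -> : u + ofR s * (v - u) - x = (u - z1) + (z1 - x) + ofR s * (v - u) by ring.
      apply: le_trans (cnD _ _) _; rewrite cnM cn_ofR ger0_norm//.
      have := cnD (u - z1) (z1 - x); rewrite (cnC u) (cnC z1 x) (cnC v).
      by have := cn_ge0 (u - v); nra.
    apply: le_trans (hdl p (le_lt_trans px hn')) _.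
    by rewrite ler_pM2l.
  apply: ler_wpM2l; first by rewrite !mulr_ge0// ltW.
  apply: le_trans (Alip _ _) _; rewrite ler_pM2l// cnC//.
have a1 := side _ _ i1 i2 s1 ltac:(by rewrite subrr cn0 ltW).
have a2 := side _ _ i2 i3 s2 s1.
have a3 := side _ _ i3 i1 s3 ltac:(by rewrite cnC).
set B := e * _ * _ in a1 a2 a3.
have hTB : cn (T (z1, z2, z3)) <= 3 * B.
  rewrite /T /=; move: a1 a2 a3.
  set x1 := _ - _; set x2 := _ - (_ + _); set x3 := _ - (_ + _) => a1 a2 a3.
  have -> : S z1 z2 + S z2 z3 + S z3 z1 = x1 + x2 + x3 by rewrite /x1 /x2 /x3; field.
  have := cnD (x1 + x2) x3; have := cnD x1 x2; lra.
apply: le_trans hT _; apply: le_trans (ler_wpM2l _ hTB) _; first exact: exprn_ge0.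
rewrite le_eqVlt; apply/orP; left; apply/eqP.
rewrite -eE /B /rho.
have : (4 : R) ^+ n * (2^-1 ^+ n * 2^-1 ^+ n) = 1.
  by rewrite -!exprMn (_ : 4 * _ = 1) ?expr1n//; field.
move=> h; transitivity (48 * e * M ^+ 2 * (4 ^+ n * (2^-1 ^+ n * 2^-1 ^+ n))); last by rewrite h mulr1.
ring.
Qed.

End Triangle.

(** Integrate from a fixed point along segments. By [triangle_zero] the increment from z to w is the
    integral over the segment from z to w, which continuity compares with f(z) (w - z). *)
Theorem convex_primitive : open D -> exists F : C -> C, forall z, D z -> cder F z (f z).
Proof.
move=> /copenP oD.
have [[a Da]|D0] := pselect (D !=set0); last first.
  by exists (fun=> 0) => z Dz; exfalso; apply: D0; exists z.
exists (fun z => segint f a z) => z Dz e e0.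
have [r r0 hr] := oD _ Dz; have [s s0 hs] := cf Dz e0.
exists (Num.min r s); first by rewrite lt_min r0.
move=> w; rewrite lt_min => /andP[wr ws].
have Dw := hr _ wr.
have -> : segint f a w - segint f a z = segint f z w.
  have := triangle_zero Da Dz Dw; rewrite (segint_sym cD cf Da Dw) => /eqP.
  rewrite subr_eq0 => /eqP <-; ring.
have := segI_est (c := f z) (d := 0) (M := e) (segintP cD cf Dz Dw).
rewrite !mul0r addr0; apply=> t /andP[t0 t1].
rewrite mul0r addr0; apply/ltW/hs; rewrite [z + _]addrC addrK cnM cn_ofR ger0_norm//.
by apply: le_lt_trans ws; rewrite ler_piMl ?cn_ge0.
Qed.

End Goursat.

(** * The complex exponential *)

Section Exponential.
Variable R : realType.
Local Notation C := (Cplx R).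
Implicit Types (f g : C -> C) (z w : C).

Definition cexp z : C := cpx (expR (re z) * cos (im z)) (expR (re z) * sin (im z)).

Lemma cexp0 : cexp 0 = 1.
Proof. by apply: cplx_ext; rewrite /cexp !reimE expR0 ?cos0 ?sin0; ring. Qed.

Lemma cexpD z w : cexp (z + w) = cexp z * cexp w.
Proof.
by apply: cplx_ext; rewrite /cexp !reimE expRD ?cosD ?sinD; ring.
Qed.

Lemma cn_cexp z : cn (cexp z) = expR (re z).
Proof.
apply/eqP; rewrite -(@eqrXn2 _ 2) ?cn_ge0 ?expR_ge0// cn_sqr /cexp !reimE.
by rewrite !exprMn -mulrDr cos2Dsin2 mulr1.
Qed.

Lemma cexp_neq0 z : cexp z != 0.
Proof. by rewrite -cn_gt0 cn_cexp expR_gt0. Qed.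

Lemma cexpN z : cexp (- z) = (cexp z)^-1.
Proof. by apply: (mulfI (cexp_neq0 z)); rewrite -cexpD subrr cexp0 divff ?cexp_neq0. Qed.

Lemma cexp_ofR (x : R) : cexp (ofR x) = ofR (expR x).
Proof. by apply: cplx_ext; rewrite /cexp !reimE ?cos0 ?sin0; ring. Qed.

Lemma cexp_conj z : cexp (z^*) = (cexp z)^*.
Proof. by apply: cplx_ext; rewrite /cexp !reimE ?cosN ?sinN; ring. Qed.

Lemma cexpMn z n : cexp (n%:R * z) = cexp z ^+ n.
Proof.
elim: n => [|n IH]; first by rewrite mul0r cexp0.
by rewrite exprS -IH -cexpD; congr cexp; rewrite -natr1; ring.
Qed.

Lemma cder_cexp0 : cder cexp 0 1.
Proof.
have hexp : is_derive (0 : R) 1 (@expR R) 1 by rewrite -[X in is_derive _ _ _ X]expR0; exact: is_derive_expR.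
have hcos : is_derive (0 : R) 1 (@cos R) 0 by have := is_derive_cos (0 : R); rewrite sin0 oppr0.
have hsin : is_derive (0 : R) 1 (@sin R) 1 by have := is_derive_sin (0 : R); rewrite cos0.
move=> e e0.
(* The real part of the remainder will take three shares of e/8 and the imaginary part four; the cap
   1 serves to bound the factor [expR (re w)] by 2. *)
have e8 : 0 < Num.min 1 (e / 8) by rewrite lt_min ltr01 divr_gt0.
have [a a0 ha] := (real_derP _ _ _).1 hexp _ e8.
have [b b0 hb] := (real_derP _ _ _).1 hcos _ e8.
have [c c0 hc] := (real_derP _ _ _).1 hsin _ e8.
exists (Num.min (Num.min a b) (Num.min c (Num.min (2^-1) (e / 8)))).
  by rewrite !lt_min a0 b0 c0 invr_gt0 divr_gt0 //= ltr0n.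
move=> w; rewrite !lt_min subr0 cexp0 mul1r => /andP[/andP[wa wb] /andP[wc /andP[w1 we]]].
have hx := re_le_cn w; have hy := im_le_cn w.
have := ha (re w); have := hb (im w); have := hc (im w).
rewrite !subr0 expR0 cos0 sin0 !subr0 !mul1r mul0r subr0.
move=> /(_ (le_lt_trans hy wc)) h1 /(_ (le_lt_trans hy wb)) h2 /(_ (le_lt_trans hx wa)) h3.
set m := Num.min 1 (e / 8) in h1 h2 h3.
have m1 : m <= 1 by rewrite ge_min lexx.
have me : m <= e / 8 by rewrite ge_min lexx orbT.
have m0 : 0 <= m by exact: ltW.
apply: le_trans (cn_le_reim _) _; rewrite /cexp !reimE.
set X := expR _ in h3 *; set x := re w in hx h3 *; set y := im w in hy h1 h2 *.
set t := cn w in w1 we hx hy *; have t0 : 0 <= t by exact: cn_ge0.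
have -> : X * cos y - 1 - x = X * (cos y - 1) + (X - 1 - x) by ring.
have -> : X * sin y - 0 - y = X * (sin y - y) + (X - 1 - x) * y + x * y by ring.
have hX : `|X| <= 2.
  have -> : X = (X - 1 - x) + (1 + x) by ring.
  apply: le_trans (ler_normD _ _) _; apply: le_trans (lerD h3 (ler_normD _ _)) _.
  by rewrite normr1; have := normr_ge0 x; nra.
have k1 : `|X * (cos y - 1) + (X - 1 - x)| <= 3 * (e / 8) * t.
  apply: le_trans (ler_normD _ _) _; rewrite normrM.
  have := normr_ge0 x; have := normr_ge0 y; have := normr_ge0 X; have := normr_ge0 (cos y - 1).
  move: hX h2 h3 hx hy me m0; set A := `|X|; set B := `|cos y - 1|; set D := `|X - 1 - x|; set a1 := `|x|; set a2 := `|y| => *.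
  have k1 : A * B <= 2 * (m * a2) by apply: ler_pM.
  have k2 : m * a2 <= e / 8 * t by apply: ler_pM.
  have k3 : m * a1 <= e / 8 * t by apply: ler_pM.
  lra.
have k2 : `|X * (sin y - y) + (X - 1 - x) * y + x * y| <= 4 * (e / 8) * t.
  apply: le_trans (ler_normD _ _) _; apply: le_trans (lerD (ler_normD _ _) (lexx _)) _; rewrite !normrM.
  have := normr_ge0 x; have := normr_ge0 y; have := normr_ge0 X; have := normr_ge0 (sin y - y).
  have := normr_ge0 (X - 1 - x).
  move: hX h1 h3 hx hy me m0; set A := `|X|; set B := `|sin y - y|; set D := `|X - 1 - x|; set a1 := `|x|; set a2 := `|y| => *.
  have k1' : A * B <= 2 * (m * a2) by apply: ler_pM.
  have k2 : m * a2 <= e / 8 * t by apply: ler_pM.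
  have k3 : m * a1 <= e / 8 * t by apply: ler_pM.
  have k4 : a1 * a2 <= e / 8 * t by apply: ler_pM => //; lra.
  have k5 : D * a2 <= (m * a1) * a2 by apply: ler_wpM2r.
  have k6 : m * a1 * a2 <= a1 * a2 by rewrite -mulrA ler_piMl// mulr_ge0.
  lra.
apply: le_trans (lerD k1 k2) _; have : 0 <= e * t by apply: mulr_ge0 => //; exact: ltW.
lra.
Qed.

Lemma cder_cexp z : cder cexp z (cexp z).
Proof.
have -> : cexp = fun w => cexp z * cexp (w - z).
  by apply/funext => w; rewrite -cexpD addrC subrK.
have h1 : cder (fun w => w - z) z 1.
  by have := cderB (cder_id z) (cder_cst z z); rewrite subr0.
have h2 : cder cexp (z - z) 1.
  by rewrite subrr; exact: cder_cexp0.
apply: cder_eq (cderZ (cexp z) (cder_comp h1 h2)) _.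
by rewrite subrr cexp0 !mulr1.
Qed.

(** Polar coordinates. The arccosine only supplies arguments in [0, pi], so points of the lower half
    plane take its opposite. *)
Lemma cexp_surj w : w != 0 -> exists z, cexp z = w.
Proof.
move=> w0; have c0 : 0 < cn w by rewrite cn_gt0.
have hs : re w ^+ 2 + im w ^+ 2 = cn w ^+ 2 by rewrite cn_sqr.
have hx : -1 <= re w / cn w <= 1.
  by rewrite -ler_norml normrM normfV [`|cn w|]ger0_norm ?cn_ge0// ler_pdivrMr// mul1r re_le_cn.
have hsin : sin (acos (re w / cn w)) = `|im w| / cn w.
  rewrite sin_acos//.
  have -> : 1 - (re w / cn w) ^+ 2 = (im w / cn w) ^+ 2.
    by rewrite !expr_div_n -[1](@divff _ (cn w ^+ 2)) ?gt_eqF ?exprn_gt0// -mulrBl -hs; congr (_ / _); ring.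
  by rewrite sqrtr_sqr normrM normfV [`|cn w|]ger0_norm ?cn_ge0.
have hcos : cos (acos (re w / cn w)) = re w / cn w by apply: acosK; rewrite in_itv.
have [i0|i0] := leP 0 (im w).
  exists (cpx (ln (cn w)) (acos (re w / cn w))).
  apply: cplx_ext; rewrite /cexp !reimE lnK ?posrE// ?hcos ?hsin ?(ger0_norm i0);
    by rewrite mulrC divfK ?gt_eqF.
exists (cpx (ln (cn w)) (- acos (re w / cn w))).
apply: cplx_ext; rewrite /cexp !reimE lnK ?posrE// ?cosN ?sinN ?hcos ?hsin ?(ltr0_norm i0).
  by rewrite mulrC divfK ?gt_eqF.
by rewrite mulNr opprK mulrC divfK ?gt_eqF.
Qed.

End Exponential.

(** * Integrals over a period and shifts of contour *)

Section PeriodicCauchy.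
Variable R : realType.
Local Notation C := (Cplx R).
Implicit Types (f g h : C -> C) (z w : C) (D E : set C).

(** e^{i pi z}: it has period 2, the length of the interval, and maps the upper half plane onto the
    punctured unit disc. *)
Definition ce z : C := cexp (ci * ofR pi * z).

Lemma ceD z w : ce (z + w) = ce z * ce w.
Proof. by rewrite /ce mulrDr cexpD. Qed.
Lemma ce0 : ce 0 = 1. Proof. by rewrite /ce mulr0 cexp0. Qed.
Lemma ce_neq0 z : ce z != 0. Proof. exact: cexp_neq0. Qed.
Lemma ceN z : ce (- z) = (ce z)^-1. Proof. by rewrite /ce mulrN cexpN. Qed.
Lemma ceB z w : ce (z - w) = ce z / ce w. Proof. by rewrite ceD ceN. Qed.
Lemma cn_ce z : cn (ce z) = expR (- pi * im z).
Proof. by rewrite /ce cn_cexp !reimE; congr expR; ring. Qed.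
Lemma ce_re (z : C) : ce z = ofR (expR (- pi * im z)) * expi (pi * re z).
Proof.
have -> : expi (pi * re z) = cpx (cos (pi * re z)) (sin (pi * re z)) by [].
have h1 : re (ci * ofR pi * z) = - pi * im z by rewrite !reimE; ring.
have h2 : im (ci * ofR pi * z) = pi * re z by rewrite !reimE; ring.
by apply: cplx_ext; rewrite /ce /cexp h1 h2 !reimE ?mul0r ?subr0 ?addr0.
Qed.
Lemma ce2 : ce 2 = 1.
Proof.
have two : (2 : C) = ofR 2 by rewrite ofRn.
have h1 : re (ci * ofR pi * 2 : C) = 0 by rewrite two !reimE; ring.
have h2 : im (ci * ofR pi * 2 : C) = pi *+ 2 :> R by rewrite two !reimE; ring.
by apply: cplx_ext; rewrite /ce /cexp h1 h2 !reimE expR0 ?cos2pi ?sin2pi ?mulr1 ?mulr0.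
Qed.
Lemma ce_period z : ce (z + 2) = ce z.
Proof. by rewrite ceD ce2 mulr1. Qed.
Lemma cder_ce z : cder ce z (ci * ofR pi * ce z).
Proof.
have h1 : cder (fun w => ci * ofR pi * w) z (ci * ofR pi).
  by apply: cder_eq (cderZ _ (cder_id z)) _; rewrite mulr1.
by apply: cder_eq (cder_comp h1 (cder_cexp _)) _; rewrite mulrC.
Qed.

(** The value 1 forces imaginary part 0 by the modulus, and then sin(pi Re(z) / 2) = 0 by the
    half-angle formula, whereas this sine is positive for real parts between 0 and 2. *)
Lemma ce_neq1 z : (im z != 0) || (0 < re z < 2) -> ce z != 1.
Proof.
move=> h; apply/eqP => z1.
have i0 : im z = 0.
  have := congr1 (@cn R) z1; rewrite cn_ce cn1 -[1 in RHS](@expR0 R) => /expR_inj/eqP.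
  by rewrite mulf_eq0 oppr_eq0 gt_eqF ?pi_gt0//= => /eqP.
move: h; rewrite i0 eqxx /= => /andP[x0 x2].
have := congr1 (@re R) z1; rewrite ce_re i0 mulr0 expR0 mul1r => c1.
have {}c1 : cos (pi * re z) = 1 by [].
have : sin (pi * re z / 2) ^+ 2 = 0.
  have E : pi * re z = (pi * re z / 2) *+ 2 by rewrite -mulr_natr; field.
  have := cos2Dsin2 (pi * re z / 2); move: c1; rewrite {1}E cos_mulr2n; lra.
move/eqP; rewrite sqrf_eq0; apply/negP; rewrite gt_eqF//.
have := pi_gt0 R => p0; apply: sin_gt0_pi; apply/andP; split; nra.
Qed.

(** The values -i, i, 1, -1 of c give the open half planes above, below, to the right and to the
    left of a. *)
Definition hplane (c a : C) : set C := [set z | 0 < re (c * (z - a))].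

Lemma hplane_convex c a : cconvex (hplane c a).
Proof.
move=> z w t; rewrite /hplane /= => hz hw /andP[t0 t1].
have -> : c * (z + ofR t * (w - z) - a) =
  ofR (1 - t) * (c * (z - a)) + ofR t * (c * (w - a)) by rewrite !ofRE; ring.
rewrite reD; have -> (x : R) u : re (ofR x * u) = x * re u by rewrite !reimE; ring.
have -> (x : R) u : re (ofR x * u) = x * re u by rewrite !reimE; ring.
have [->|tn] := eqVneq t 0; first by rewrite subr0 mul0r mul1r addr0.
have tp : 0 < t by rewrite lt_def tn.
by apply: ltr_wpDl; [rewrite mulr_ge0 ?subr_ge0// ltW|rewrite mulr_gt0].
Qed.

Lemma hplane_open c a : open (hplane c a).
Proof.
apply/copenP => z hz; have M0 : 0 < cn c + 1 by rewrite ltr_wpDl ?cn_ge0.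
exists (re (c * (z - a)) / (cn c + 1)); first by rewrite divr_gt0.
move=> w; rewrite ltr_pdivlMr// => hw; rewrite /hplane /=.
have -> : c * (w - a) = c * (z - a) + c * (w - z) by ring.
rewrite reD; have := re_le_cn (c * (w - z)); rewrite cnM ler_norml => /andP[h _].
have := cn_ge0 (w - z); nra.
Qed.

Lemma cconvexI D E : cconvex D -> cconvex E -> cconvex (D `&` E).
Proof. by move=> cD cE z w t [? ?] [? ?] ht; split; [exact: cD|exact: cE]. Qed.

Definition cball a (r : R) : set C := [set z | cn (z - a) < r].

Lemma cball_convex a r : cconvex (cball a r).
Proof.
move=> z w t; rewrite /cball /= => hz hw /andP[t0 t1].
have -> : z + ofR t * (w - z) - a = ofR (1 - t) * (z - a) + ofR t * (w - a).
  by rewrite !ofRE; ring.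
apply: le_lt_trans (cnD _ _) _; rewrite !cnM !cn_ofR !ger0_norm ?subr_ge0//.
have [->|tn] := eqVneq t 0; first by rewrite subr0 mul0r mul1r addr0.
have tp : 0 < t by rewrite lt_def tn.
have -> : r = (1 - t) * r + t * r by ring.
apply: ler_ltD; last by rewrite ltr_pM2l.
by apply: ler_wpM2l; [rewrite subr_ge0|apply: ltW].
Qed.

Lemma cball_open a r : open (cball a r).
Proof.
apply/copenP => z hz; exists (r - cn (z - a)); first by rewrite subr_gt0.
move=> w hw; rewrite /cball /=; apply: le_lt_trans (cnDB _ _ z) _; lra.
Qed.

Lemma prim_diff E h Q1 Q2 a b : cconvex E ->
  (forall z, E z -> cder Q1 z (h z)) -> (forall z, E z -> cder Q2 z (h z)) ->
  E a -> E b -> Q1 b - Q1 a = Q2 b - Q2 a.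
Proof.
move=> cE h1 h2 Ea Eb.
have : Q1 b - Q2 b = Q1 a - Q2 a.
  apply: (@cder0_const R E (fun z => Q1 z - Q2 z)) => // z Ez.
  by apply: cder_eq (cderB (h1 z Ez) (h2 z Ez)) _; rewrite subrr.
move=> e; have -> : Q1 b = Q1 b - Q2 b + Q2 b by ring.
by rewrite e; ring.
Qed.

Lemma cder_shift f z c d : cder f (z + c) d -> cder (fun w => f (w + c)) z d.
Proof.
move=> h; have h1 := cderD (cder_id z) (cder_cst c z).
by apply: cder_eq (cder_comp h1 h) _; rewrite addr0 mulr1.
Qed.

(** Q(z + c) - Q(z) has derivative 0. This is the device that moves an integral over a period from
    one starting point to another. *)
Lemma period_const E h Q (c v w : C) : cconvex E ->
  (forall z, E z -> cder Q z (h z)) -> (forall z, E z -> E (z + c) -> h (z + c) = h z) ->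
  E v -> E (v + c) -> E w -> E (w + c) -> Q (v + c) - Q v = Q (w + c) - Q w.
Proof.
move=> cE hQ hp Ev Evc Ew Ewc.
apply: (@cder0_const R (E `&` [set z | E (z + c)]) (fun z => Q (z + c) - Q z)); rewrite //=.
- move=> x y t [Ex Exc] [Ey Eyc] ht; split; first exact: cE.
  rewrite /=; have -> : x + ofR t * (y - x) + c = x + c + ofR t * (y + c - (x + c)) by ring.
  exact: cE.
- move=> z [Ez Ezc]; apply: cder_eq (cderB (cder_shift (hQ _ Ezc)) (hQ _ Ez)) _.
  by rewrite hp// subrr.
Qed.

(* The poles [w0] and [w0 + 2] are bypassed through the strip between them;
   the four short connecting segments have length [2 d]. *)
Lemma strip_residue D H w0 (M r : R) Qp Qm : cconvex D -> open D -> 0 < r ->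
  cball w0 r `<=` D -> cball (w0 + 2) r `<=` D ->
  (forall z, D z -> (im z != im w0) || (re w0 < re z < re w0 + 2) -> exists d, cder H z d) ->
  (forall z, cball w0 r z -> z != w0 -> cn (H z) <= M) ->
  (forall z, cball (w0 + 2) r z -> z != w0 + 2 -> cn (H z) <= M) ->
  (forall z, (D `&` hplane (- ci) w0) z -> cder Qp z (H z)) ->
  (forall z, (D `&` hplane ci w0) z -> cder Qm z (H z)) ->
  (forall z, D z -> D (z + 2) -> im z != im w0 -> H (z + 2) = H z) ->
  forall v w, (D `&` hplane (- ci) w0) v -> (D `&` hplane (- ci) w0) (v + 2) ->
   (D `&` hplane ci w0) w -> (D `&` hplane ci w0) (w + 2) ->
   Qp (v + 2) - Qp v = Qm (w + 2) - Qm w.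
Proof.
move=> cD oD r0 B1 B2 hH hM1 hM2 hQp hQm hper v w Dv Dv2 Dw Dw2.
have two : (2 : C) = ofR 2 by rewrite ofRn.
have up z : hplane (- ci) w0 z <-> im w0 < im z.
  by rewrite /hplane /= !reimE; split; lra.
have lo z : hplane ci w0 z <-> im z < im w0.
  by rewrite /hplane /= !reimE; split; lra.
have rt z : hplane 1 w0 z <-> re w0 < re z.
  by rewrite /hplane /= !reimE; split; lra.
have lf z : hplane (-1) (w0 + 2) z <-> re z < re w0 + 2.
  by rewrite /hplane /= two !reimE; split; lra.
set Dp := D `&` hplane (- ci) w0 in hQp Dv Dv2 *.
set Dm := D `&` hplane ci w0 in hQm Dw Dw2 *.
have cDp : cconvex Dp by apply: cconvexI => //; exact: hplane_convex.
have cDm : cconvex Dm by apply: cconvexI => //; exact: hplane_convex.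
(* The open strip between the two poles contains no singularity of [H], so a primitive there
   connects the upper side with the lower one. *)
pose D0 := D `&` (hplane 1 w0 `&` hplane (-1) (w0 + 2)).
have cD0 : cconvex D0 by do 2?[apply: cconvexI => //; try exact: hplane_convex].
have oD0 : open D0 by do 2?[apply: openI => //; try exact: hplane_open].
have [z|Q0 hQ0] := @convex_primitive R D0 H cD0 _ oD0.
  by move=> [Dz [/rt z1 /lf z2]]; apply: hH => //; rewrite z1 z2 orbT.
apply/eqP; rewrite -subr_eq0; apply/eqP/cn_le0/ler_addgt0Pr => e e0; rewrite add0r.
have M0 : 0 <= M.
  apply: le_trans (cn_ge0 _) (hM1 (w0 + ofR (r / 2)) _ _).
    by rewrite /cball /= [w0 + _]addrC addrK cn_ofR gtr0_norm ?divr_gt0//; lra.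
  by rewrite -subr_eq0 [w0 + _]addrC addrK -cn_eq0 cn_ofR normr_eq0 gt_eqF ?divr_gt0.
(* The first bound keeps the corners near a pole inside the balls, the second keeps abscissas d and
   2 - d between the poles, the third makes four segments of length 2 d contribute at most e. *)
pose d := Num.min (Num.min (r / 4) (2^-1)) (e / (8 * (M + 1))).
have d0 : 0 < d by rewrite !lt_min !divr_gt0 ?invr_gt0 ?mulr_gt0 ?ltr_wpDl.
have dr : d <= r / 4 by rewrite !ge_min lexx.
have d1 : d <= 2^-1 by rewrite !ge_min lexx orbT.
have de : 8 * M * d <= e.
  have : d <= e / (8 * (M + 1)) by rewrite !ge_min lexx orbT.
  by rewrite ler_pdivlMr ?mulr_gt0 ?ltr_wpDl//; nra.
pose pt (s t : R) : C := w0 + cpx s t.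
have ptB s t : (cn (pt s t - w0)) <= `|s| + `|t|.
  by rewrite /pt [w0 + _]addrC addrK; exact: cn_le_reim.
have pt2 s t : pt (2 + s) t = pt s t + 2.
  by rewrite /pt two; apply: cplx_ext; rewrite !reimE; ring.
have ptr s t : re (pt s t) = re w0 + s by rewrite /pt !reimE.
have pti s t : im (pt s t) = im w0 + t by rewrite /pt !reimE.
have absd : `|d| = d by rewrite gtr0_norm.
have inB s t : `|s| = d -> `|t| = d -> cball w0 r (pt s t).
  by move=> h1 h2; rewrite /cball /=; apply: le_lt_trans (ptB _ _) _; rewrite h1 h2; lra.
have inB2 s t : `|s| = d -> `|t| = d -> cball (w0 + 2) r (pt (2 + s) t).
  move=> h1 h2; rewrite pt2 /cball /=; have -> : pt s t + 2 - (w0 + 2) = pt s t - w0 by ring.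
  exact: inB.
have inD s t : `|s| = d -> `|t| = d -> D (pt s t) by move=> *; apply: B1; exact: inB.
have inD2 s t : `|s| = d -> `|t| = d -> D (pt (2 + s) t) by move=> *; apply: B2; exact: inB2.
have absN : `|- d| = d by rewrite normrN.
have b1 : cn (Qp (pt d d) - Qp (pt (- d) d)) <= M * (2 * d).
  have -> : 2 * d = cn (pt d d - pt (- d) d).
    have -> : pt d d - pt (- d) d = ofR (2 * d) by apply: cplx_ext; rewrite !reimE; ring.
    by rewrite cn_ofR gtr0_norm// mulr_gt0.
  apply: (@mvi R (cball w0 r `&` hplane (- ci) w0) Qp H).
  - by apply: cconvexI; [exact: cball_convex|exact: hplane_convex].
  - by move=> z [zB zU]; apply: hQp; split => //; exact: B1.
  - move=> z [zB /up zU]; apply: hM1 => //; apply/eqP => zE.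
    by move: zU; rewrite zE ltxx.
  - by split; [exact: inB|apply/up; rewrite pti; lra].
  - by split; [exact: inB|apply/up; rewrite pti; lra].
have b2 : cn (Qm (pt d (- d)) - Qm (pt (- d) (- d))) <= M * (2 * d).
  have -> : 2 * d = cn (pt d (- d) - pt (- d) (- d)).
    have -> : pt d (- d) - pt (- d) (- d) = ofR (2 * d) by apply: cplx_ext; rewrite !reimE; ring.
    by rewrite cn_ofR gtr0_norm// mulr_gt0.
  apply: (@mvi R (cball w0 r `&` hplane ci w0) Qm H).
  - by apply: cconvexI; [exact: cball_convex|exact: hplane_convex].
  - by move=> z [zB zU]; apply: hQm; split => //; exact: B1.
  - move=> z [zB /lo zU]; apply: hM1 => //; apply/eqP => zE.
    by move: zU; rewrite zE ltxx.
  - by split; [exact: inB|apply/lo; rewrite pti; lra].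
  - by split; [exact: inB|apply/lo; rewrite pti; lra].
have b3 : cn (Q0 (pt d d) - Q0 (pt d (- d))) <= M * (2 * d).
  have -> : 2 * d = cn (pt d d - pt d (- d)).
    have -> : pt d d - pt d (- d) = ofR (2 * d) * ci by apply: cplx_ext; rewrite !reimE; ring.
    by rewrite cnM cn_ci mulr1 cn_ofR gtr0_norm// mulr_gt0.
  apply: (@mvi R (cball w0 r `&` (hplane 1 w0 `&` hplane (-1) (w0 + 2))) Q0 H).
  - by do 2?[apply: cconvexI]; [exact: cball_convex|exact: hplane_convex|exact: hplane_convex].
  - by move=> z [zB zU]; apply: hQ0; split => //; exact: B1.
  - move=> z [zB [/rt zU _]]; apply: hM1 => //; apply/eqP => zE.
    by move: zU; rewrite zE ltxx.
  - by split; [exact: inB|split; [apply/rt|apply/lf]; rewrite ptr; lra].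
  - by split; [exact: inB|split; [apply/rt|apply/lf]; rewrite ptr; lra].
have b4 : cn (Q0 (pt (2 - d) d) - Q0 (pt (2 - d) (- d))) <= M * (2 * d).
  have -> : 2 * d = cn (pt (2 - d) d - pt (2 - d) (- d)).
    have -> : pt (2 - d) d - pt (2 - d) (- d) = ofR (2 * d) * ci by apply: cplx_ext; rewrite !reimE; ring.
    by rewrite cnM cn_ci mulr1 cn_ofR gtr0_norm// mulr_gt0.
  apply: (@mvi R (cball (w0 + 2) r `&` (hplane 1 w0 `&` hplane (-1) (w0 + 2))) Q0 H).
  - by do 2?[apply: cconvexI]; [exact: cball_convex|exact: hplane_convex|exact: hplane_convex].
  - by move=> z [zB zU]; apply: hQ0; split => //; exact: B2.
  - move=> z [zB [_ /lf zU]]; apply: hM2 => //; apply/eqP => zE.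
    by move: zU; rewrite zE two !reimE ltxx.
  - by split; [exact: inB2|split; [apply/rt|apply/lf]; rewrite ptr; lra].
  - by split; [exact: inB2|split; [apply/rt|apply/lf]; rewrite ptr; lra].
have upd : 0 < d -> forall s, hplane (- ci) w0 (pt s d) by move=> _ s; apply/up; rewrite pti; lra.
have lod : 0 < d -> forall s, hplane ci w0 (pt s (- d)) by move=> _ s; apply/lo; rewrite pti; lra.
have mids s t : 0 < s < 2 -> hplane 1 w0 (pt s t) /\ hplane (-1) (w0 + 2) (pt s t).
  by move=> /andP[s0 s2]; split; [apply/rt|apply/lf]; rewrite ptr; lra.
have dd : 0 < d < 2 by apply/andP; split; lra.
have dd2 : 0 < 2 - d < 2 by apply/andP; split; lra.
(* On the long horizontal parts [Qp] and [Qm] may both be replaced by [Q0], which leaves only the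
   short segments in the difference. *)
have e1 : Qp (pt (2 - d) d) - Qp (pt d d) = Q0 (pt (2 - d) d) - Q0 (pt d d).
  apply: (@prim_diff (Dp `&` D0) H) => //; first exact: cconvexI.
  - by move=> z [/hQp].
  - by move=> z [_ /hQ0].
  - by split; split; [exact: inD|exact: upd|exact: inD|exact: mids].
  - by split; split; [exact: inD2|exact: upd|exact: inD2|exact: mids].
have e2 : Qm (pt (2 - d) (- d)) - Qm (pt d (- d)) = Q0 (pt (2 - d) (- d)) - Q0 (pt d (- d)).
  apply: (@prim_diff (Dm `&` D0) H) => //; first exact: cconvexI.
  - by move=> z [/hQm].
  - by move=> z [_ /hQ0].
  - by split; split; [exact: inD|exact: lod|exact: inD|exact: mids].
  - by split; split; [exact: inD2|exact: lod|exact: inD2|exact: mids].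
have p1 : Qp (v + 2) - Qp v = Qp (pt (2 - d) d) - Qp (pt (- d) d).
  rewrite pt2; apply: (@period_const Dp H) => //.
  - by move=> z [Dz /up zU] [Dz2 _]; apply: hper => //; rewrite gt_eqF.
  - by split; [exact: inD|exact: upd].
  - by rewrite -pt2; split; [exact: inD2|exact: upd].
have p2 : Qm (w + 2) - Qm w = Qm (pt (2 - d) (- d)) - Qm (pt (- d) (- d)).
  rewrite pt2; apply: (@period_const Dm H) => //.
  - by move=> z [Dz /lo zU] [Dz2 _]; apply: hper => //; rewrite lt_eqF.
  - by split; [exact: inD|exact: lod].
  - by rewrite -pt2; split; [exact: inD2|exact: lod].
rewrite p1 p2.
move: b1 b2 b3 b4 e1 e2; set A1 := Qp _; set A2 := Qp _; set A3 := Qm _; set A4 := Qm _.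
set A5 := Q0 _; set A6 := Q0 _; set A7 := Q0 _; set A8 := Q0 _; set A9 := Qp _; set A10 := Qm _.
move=> b1 b2 b3 b4 e1 e2.
have -> : A9 - A2 - (A10 - A4) = (A1 - A2) - (A3 - A4) + (A7 - A8) - (A5 - A6).
  have -> : A9 = A9 - A1 + A1 by ring.
  have -> : A10 = A10 - A3 + A3 by ring.
  rewrite e1 e2; ring.
apply: le_trans de.
have := cnB ((A1 - A2) - (A3 - A4) + (A7 - A8)) (A5 - A6).
have := cnD ((A1 - A2) - (A3 - A4)) (A7 - A8).
have := cnB (A1 - A2) (A3 - A4); lra.
Qed.

(** The integral over a period does not depend on its starting point, which is moved so far into the
    half plane that H is within e/2 of l; a period has length 2. *)
Lemma period_limit (s : C) a H Q l v : (s = ci \/ s = - ci) ->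
  (forall z, hplane s a z -> cder Q z (H z)) ->
  (forall z, hplane s a z -> H (z + 2) = H z) ->
  (forall e : R, 0 < e -> exists Y : R, forall z, hplane s a z -> Y < re (s * (z - a)) -> cn (H z - l) <= e) ->
  hplane s a v -> Q (v + 2) - Q v = 2 * l.
Proof.
move=> hs hQ hp hl hv; have two : (2 : C) = ofR 2 by rewrite ofRn.
have rs z : re (s * (z + 2 - a)) = re (s * (z - a)).
  by rewrite two; case: hs => ->; rewrite !reimE; ring.
apply/eqP; rewrite -subr_eq0; apply/eqP/cn_le0/ler_addgt0Pr => e e0; rewrite add0r.
have [Y hY] := hl (e / 2) ltac:(by rewrite divr_gt0).
pose y := Num.max 0 Y + 1.
have y0 : 0 < y by rewrite /y ltr_wpDl// le_max lexx.
have yY : Y < y by rewrite /y ltr_pwDr// le_max lexx orbT.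
pose w := a + ofR y * s^*.
have ss : s * s^* = 1.
  by case: hs => ->; apply: cplx_ext; rewrite !reimE; ring.
have rw : re (s * (w - a)) = y by rewrite /w [a + _]addrC addrK mulrCA ss mulr1.
have hw : hplane s a w by rewrite /hplane /= rw.
have hpl z : hplane s a z -> hplane s a (z + 2) by rewrite /hplane /= rs.
have -> : Q (v + 2) - Q v = Q (w + 2) - Q w.
  apply: (@period_const (hplane s a) H) => //; try exact: hpl.
    exact: hplane_convex.
  by move=> z hz _; exact: hp.
pose E := hplane s a `&` hplane s (a + ofR (Num.max 0 Y) * s^*).
have hE z : E z -> Y < re (s * (z - a)).
  move=> [_]; rewrite /hplane /=.
  have -> : s * (z - (a + ofR (Num.max 0 Y) * s^*)) = s * (z - a) - ofR (Num.max 0 Y) * (s * s^*) by ring.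
  rewrite ss mulr1 reB re_ofR subr_gt0; apply: le_lt_trans.
  by rewrite le_max lexx orbT.
have Ew : E w.
  split => //; rewrite /hplane /= /w.
  have -> : s * (a + ofR y * s^* - (a + ofR (Num.max 0 Y) * s^*)) = ofR (y - Num.max 0 Y) * (s * s^*).
    by rewrite !ofRE; ring.
  by rewrite ss mulr1 re_ofR /y; lra.
have Ew2 : E (w + 2).
  split; first exact: hpl.
  move: Ew => [_]; rewrite /hplane /=.
  have -> : re (s * (w + 2 - (a + ofR (Num.max 0 Y) * s^*))) =
     re (s * (w - (a + ofR (Num.max 0 Y) * s^*))) + re (s * 2) by rewrite -reD; congr re; ring.
  by have -> : re (s * 2) = 0; [rewrite two; case: hs => ->; rewrite !reimE; ring|rewrite addr0].
have := @mvi R E (fun z => Q z - l * z) (fun z => H z - l) (e / 2) w (w + 2).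
have -> : Q (w + 2) - l * (w + 2) - (Q w - l * w) = Q (w + 2) - Q w - 2 * l by ring.
have -> : w + 2 - w = 2 by ring.
have -> : cn (2 : C) = 2 by rewrite two cn_ofR ger0_norm.
rewrite divfK//; apply => //.
- by apply: cconvexI; exact: hplane_convex.
- move=> z [hz _]; apply: cder_eq (cderB (hQ z hz) (cderZ l (cder_id z))) _.
  by rewrite mulr1.
- by move=> z Ez; apply: hY; [case: Ez|exact: hE].
Qed.

End PeriodicCauchy.

(** * The periodic Cauchy formula and Taylor expansions with remainder *)

Section Taylor.
Variable R : realType.
Local Notation C := (Cplx R).
Implicit Types (f g h : C -> C) (z w : C) (D E : set C).

(** The Cauchy kernel of period 2. Its poles are w0 and its translates by even integers; it tends to
    0 upwards and to 1 downwards. *)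
Definition ckern w0 z : C := (1 - ce (w0 - z))^-1.

Lemma upE a z : hplane (- ci) a z <-> im a < im z.
Proof. by rewrite /hplane /= !reimE; split; lra. Qed.
Lemma loE a z : hplane ci a z <-> im z < im a.
Proof. by rewrite /hplane /= !reimE; split; lra. Qed.

Lemma im2 z : im (z + 2) = im z.
Proof. by rewrite -(ofRn R 2) !reimE addr0. Qed.
Lemma cder_ckern w0 z : ce (w0 - z) != 1 -> exists d, cder (ckern w0) z d.
Proof.
move=> h; have h1 := cderB (cder_cst w0 z) (cder_id z).
have h2 := cderB (cder_cst 1 z) (cder_comp h1 (cder_ce _)).
by eexists; apply: cderV h2; rewrite subr_eq0 eq_sym.
Qed.

Lemma ckern_period w0 z : ckern w0 (z + 2) = ckern w0 z.
Proof.
rewrite /ckern; congr ((1 - _)^-1).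
by rewrite -[LHS]ce_period; congr ce; ring.
Qed.

Lemma ce_ge_lin (Y : R) z : 0 <= Y -> Y <= - im z -> 1 + Y <= cn (ce z).
Proof.
move=> Y0 hz; rewrite cn_ce; apply: le_trans (expR_ge1Dx _).
by have := pi_ge2 R; nra.
Qed.

Lemma ckern_up w0 z (e : R) : 0 < e -> e^-1 < im z - im w0 -> cn (ckern w0 z) <= e.
Proof.
move=> e0 h; rewrite /ckern cnV -[e]invrK lef_pV2 ?posrE ?invr_gt0//; last first.
  rewrite cn_gt0 subr_eq0 eq_sym ce_neq1// reimE imN; apply/orP; left.
  have : 0 < e^-1 by rewrite invr_gt0.
  by move=> h2; rewrite lt_eqF//; lra.
have h1 : 1 + e^-1 <= cn (ce (w0 - z)).
  by apply: ce_ge_lin; [rewrite invr_ge0 ltW|rewrite !reimE; lra].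
have := @cn_ge R (ce (w0 - z)) 1; rewrite cn1 cnC; lra.
Qed.

Lemma ckern_lo w0 z (e : R) : 0 < e -> e^-1 < im w0 - im z -> cn (ckern w0 z - 1) <= e.
Proof.
move=> e0 h.
have i0 : 0 < e^-1 by rewrite invr_gt0.
have n1 : ce (w0 - z) != 1.
  by rewrite ce_neq1// reimE imN; apply/orP; left; rewrite gt_eqF//; lra.
(* The two kernels with exchanged arguments add up to 1, which reduces the downward limit to the
   upward one. *)
have -> : ckern w0 z - 1 = - ckern z w0.
  rewrite /ckern; have -> : ce (z - w0) = (ce (w0 - z))^-1 by rewrite -ceN opprB.
  have := ce_neq0 (w0 - z); set E := ce _ in n1 * => E0.
  have h1 : 1 - E != 0 by rewrite subr_eq0 eq_sym.
  have h2 : E - 1 != 0 by rewrite subr_eq0.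
  by field; rewrite h1 h2 E0.
by rewrite cnN; apply: ckern_up.
Qed.

(** The derivative at 0 has modulus pi >= 2, so an error of relative size 1 still leaves a slope of
    at least 1. *)
Lemma ce_lin_lower : exists2 r : R, 0 < r & forall t : C, cn t < r -> cn t <= cn (1 - ce t).
Proof.
have [r r0 hr] := cder_ce (0 : C) ltr01; exists r => // t ht.
have := hr t; rewrite subr0 ce0 mulr1 mul1r => /(_ ht) h.
have := @cn_ge R (ci * ofR pi * t) (ci * ofR pi * t - (ce t - 1)).
have -> : ci * ofR pi * t - (ci * ofR pi * t - (ce t - 1)) = ce t - 1 by ring.
rewrite (cnC 1) (cnC (ci * _ * _)) !cnM cn_ci mul1r cn_ofR ger0_norm ?pi_ge0//.
by have := pi_ge2 R; have := cn_ge0 t; nra.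
Qed.

(** Split h into h - h(w0) and the constant h(w0). The first part times the kernel is bounded near
    the poles, so by [strip_residue] it contributes equally above and below; the kernel itself
    contributes 2 below and 0 above, by its limits. *)
Lemma strip_cauchy D h w0 Qp Qm v w : cconvex D -> open D ->
  (forall z, D z -> exists d, cder h z d) ->
  (forall z, D z -> D (z + 2) -> h (z + 2) = h z) ->
  D w0 -> D (w0 + 2) ->
  (forall z, (D `&` hplane (- ci) w0) z -> cder Qp z (h z * ckern w0 z)) ->
  (forall z, (D `&` hplane ci w0) z -> cder Qm z (h z * ckern w0 z)) ->
  (D `&` hplane (- ci) w0) v -> (D `&` hplane (- ci) w0) (v + 2) ->
  (D `&` hplane ci w0) w -> (D `&` hplane ci w0) (w + 2) ->
  (Qm (w + 2) - Qm w) - (Qp (v + 2) - Qp v) = 2 * h w0.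
Proof.
move=> cD oD hh hper Dw0 Dw02 hQp hQm Dv Dv2 Dw Dw2.
pose H z := (h z - h w0) * ckern w0 z.
have [Kp hKp] := @convex_primitive R (hplane (- ci) w0) (ckern w0) (@hplane_convex _ _ _)
  ltac:(by move=> z /upE hz; apply: cder_ckern; rewrite ce_neq1// reimE imN;
    apply/orP; left; rewrite lt_eqF//; lra) (@hplane_open _ _ _).
have [Km hKm] := @convex_primitive R (hplane ci w0) (ckern w0) (@hplane_convex _ _ _)
  ltac:(by move=> z /loE hz; apply: cder_ckern; rewrite ce_neq1// reimE imN;
    apply/orP; left; rewrite gt_eqF//; lra) (@hplane_open _ _ _).
have dKp : Kp (v + 2) - Kp v = 2 * 0.
  apply: (@period_limit R (- ci) w0 (ckern w0)) => //; first by right.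
  - by move=> z _; exact: ckern_period.
  - move=> e e0; exists e^-1 => z _; rewrite !reimE => hz; rewrite subr0; apply: ckern_up => //; lra.
  - by case: Dv.
have dKm : Km (w + 2) - Km w = 2 * 1.
  apply: (@period_limit R ci w0 (ckern w0)) => //; first by left.
  - by move=> z _; exact: ckern_period.
  - move=> e e0; exists e^-1 => z _; rewrite !reimE => hz; apply: ckern_lo => //; lra.
  - by case: Dw.
have [r1 r10 hr1] := ce_lin_lower.
(* Near either pole the numerator is at most (|d| + 1) |z - a| by differentiability, and the
   denominator is at least |z - a| by [ce_lin_lower]. *)
have bnd a : (a = w0 \/ a = w0 + 2) -> exists r M : R, [/\ 0 < r, cball a r `<=` D &
    forall z, cball a r z -> z != a -> cn (H z) <= M].
  move=> ha; have Da : D a by case: ha => ->.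
  have hwa : h w0 = h a by case: ha => -> //; rewrite hper.
  have [d hd] := hh _ Da; have [r2 r20 hr2] := hd 1 ltr01.
  have [r3 r30 hr3] := (copenP D).1 oD _ Da.
  exists (Num.min r1 (Num.min r2 r3)), (cn d + 1); split.
  - by rewrite !lt_min r10 r20.
  - by move=> z; rewrite /cball /= !lt_min => /andP[_ /andP[_ /hr3]].
  move=> z; rewrite /cball /= !lt_min => /andP[z1 /andP[z2 _]] za.
  have c0 : 0 < cn (z - a) by rewrite cn_gt0 subr_eq0.
  have ek : ckern w0 z = (1 - ce (a - z))^-1.
    rewrite /ckern; case: ha => -> //; congr ((1 - _)^-1).
    by rewrite -[LHS]ce_period; congr ce; ring.
  rewrite /H cnM ek cnV hwa.
  have h1 : cn (z - a) <= cn (1 - ce (a - z)) by rewrite (cnC z); apply: hr1; rewrite cnC.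
  rewrite ler_pdivrMr; last exact: lt_le_trans h1.
  apply: (@le_trans _ _ ((cn d + 1) * cn (z - a))); last first.
    by apply: ler_wpM2l => //; rewrite addr_ge0 ?cn_ge0.
  have -> : h z - h a = (h z - h a - d * (z - a)) + d * (z - a) by ring.
  apply: le_trans (cnD _ _) _; rewrite cnM mulrDl addrC lerD2l; exact: hr2.
have [ra [Ma [ra0 Ba hMa]]] := bnd w0 (or_introl erefl).
have [rb [Mb [rb0 Bb hMb]]] := bnd (w0 + 2) (or_intror erefl).
pose r := Num.min ra rb; pose M := Num.max Ma Mb.
have r0 : 0 < r by rewrite lt_min ra0.
have sa a : cball a r `<=` cball a ra by move=> z; rewrite /cball /= lt_min => /andP[].
have sb a : cball a r `<=` cball a rb by move=> z; rewrite /cball /= lt_min => /andP[].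
have := @strip_residue R D H w0 M r (fun z => Qp z - h w0 * Kp z) (fun z => Qm z - h w0 * Km z)
  cD oD r0 (subset_trans (sa _) Ba) (subset_trans (sb _) Bb).
have hH z : D z -> (im z != im w0) || (re w0 < re z < re w0 + 2) -> exists d, cder H z d.
  move=> Dz hz; have [d1 hd1] := hh _ Dz.
  have n1 : ce (w0 - z) != 1.
    have -> : w0 - z = - (z - w0) by ring.
    rewrite ceN -[1]invr1 (inj_eq invr_inj) ce_neq1// !reimE subr_eq0.
    by case/orP: hz => [->//|/andP[h1 h2]]; apply/orP; right; apply/andP; split; lra.
  have [d2 hd2] := cder_ckern n1.
  eexists; apply: cderM hd2; exact: (cderB hd1 (cder_cst _ _)).
have hMa' z : cball w0 r z -> z != w0 -> cn (H z) <= M.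
  by move=> /sa zB zn; apply: le_trans (hMa _ zB zn) _; rewrite le_max lexx.
have hMb' z : cball (w0 + 2) r z -> z != w0 + 2 -> cn (H z) <= M.
  by move=> /sb zB zn; apply: le_trans (hMb _ zB zn) _; rewrite le_max lexx orbT.
have q1 z : (D `&` hplane (- ci) w0) z -> cder (fun z => Qp z - h w0 * Kp z) z (H z).
  move=> Dz; apply: cder_eq (cderB (hQp _ Dz) (cderZ _ (hKp _ Dz.2))) _.
  by rewrite /H; ring.
have q2 z : (D `&` hplane ci w0) z -> cder (fun z => Qm z - h w0 * Km z) z (H z).
  move=> Dz; apply: cder_eq (cderB (hQm _ Dz) (cderZ _ (hKm _ Dz.2))) _.
  by rewrite /H; ring.
have q3 z : D z -> D (z + 2) -> im z != im w0 -> H (z + 2) = H z.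
  by move=> Dz Dz2 _; rewrite /H ckern_period hper.
move=> /(_ hH hMa' hMb' q1 q2 q3 v w Dv Dv2 Dw Dw2) E.
have -> : Qm (w + 2) - Qm w - (Qp (v + 2) - Qp v) =
  (Qm (w + 2) - h w0 * Km (w + 2) - (Qm w - h w0 * Km w)) + h w0 * (Km (w + 2) - Km w)
  - ((Qp (v + 2) - h w0 * Kp (v + 2) - (Qp v - h w0 * Kp v)) + h w0 * (Kp (v + 2) - Kp v)) by ring.
by rewrite dKp dKm E; ring.
Qed.

Lemma ce_surj w : w != 0 -> exists z, ce z = w.
Proof.
move=> /cexp_surj[z hz]; exists (z / (ci * ofR pi)).
rewrite /ce mulrC divfK// mulf_neq0 ?ci_neq0//.
by rewrite -cn_eq0 cn_ofR normr_eq0 gt_eqF ?pi_gt0.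
Qed.

Lemma geom_rem (E : C) n : E != 1 ->
  (1 - E)^-1 - \sum_(k < n) E ^+ k = E ^+ n * (1 - E)^-1.
Proof.
move=> E1; have h : 1 - E != 0 by rewrite subr_eq0 eq_sym.
elim: n => [|n IH]; first by rewrite big_ord0 subr0 mul1r.
rewrite big_ord_recr /= opprD addrA IH exprS; apply: (mulIf h).
by rewrite mulrBl -!mulrA !mulVf//; ring.
Qed.

Lemma cder_sum n (F : nat -> C -> C) (dF : nat -> C) z :
  (forall k, cder (F k) z (dF k)) -> cder (fun w => \sum_(k < n) F k w) z (\sum_(k < n) dF k).
Proof.
move=> h; elim: n => [|n IH].
  rewrite big_ord0 [X in cder X](_ : _ = fun=> 0); first exact: cder_cst.
  by apply/funext => w; rewrite big_ord0.
rewrite big_ord_recr /= [X in cder X](_ : _ = fun w => \sum_(k < n) F k w + F n w); first exact: cderD.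
by apply/funext => w; rewrite big_ord_recr.
Qed.

(** The substitution z0 + r e^{i pi z} turns circles into horizontal segments of length 2, the
    coefficients into period integrals, and Cauchy's formula into [strip_cauchy]. Cutting the
    geometric expansion of the kernel after n terms leaves the stated remainder. *)
Theorem taylor f z0 (r M : R) : 0 < r ->
  (forall z, cball z0 r z -> exists d, cder f z d) ->
  (forall z, cball z0 r z -> cn (f z) <= M) ->
  exists2 c : nat -> C, c 0%N = f z0 & forall (rho : R) n w, 0 < rho < r -> cn (w - z0) < rho ->
    cn (f w - \sum_(k < n) c k * (w - z0) ^+ k) <=
      M * (cn (w - z0) / rho) ^+ n / (1 - cn (w - z0) / rho).
Proof.
move=> r0 hf hM.
have cr0 : ofR r != 0 by rewrite -cn_eq0 cn_ofR normr_eq0 gt_eqF.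
pose U := hplane (- ci) (0 : C).
have UE z : U z <-> 0 < im z by rewrite /U upE.
pose h z := f (z0 + ofR r * ce z).
have inB z : U z -> cball z0 r (z0 + ofR r * ce z).
  move=> /UE hz; rewrite /cball /= [z0 + _]addrC addrK cnM cn_ofR gtr0_norm//.
  rewrite gtr_pMr// cn_ce -expR0 ltr_expR.
  by have := pi_gt0 R; nra.
have hU z : U z -> exists d, cder h z d.
  move=> /inB/hf[d hd].
  have h1 := cderD (cder_cst z0 z) (cderZ (ofR r) (cder_ce z)).
  by eexists; exact: (cder_comp h1 hd).
have hper z : h (z + 2) = h z by rewrite /h ce_period.
have cU : cconvex U by exact: hplane_convex.
have oU : open U by exact: hplane_open.
have hP k : exists P, forall z, U z -> cder P z (h z * (ce z)^-1 ^+ k).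
  apply: convex_primitive => // z /hU[d hd].
  by eexists; exact: (cderM hd (cderX k (cderV (ce_neq0 z) (cder_ce z)))).
have [P {}hP] := choice hP.
have U1 : U ci by apply/UE; rewrite !reimE.
have U2 z : U z -> U (z + 2) by move=> /UE hz; apply/UE; rewrite im2.
pose c k := (P k (ci + 2) - P k ci) / 2 / ofR r ^+ k.
have c0 : c 0%N = f z0.
  rewrite /c; have -> : P 0%N (ci + 2) - P 0%N ci = 2 * f z0; last by rewrite expr0; field.
  (* High in the upper half plane the argument of f tends to z0, so the integral for k = 0 is 2
     f(z0). *)
  apply: (@period_limit R (- ci) 0 h) => //; first by right.
  - by move=> z hz; have := hP 0%N z hz; rewrite expr0 mulr1.
  move=> e e0.
  have [d hd] : exists d, cder f z0 d by apply: hf; rewrite /cball /= subrr cn0.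
  have [a a0 ha] := cder_cont hd e0.
  exists (r / a) => z _; rewrite !reimE subr0 => hz; apply/ltW/ha.
  rewrite [z0 + _]addrC addrK cnM cn_ofR gtr0_norm//.
  have ra : 0 < r / a by rewrite divr_gt0.
  have : 1 + r / a <= cn (ce (- z)) by apply: ce_ge_lin; [exact: ltW|rewrite !reimE; lra].
  rewrite ceN cnV => hh; have p0 : 0 < cn (ce z) by rewrite cn_gt0 ce_neq0.
  have : (1 + r / a) * cn (ce z) <= 1 by rewrite -ler_pdivlMr// mul1r.
  have E : r / a * a = r by rewrite divfK ?gt_eqF.
  move: E; set t := r / a => E; nra.
exists c => // rho n w /andP[rho0 rhor] wrho.
have q1 : cn (w - z0) / rho < 1 by rewrite ltr_pdivrMr// mul1r.
have q0 : 0 <= cn (w - z0) / rho by rewrite divr_ge0 ?cn_ge0 ?ltW.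
have M0 : 0 <= M by apply: le_trans (hM z0 _); rewrite ?cn_ge0// /cball /= subrr cn0.
(* The centre is not in the image of the parametrisation, so it is treated apart. *)
have [->|wz] := eqVneq w z0.
  rewrite subrr cn0 mul0r subr0 invr1 mulr1.
  case: n => [|n]; first by rewrite big_ord0 subr0 expr0 mulr1 hM// /cball /= subrr cn0.
  rewrite big_ord_recl /= c0 expr0 mulr1 big1 ?addr0 ?subrr ?cn0 ?exprS ?mul0r ?mulr0//.
  by move=> i _; rewrite /= /bump /= exprS mul0r mulr0.
have [om hom] : exists om, ce om = (w - z0) / ofR r.
  by apply: ce_surj; rewrite mulf_neq0 ?invr_neq0// subr_eq0.
have fom : h om = f w by rewrite /h hom mulrC divfK// addrC subrK.
have Eom : cn (ce om) = cn (w - z0) / r by rewrite hom cnM cnV cn_ofR gtr0_norm.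
(* The height of the horizontal line that parametrises the circle of radius [rho]. *)
pose y := - ln (rho / r) / pi.
have py : expR (- pi * y) = rho / r.
  have pn : (pi : R) != 0 by rewrite gt_eqF ?pi_gt0.
  have -> : - pi * y = ln (rho / r).
    by move: pn; rewrite /y; move: (ln _) (pi : R) => l p pn; field.
  by rewrite lnK// posrE divr_gt0.
have y0 : 0 < y.
  have : expR (- pi * y) < expR 0 by rewrite py expR0 ltr_pdivrMr// mul1r.
  by rewrite ltr_expR; have := pi_gt0 R; nra.
have yom : y < im om.
  have : expR (- pi * im om) < expR (- pi * y).
    by rewrite py -cn_ce Eom ltr_pM2r// invr_gt0.
  by rewrite ltr_expR; have := pi_gt0 R; nra.
have Uom : U om by apply/UE; lra.
pose K := ckern om.
have hK z : im z != im om -> exists d, cder K z d.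
  by move=> hz; apply: cder_ckern; rewrite ce_neq1// reimE imN subr_eq0 eq_sym hz.
have hHU z : U z -> im z != im om -> exists d, cder (fun z => h z * K z) z d.
  move=> /hU[d1 h1] /hK[d2 h2]; eexists; exact: (cderM h1 h2).
have [Qp hQp] : exists Q, forall z, (U `&` hplane (- ci) om) z -> cder Q z (h z * K z).
  apply: convex_primitive.
  - by apply: cconvexI => //; exact: hplane_convex.
  - by move=> z [Uz /upE hz]; apply: hHU => //; rewrite gt_eqF.
  - by apply: openI => //; exact: hplane_open.
have [Qm hQm] : exists Q, forall z, (U `&` hplane ci om) z -> cder Q z (h z * K z).
  apply: convex_primitive.
  - by apply: cconvexI => //; exact: hplane_convex.
  - by move=> z [Uz /loE hz]; apply: hHU => //; rewrite lt_eqF.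
  - by apply: openI => //; exact: hplane_open.
pose v : C := om + ci; pose x : C := cpx 0 y.
have Uup z : hplane (- ci) om z -> U z by move=> /upE hz; apply/UE; lra.
have hv : hplane (- ci) om v by apply/upE; rewrite /v !reimE; lra.
(* Above the pole the integral vanishes, because h is bounded by M and the kernel tends to 0. *)
have dQp : Qp (v + 2) - Qp v = 2 * 0.
  apply: (@period_limit R (- ci) om (fun z => h z * K z)) => //; first by right.
  - by move=> z hz; apply: hQp; split => //; exact: Uup.
  - by move=> z _; rewrite hper /K ckern_period.
  move=> e e0; have e1 : 0 < e / (M + 1) by rewrite divr_gt0// ltr_wpDl.
  exists (e / (M + 1))^-1 => z hz; rewrite !reimE => hz2; rewrite subr0 cnM.
  have k1 : cn (K z) <= e / (M + 1) by apply: ckern_up => //; lra.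
  have k2 : cn (h z) <= M by apply: hM; apply: inB; exact: Uup.
  have k3 : e / (M + 1) * (M + 1) = e by rewrite divfK// gt_eqF// ltr_wpDl.
  move: k1 k3 e1; set t := e / (M + 1) => k1 k3 e1.
  have := cn_ge0 (K z); have := cn_ge0 (h z); nra.
have Ux : U x by apply/UE; rewrite /x !reimE.
have lx z : im z = y -> (U `&` hplane ci om) z.
  by move=> hz; split; [apply/UE|apply/loE]; rewrite hz.
have ix : im x = y by rewrite /x !reimE.
have Ex := @strip_cauchy U h om Qp Qm v x cU oU hU (fun z _ _ => hper z) Uom (U2 _ Uom) hQp hQm
  (conj (Uup _ hv) hv) ltac:(by have hv2 : hplane (- ci) om (v + 2);
     [apply/upE; rewrite im2; apply/upE|split => //; exact: Uup]) (lx _ ix)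
  ltac:(by apply: lx; rewrite im2).
rewrite dQp mulr0 subr0 fom in Ex.
(* A primitive of h times the tail of the geometric series. On the line at height y it is bounded by
   M q^n / (1 - q), and the mean value inequality is applied over one period. *)
pose G z := Qm z - \sum_(k < n) ce om ^+ k * P k z.
pose dG z := h z * (ce (om - z) ^+ n * K z).
have hG z : im z = y -> cder G z (dG z).
  move=> hz; have [Uz lz] := lx z hz.
  apply: cder_eq (cderB (hQm z (lx z hz)) (cder_sum n (fun k => cderZ (ce om ^+ k) (hP k z Uz)))) _.
  rewrite /dG /K -geom_rem; last by rewrite ce_neq1// reimE imN subr_eq0 gt_eqF// hz.
  rewrite mulrBr mulr_sumr; congr (_ - _); apply: eq_bigr => k _.
  by rewrite ceB exprMn; ring.
have cL : cconvex [set z | im z = y].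
  by move=> a b t /= ha hb _; rewrite !reimE ha hb; ring.
set q := cn (w - z0) / rho in q0 q1 *.
have Eq z : im z = y -> cn (ce (om - z)) = q.
  move=> hz; rewrite ceB cnM cnV Eom cn_ce hz py /q; field.
  by rewrite !gt_eqF.
have bG z : im z = y -> cn (dG z) <= M * q ^+ n / (1 - q).
  move=> hz; rewrite /dG !cnM cnX Eq// mulrA.
  have k2 : cn (h z) <= M by apply: hM; apply: inB; case: (lx z hz).
  have k3 : cn (K z) <= (1 - q)^-1.
    rewrite /K /ckern cnV lef_pV2 ?posrE ?subr_gt0//.
      by rewrite -(Eq z hz) -(cn1 R); exact: cn_ge.
    apply: lt_le_trans (@cn_ge R 1 (ce (om - z))); by rewrite cn1 Eq// subr_gt0.
  by apply: ler_pM; rewrite ?mulr_ge0 ?cn_ge0 ?exprn_ge0// ler_wpM2r ?exprn_ge0.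
have ix2 : im (x + 2) = y by rewrite im2.
have := @mvi R _ G dG _ x (x + 2) cL hG bG ix ix2.
have -> : x + 2 - x = 2 by ring.
have -> : cn (2 : C) = 2 by rewrite -(ofRn R 2) cn_ofR ger0_norm.
have -> : G (x + 2) - G x = 2 * (f w - \sum_(k < n) c k * (w - z0) ^+ k).
  have -> : G (x + 2) - G x = (Qm (x + 2) - Qm x) - \sum_(k < n) ce om ^+ k * (P k (x + 2) - P k x).
    have -> : \sum_(k < n) ce om ^+ k * (P k (x + 2) - P k x) =
       \sum_(k < n) ce om ^+ k * P k (x + 2) - \sum_(k < n) ce om ^+ k * P k x.
      by rewrite -sumrB; apply: eq_bigr => k _; rewrite mulrBr.
    by rewrite /G; ring.
  rewrite Ex mulrBr mulr_sumr; congr (_ - _); apply: eq_bigr => k _.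
  have -> : P k (x + 2) - P k x = P k (ci + 2) - P k ci.
    have hp2 z : U z -> U (z + 2) -> h (z + 2) * (ce (z + 2))^-1 ^+ k = h z * (ce z)^-1 ^+ k.
      by move=> _ _; rewrite hper ce_period.
    exact: (@period_const R U _ (P k) 2 x ci cU (hP k) hp2 Ux (U2 _ Ux) U1 (U2 _ U1)).
  rewrite /c hom exprMn exprVn; field.
  by rewrite expf_neq0.
rewrite cnM.
have -> : cn (2 : C) = 2 by rewrite -(ofRn R 2) cn_ofR ger0_norm.
by rewrite mulrC ler_pM2r.
Qed.

Lemma taylor_lip f z0 (r M : R) w : 0 < r ->
  (forall z, cball z0 r z -> exists d, cder f z d) ->
  (forall z, cball z0 r z -> cn (f z) <= M) ->
  cn (w - z0) < r / 4 -> cn (f w - f z0) <= 4 * M / r * cn (w - z0).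
Proof.
move=> r0 hf hM hw; have [c c0 hc] := taylor r0 hf hM.
have M0 : 0 <= M by apply: le_trans (hM z0 _); rewrite ?cn_ge0// /cball /= subrr cn0.
have := hc (r / 2) 1%N w ltac:(by apply/andP; split; lra) ltac:(by lra).
rewrite big_ord_recl big_ord0 /= c0 expr0 mulr1 addr0 expr1.
set q := cn (w - z0) / (r / 2) => h; apply: le_trans h _.
have q2 : q <= 1 / 2 by rewrite /q ler_pdivrMr; lra.
have q0 : 0 <= q by rewrite divr_ge0 ?cn_ge0//; lra.
have -> : 4 * M / r * cn (w - z0) = M * q * 2 by rewrite /q; field; rewrite gt_eqF.
rewrite ler_pdivrMr; last by lra.
have : 0 <= M * q by rewrite mulr_ge0.
by nra.
Qed.

(** The bounds depend on M and r only, hence hold uniformly on a bounded family; the compactness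
    proof passes to the limit in them. *)
Lemma taylor_quad f z0 (r M : R) : 0 < r ->
  (forall z, cball z0 r z -> exists d, cder f z d) ->
  (forall z, cball z0 r z -> cn (f z) <= M) ->
  exists2 d : C, cn d <= 8 * M / r & forall w, cn (w - z0) < r / 4 ->
    cn (f w - f z0 - d * (w - z0)) <= 8 * M / r ^+ 2 * cn (w - z0) ^+ 2.
Proof.
move=> r0 hf hM; have [c c0 hc] := taylor r0 hf hM.
have M0 : 0 <= M by apply: le_trans (hM z0 _); rewrite ?cn_ge0// /cball /= subrr cn0.
have hq w : cn (w - z0) < r / 4 ->
    cn (f w - f z0 - c 1%N * (w - z0)) <= 8 * M / r ^+ 2 * cn (w - z0) ^+ 2.
  move=> hw.
  have := hc (r / 2) 2%N w ltac:(by apply/andP; split; lra) ltac:(by lra).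
  rewrite !big_ord_recl big_ord0 /= /bump /= c0 expr0 mulr1 addr0 expr1 opprD addrA.
  set q := cn (w - z0) / (r / 2) => h; apply: le_trans h _.
  have q2 : q <= 1 / 2 by rewrite /q ler_pdivrMr; lra.
  have -> : 8 * M / r ^+ 2 * cn (w - z0) ^+ 2 = M * q ^+ 2 * 2.
    by rewrite /q; field; rewrite gt_eqF.
  rewrite ler_pdivrMr; last by lra.
  have : 0 <= M * q ^+ 2 by rewrite mulr_ge0 ?sqr_ge0.
  by nra.
exists (c 1%N) => //.
(* The derivative is bounded by testing the expansion at one point of the ball of radius r/4, where
   4/5 + 8/25 is less than 8/5. *)
pose w := z0 + ofR (r / 5).
have wz : w - z0 = ofR (r / 5) by rewrite /w [z0 + _]addrC addrK.
have cw : cn (w - z0) = r / 5 by rewrite wz cn_ofR gtr0_norm// divr_gt0.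
have w4 : cn (w - z0) < r / 4 by rewrite cw; lra.
have h1 := hq w w4; have h2 := taylor_lip r0 hf hM w4.
have : cn (c 1%N * (w - z0)) <= 4 * M / r * cn (w - z0) + 8 * M / r ^+ 2 * cn (w - z0) ^+ 2.
  have -> : c 1%N * (w - z0) = (f w - f z0) - (f w - f z0 - c 1%N * (w - z0)) by ring.
  by apply: le_trans (cnB _ _) _; exact: lerD.
rewrite cnM cw => h3.
have r5 : 0 < r / 5 by lra.
rewrite -(ler_pM2r r5); apply: le_trans h3 _.
have -> : 4 * M / r * (r / 5) + 8 * M / r ^+ 2 * (r / 5) ^+ 2 = M * (4 / 5 + 8 / 25).
  by field; rewrite gt_eqF.
have -> : 8 * M / r * (r / 5) = M * (8 / 5) by field; rewrite gt_eqF.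
by apply: ler_wpM2l => //; lra.
Qed.

End Taylor.

(** * Riesz theory: non-zero spectral values of a compact operator are eigenvalues *)

Section Riesz.
Variable R : realType.
Local Notation C := (Cplx R).
Variable V : normedModType C.
Implicit Types (u v w : V).

Definition vn v : R := re `|v|.

Lemma vnE v : `|v| = ofR (vn v).
Proof. by rewrite /vn /ofR /re RRe_real// ger0_real. Qed.
Lemma vn_ge0 v : 0 <= vn v.
Proof. by rewrite -lecR' -vnE ofR0. Qed.
Lemma vnZ (a : C) v : vn (a *: v) = cn a * vn v.
Proof. by apply: ofR_inj; rewrite ofRM -cnE -!vnE normrZ. Qed.
Lemma vnD v w : vn (v + w) <= vn v + vn w.
Proof. by rewrite -lecR' ofRD -!vnE ler_normD. Qed.
Lemma vnN v : vn (- v) = vn v. Proof. by rewrite /vn normrN. Qed.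
Lemma vnC v w : vn (v - w) = vn (w - v).
Proof. by rewrite -vnN opprB. Qed.
Lemma vnB v w : vn (v - w) <= vn v + vn w.
Proof. by rewrite -(vnN w) vnD. Qed.
Lemma vnDB u v w : vn (u - w) <= vn (u - v) + vn (v - w).
Proof. by have := vnD (u - v) (v - w); rewrite addrA subrK. Qed.
Lemma vn0 : vn 0 = 0. Proof. by rewrite /vn normr0. Qed.
Lemma vn_eq0 v : (vn v == 0) = (v == 0).
Proof. by rewrite -(normr_eq0 v) vnE -ofR0 (inj_eq (@ofR_inj R)). Qed.
Lemma vn_gt0 v : (0 < vn v) = (v != 0).
Proof. by rewrite lt_def vn_ge0 andbT vn_eq0. Qed.
Lemma vn_le1 v : (`|v| <= 1) = (vn v <= 1).
Proof. by rewrite vnE -ofR1 lecR'. Qed.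

Lemma vnbhsP v (A : set V) :
  nbhs v A <-> exists2 e : R, 0 < e & forall w, vn (w - v) < e -> A w.
Proof.
split=> [/nbhs_ballP[e /= /cpos_ofR[x x0 ->] h]|[e e0 h]].
  by exists x => // w hw; apply: h; rewrite -ball_normE /= distrC vnE ltcR'.
apply/nbhs_ballP; exists (ofR e) => /=; first by rewrite -ofR0 ltcR'.
by move=> w; rewrite -ball_normE /= distrC vnE ltcR' => /h.
Qed.

Definition linear_of (U W : lmodType C) (f : U -> W) (h : linear f) : {linear U -> W} :=
  HB.pack f (GRing.isLinear.Build C U W *:%R f h).

Lemma continuous_bounded (S : {linear V -> V}) : continuous S ->
  exists2 M : R, 0 < M & forall v, vn (S v) <= M * vn v.
Proof.
move=> /(_ 0 [set w | vn w < 1]) h.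
have : nbhs (S 0) [set w | vn w < 1].
  by apply/vnbhsP; exists 1 => // w; rewrite linear0 subr0.
move=> /h/vnbhsP[d d0 hd]; exists (2 / d); first by rewrite divr_gt0.
move=> v; have [->|v0] := eqVneq v 0; first by rewrite linear0 vn0 mulr0.
have vp : 0 < vn v by rewrite vn_gt0.
have := hd (ofR (d / 2 / vn v) *: v).
rewrite /= subr0 linearZ /= !vnZ cn_ofR gtr0_norm ?divr_gt0// divfK ?gt_eqF// => hh.
have {}hh := hh ltac:(by lra).
have -> : vn (S v) = (2 / d * vn v) * (d / 2 / vn v * vn (S v)).
  by field; rewrite !gt_eqF.
by rewrite ler_piMr ?ltW// mulr_gt0 ?divr_gt0.
Qed.

Lemma bounded_continuous (S : {linear V -> V}) (M : R) :
  (forall v, vn (S v) <= M * vn v) -> continuous S.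
Proof.
move=> h v A /vnbhsP[e e0 he]; apply/vnbhsP.
have M0 : 0 < `|M| + 1 by rewrite ltr_wpDl.
exists (e / (`|M| + 1)); first by rewrite divr_gt0.
move=> w; rewrite ltr_pdivlMr// => hw; apply: he; rewrite -linearB.
apply: le_lt_trans (h _) _; apply: le_lt_trans hw.
by have := ler_norm M; have := vn_ge0 (w - v); nra.
Qed.

Variable L : {linear V -> V}.
Hypothesis cL : compact_operator L.

Lemma compact_cluster (v : nat -> V) : (forall n, vn (v n) <= 1) ->
  exists y, forall e : R, 0 < e -> forall N, exists2 n, (N <= n)%N & vn (L (v n) - y) < e.
Proof.
move=> hv; have hF : ((L \o v) @ \oo) (closure (L @` [set v | `|v| <= 1])).
  exists 0%N => // n _; apply: subset_closure; exists (v n) => //=.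
  by rewrite vn_le1.
have [y [_ hc]] := cL _ hF.
exists y => e e0 N.
have h1 : nbhs y [set w | vn (w - y) < e] by apply/vnbhsP; exists e.
have h2 : ((L \o v) @ \oo) [set w | exists2 n, (N <= n)%N & w = L (v n)].
  by exists N => // n /= Nn; exists n.
by have [_ [[n Nn ->] /= h]] := hc _ _ h2 h1; exists n.
Qed.

Lemma compact_bounded_operator : exists2 M : R, 0 < M & forall v, vn (L v) <= M * vn v.
Proof.
suff [M M0 hM] : exists2 M : R, 0 < M & forall v, vn v <= 1 -> vn (L v) <= M.
  exists M => // v; have [->|v0] := eqVneq v 0; first by rewrite linear0 vn0 mulr0.
  have vp : 0 < vn v by rewrite vn_gt0.
  have := hM (ofR (vn v)^-1 *: v).
  rewrite linearZ /= !vnZ cn_ofR gtr0_norm ?invr_gt0// mulVf ?gt_eqF// => /(_ (lexx _)).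
  by rewrite mulrC ler_pdivrMr.
apply: contrapT => hM.
have hv n : exists v, vn v <= 1 /\ n%:R < vn (L v).
  apply: contrapT => hn; apply: hM; exists n.+1%:R => // v v1.
  rewrite leNgt; apply/negP => hlt; apply: hn; exists v; split=> //.
  by apply: le_lt_trans hlt; rewrite ler_nat.
have [v {}hv] := choice hv.
have [y hy] := compact_cluster (fun n => (hv n).1).
have [n nN hn] := hy 1 ltr01 (Num.trunc (vn y + 1)).+1.
have h1 := (hv n).2.
have : vn (L (v n)) < vn y + 1.
  have -> : L (v n) = (L (v n) - y) + y by rewrite subrK.
  by apply: le_lt_trans (vnD _ _) _; lra.
have : vn y + 1 < n%:R.
  apply: (@lt_le_trans _ _ (Num.trunc (vn y + 1)).+1%:R); first exact: truncnS_gt.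
  by rewrite ler_nat.
lra.
Qed.

Variable nu : C.
Hypothesis nu0 : nu != 0.
Hypothesis nE : ~ eigenvalues L nu.

Let T v := nu *: v - L v.

Let TB u v : T (u - v) = T u - T v.
Proof. by rewrite /T scalerBr linearB !opprD !opprK addrACA. Qed.
Let TZ (a : C) v : T (a *: v) = a *: T v.
Proof. by rewrite /T [L (_ *: _)]linearZ /= scalerBr !scalerA [nu * a]mulrC. Qed.
Let T0 : T 0 = 0. Proof. by rewrite /T scaler0 linear0 subr0. Qed.
Let Tinj v : T v = 0 -> v = 0.
Proof.
move=> h; apply: contrapT => v0; apply: nE; exists v; first exact/eqP.
by apply/esym/eqP; rewrite -subr_eq0; apply/eqP.
Qed.
Let TD u v : T (u + v) = T u + T v.
Proof. by rewrite /T scalerDr linearD opprD addrACA. Qed.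
Let TL v : T (L v) = L (T v).
Proof. by rewrite /T linearB [L (_ *: _)]linearZ. Qed.
Let nu_gt0 : 0 < cn nu. Proof. by rewrite cn_gt0. Qed.

Let Tbound : exists2 M : R, 0 < M & forall v, vn (T v) <= M * vn v.
Proof.
have [M M0 hM] := compact_bounded_operator; exists (cn nu + M); first by rewrite addr_gt0.
by move=> v; apply: le_trans (vnB _ _) _; rewrite vnZ mulrDl lerD2l.
Qed.

(** Otherwise there are unit vectors v_n with T v_n -> 0. A cluster point y of L v_n satisfies T y =
    0, since T and L commute, so y = 0; but nu v_n = T v_n + L v_n keeps L v_n away from 0. *)
Lemma riesz_below : exists2 c : R, 0 < c & forall v, c * vn v <= vn (T v).
Proof.
apply: contrapT => hc.
have hv n : exists u, vn u = 1 /\ vn (T u) < n.+1%:R^-1.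
  apply: contrapT => hn; apply: hc; exists n.+1%:R^-1; first by rewrite invr_gt0.
  move=> v; rewrite leNgt; apply/negP => hlt; apply: hn.
  have vp : 0 < vn v.
    rewrite lt_def vn_ge0 andbT; apply/eqP => v0; move: hlt; rewrite v0 mulr0 ltNge.
    by rewrite vn_ge0.
  exists (ofR (vn v)^-1 *: v); rewrite TZ !vnZ cn_ofR gtr0_norm ?invr_gt0// mulVf ?gt_eqF//.
  by split => //; rewrite mulrC ltr_pdivrMr.
have [v {}hv] := choice hv.
have [M M0 hM] := compact_bounded_operator; have [N N0 hN] := Tbound.
have [y hy] := compact_cluster (fun n => ltac:(by rewrite (hv n).1) : vn (v n) <= 1).
have small (e : R) : 0 < e -> exists n, vn (L (v n) - y) < e /\ vn (T (v n)) < e.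
  move=> e0; have [n nN hn] := hy e e0 (Num.trunc (e^-1)).+1; exists n; split => //.
  apply: lt_le_trans (hv n).2 _; rewrite -[e]invrK lef_pV2 ?posrE ?invr_gt0//.
  apply/ltW; apply: (@lt_le_trans _ _ (Num.trunc e^-1).+1%:R); first exact: truncnS_gt.
  by rewrite ler_nat; apply: leq_trans nN _.
have Ty : T y = 0.
  apply/eqP; rewrite -vn_eq0 eq_le vn_ge0 andbT; apply/ler_addgt0Pr => e e0; rewrite add0r.
  have [n [h1 h2]] := small (e / (N + M)) ltac:(by rewrite divr_gt0 ?addr_gt0).
  have -> : T y = - T (L (v n) - y) + L (T (v n)) by rewrite TB TL opprB subrK.
  apply: le_trans (vnD _ _) _; rewrite vnN.
  apply: le_trans (lerD (hN _) (hM _)) _.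
  have E : e / (N + M) * (N + M) = e by rewrite divfK// gt_eqF// addr_gt0.
  by move: h1 h2 E; set t := e / (N + M) => *; nra.
have y0 := Tinj Ty.
have [n [h1 h2]] := small (cn nu / 2) ltac:(by rewrite divr_gt0).
rewrite y0 subr0 in h1.
have : cn nu <= vn (T (v n)) + vn (L (v n)).
  by rewrite -[leLHS]mulr1 -(hv n).1 -vnZ; have := vnD (T (v n)) (L (v n)); rewrite subrK.
lra.
Qed.

(** Approximate preimages are bounded by [riesz_below]. After rescaling to the unit ball their
    images under L cluster, and from these the preimage is rebuilt. *)
Lemma riesz_closed_range y :
  (forall e : R, 0 < e -> exists x, vn (y - T x) < e) -> exists x, y = T x.
Proof.
move=> hy; have [c c0 hc] := riesz_below.
have [M M0 hM] := compact_bounded_operator; have [N N0 hN] := Tbound.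
have [x {}hx] := choice (fun n : nat => hy n.+1%:R^-1 ltac:(by rewrite invr_gt0)).
pose B := (vn y + 1) / c + 1.
have B0 : 0 < B by rewrite /B ltr_wpDl// divr_ge0 ?addr_ge0 ?vn_ge0 ?ltW.
have xB n : vn (x n) <= B.
  have h1 := hc (x n); have h2 := hx n.
  have h3 : n.+1%:R^-1 <= 1 :> R by rewrite invf_le1 ?ler1n.
  have : vn (T (x n)) <= vn y + 1.
    have -> : T (x n) = y - (y - T (x n)) by rewrite opprB addrC subrK.
    apply: le_trans (vnB _ _) _; rewrite lerD2l; exact/ltW/(lt_le_trans h2 h3).
  move=> h4; apply: (@le_trans _ _ ((vn y + 1) / c)); last by rewrite /B lerDl.
  by rewrite ler_pdivlMr// mulrC; lra.
have hB : ofR B != 0 by rewrite -cn_eq0 cn_ofR normr_eq0 gt_eqF.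
have [z hz] := compact_cluster (fun n => ltac:(by rewrite vnZ cn_ofR gtr0_norm ?invr_gt0// mulrC ler_pdivrMr// mul1r) : vn (ofR B^-1 *: x n) <= 1).
(* The limit read off from nu x_n = T x_n + L x_n, where T x_n tends to y and, along suitable
   indices, L x_n to B z. *)
exists (nu^-1 *: (y + ofR B *: z)).
apply/eqP; rewrite -subr_eq0 -vn_eq0 eq_le vn_ge0 andbT; apply/ler_addgt0Pr => e e0; rewrite add0r.
rewrite TZ -(scale1r y) -(mulVf nu0) -scalerA -scalerBr vnZ cnV mulrC ler_pdivrMr//.
rewrite scalerA mulVf// scale1r.
pose K := cn nu + N * (1 + B).
have K0 : 0 < K by rewrite /K addr_gt0// mulr_gt0// addr_gt0.
pose t := e * cn nu / K.
have t0 : 0 < t by rewrite /t !divr_gt0 ?mulr_gt0.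
have tK : t * K = e * cn nu by rewrite /t divfK// gt_eqF.
have [n nN hn] := hz t t0 (Num.trunc (t^-1)).+1.
have hxn : vn (y - T (x n)) < t.
  apply: lt_le_trans (hx n) _; rewrite -[t]invrK lef_pV2 ?posrE ?invr_gt0//.
  apply/ltW; apply: (@lt_le_trans _ _ (Num.trunc t^-1).+1%:R); first exact: truncnS_gt.
  by rewrite ler_nat; apply: leq_trans nN _.
set a := y - T (x n) in hxn; set b := L _ - z in hn.
have -> : nu *: y - T (y + ofR B *: z) = nu *: a - T (a - ofR B *: b).
  have -> : a - ofR B *: b = y + ofR B *: z - nu *: x n.
    rewrite /a /b scalerBr linearZ /= scalerA -ofRM divff ?gt_eqF// scale1r /T.
    by rewrite !opprB -[LHS]addrA -[RHS]addrA; congr (_ + _); rewrite addrC addrA subrK.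
  rewrite TB TZ /a scalerBr; move: (T (y + _)) (nu *: T (x n)) (nu *: y) => p1 p2 p3.
  by rewrite opprB addrA subrK.
apply: le_trans (vnB _ _) _; rewrite vnZ.
apply: le_trans (lerD (lexx _) (hN _)) _.
have hab : vn (a - ofR B *: b) <= t * (1 + B).
  apply: le_trans (vnB _ _) _; rewrite vnZ cn_ofR (gtr0_norm B0); nra.
rewrite -tK /K.
have k1 : cn nu * vn a <= cn nu * t by rewrite ler_pM2l// ltW.
have k2 : N * vn (a - ofR B *: b) <= N * (t * (1 + B)) by rewrite ler_pM2l.
by apply: le_trans (lerD k1 k2) _; rewrite le_eqVlt; apply/orP; left; apply/eqP; ring.
Qed.

(** If T is not onto, the ranges of its iterates keep shrinking. There are vectors T^n v_n of norm
    at most 1 at distance at least 1/2 from the range of T^(n+1); their images under L stay |nu|/2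
    apart, against compactness. *)
Lemma riesz_surjective y : exists x, y = T x.
Proof.
apply: contrapT => hy; have [c c0 hc] := riesz_below.
have [d d0 hd] : exists2 d : R, 0 < d & forall x, d <= vn (y - T x).
  apply: contrapT => hd; apply: hy; apply: riesz_closed_range => e e0.
  apply: contrapT => he; apply: hd; exists e => // x; rewrite leNgt; apply/negP => hlt.
  by apply: he; exists x.
have Titer n u v : iter n T (u - v) = iter n T u - iter n T v.
  by elim: n => // n IH; rewrite !iterS IH TB.
have TiterZ n (a : C) v : iter n T (a *: v) = a *: iter n T v.
  by elim: n => // n IH; rewrite !iterS IH TZ.
have TiterD n u v : iter n T (u + v) = iter n T u + iter n T v.
  by elim: n => // n IH; rewrite !iterS IH TD.
have lb n x : c ^+ n * d <= vn (iter n T (y - T x)).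
  elim: n => [|n IH]; first by rewrite mul1r hd.
  rewrite iterS exprS -mulrA; apply: le_trans (hc _); by rewrite ler_pM2l.
have hv n : exists v, [/\ vn (iter n T v) <= 1 &
    forall x, 2^-1 <= vn (iter n T v - iter n.+1 T x)].
  (* Riesz's lemma: an element whose norm is less than twice the infimum is normalised. The infimum
     is positive because T is bounded below and y is at distance at least d from the range. *)
  pose A := [set vn (iter n T (y - T x)) | x in setT].
  have hA : has_inf A.
    split; first by exists (vn (iter n T (y - T 0))), 0.
    by exists (c ^+ n * d) => _ [x _ <-]; exact: lb.
  have i0 : 0 < inf A.
    apply: (@lt_le_trans _ _ (c ^+ n * d)); first by rewrite mulr_gt0 ?exprn_gt0.
    by apply: lb_le_inf; [case: hA|move=> _ [x _ <-]; exact: lb].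
  have [_ [x _ <-] hx] := @inf_adherent R A (inf A) i0 hA.
  pose w := y - T x; pose s := vn (iter n T w).
  have s0 : 0 < s by apply: lt_le_trans (lb n x); rewrite mulr_gt0 ?exprn_gt0.
  exists (ofR s^-1 *: w); split.
    by rewrite TiterZ vnZ cn_ofR gtr0_norm ?invr_gt0// -/s mulVf ?gt_eqF.
  move=> x'.
  have -> : iter n T (ofR s^-1 *: w) - iter n.+1 T x' =
     ofR s^-1 *: iter n T (y - T (x + ofR s *: x')).
    have -> : y - T (x + ofR s *: x') = w - ofR s *: T x'.
      by rewrite /w TD TZ opprD addrA.
    rewrite Titer (TiterZ n (ofR s^-1)) (TiterZ n (ofR s)) iterSr scalerBr.
    by rewrite [ofR s^-1 *: (_ *: _)]scalerA -ofRM mulVf ?gt_eqF// scale1r.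
  rewrite vnZ cn_ofR gtr0_norm ?invr_gt0// mulrC ler_pdivlMr//.
  have : inf A <= vn (iter n T (y - T (x + ofR s *: x'))).
    by apply: ge_inf; [case: hA|exists (x + ofR s *: x')].
  by move: hx; rewrite -/w -/s; lra.
have [v {}hv] := choice hv.
have [z hz] := compact_cluster (fun n => (hv n).1 : vn (iter n T (v n)) <= 1).
have e0 : 0 < cn nu / 4 / 2 by rewrite !divr_gt0.
have [n _ hn] := hz _ e0 0%N; have [m nm hm] := hz _ e0 n.+1.
have : vn (L (iter n T (v n)) - L (iter m T (v m))) <= cn nu / 4.
  apply: le_trans (vnDB _ z _) _; rewrite (vnC z); lra.
set a := iter n T (v n); set b := iter m T (v m).
(* The subtracted vector lies in the range of T^(n+1), because m > n. *)
have -> : L a - L b = nu *: (a - nu^-1 *: (T a + nu *: b - T b)).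
  have hT u : L u = nu *: u - T u by rewrite /T subKr.
  rewrite (hT a) (hT b) scalerBr scalerA mulfV// scale1r.
  by move: (T a) (T b) (nu *: a) (nu *: b) => p1 p2 p3 p4; rewrite -[X in _ = _ - X]addrA [in RHS]opprD addrA.
have [x ->] : exists x, nu^-1 *: (T a + nu *: b - T b) = iter n.+1 T x.
  exists (nu^-1 *: (v n + nu *: iter (m - n.+1) T (v m) - T (iter (m - n.+1) T (v m)))).
  have bE : b = iter n.+1 T (iter (m - n.+1) T (v m)) by rewrite -iterD subnKC.
  rewrite (TiterZ n.+1) (Titer n.+1) (TiterD n.+1) (TiterZ n.+1) -bE.
  by rewrite -iterSr [iter n.+2 _ _]iterS -bE.
rewrite vnZ => h; have := (hv n).2 x; rewrite -/a => h2.
move: nu_gt0 => ?; nra.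
Qed.

Theorem riesz_resolvent : resolvent_set L nu.
Proof.
have [S hS] := choice riesz_surjective.
have [c c0 hc] := riesz_below.
have ST v : S (T v) = v.
  by apply/eqP; rewrite -subr_eq0; apply/eqP/Tinj; rewrite TB -hS subrr.
have Slin : linear S.
  move=> a u v; apply/eqP; rewrite -subr_eq0; apply/eqP/Tinj.
  by rewrite TB TD TZ -!hS subrr.
exists (linear_of Slin); split.
- apply: (@bounded_continuous _ c^-1) => v /=.
  by have := hc (S v); rewrite -hS mulrC [c^-1 * _]mulrC ler_pdivlMr.
- exact: ST.
- by move=> v; exact: (esym (hS v)).
Qed.

End Riesz.

(** * Compactness of weighted composition operators on bounded holomorphic functions *)

Section HinfCompact.
Variable R : realType.
Local Notation C := (Cplx R).
Variable D : set C.
Implicit Types (f g : Hinf D) (z w : C).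

Lemma Hinf_norm_ubR f z : D z -> cn (f z) <= vn f.
Proof. by move=> Dz; rewrite -lecR' -cnE -vnE; exact: Hinf_norm_ub. Qed.

Lemma Hinf_norm_leR f (M : R) : 0 <= M -> (forall z, D z -> cn (f z) <= M) -> vn f <= M.
Proof.
move=> M0 h; rewrite -lecR' -vnE; apply: Hinf_norm_le; first by rewrite -ofR0 lecR'.
by move=> z /h; rewrite cn_le.
Qed.

Lemma Hinf_cder f z : D z -> exists d, cder f z d.
Proof.
by move=> Dz; have /hinfP[/(_ _ Dz)/derivableP/cderP hf _ _] := valP f; eexists; exact: hf.
Qed.

Lemma Hinf_out f z : ~ D z -> f z = 0.
Proof. by have /hinfP[_ _] := valP f; apply. Qed.

Lemma Hinf_exists (h : C -> C) (M : R) : (forall z, D z -> exists d, cder h z d) ->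
  open D -> (forall z, D z -> cn (h z) <= M) ->
  exists f : Hinf D, forall z, D z -> f z = h z.
Proof.
move=> hd oD hM; pose k z := if `[< D z >] then h z else 0.
have kE z : D z -> k z = h z by move=> Dz; rewrite /k asboolT.
have kin : k \in hinf D.
  apply/hinfP; split.
  - move=> z Dz; have [d hz] := hd z Dz.
    suff /cderP[] : cder k z d by [].
    apply: cder_near hz; have [e e0 he] := (copenP D).1 oD z Dz.
    by exists e => // w /he Dw; rewrite kE.
  - by apply/bounded_onP; exists M => z Dz; rewrite cn_le kE// hM.
  - by move=> z nD; rewrite /k asboolF.
by exists (MkHinf kin) => z Dz /=; rewrite kE.
Qed.

Lemma Hinf_ext f g : (forall z, D z -> f z = g z) -> f = g.
Proof.
move=> h; apply/val_inj/funext => z /=.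
have [Dz|nDz] := pselect (D z); first exact: h.
by rewrite !Hinf_out.
Qed.

(** Ultrafilters play the role of subsequences: one filter gives limits at all points
    simultaneously, without a diagonal argument. *)
Lemma ultra_limit (X : Type) (F : set_system X) (g : X -> C) (M : R) : UltraFilter F ->
  F [set x | cn (g x) <= M] -> exists l, forall e : R, 0 < e -> F [set x | cn (g x - l) < e].
Proof.
move=> FU hM.
have cK := @compact_setX R R `[-M, M] `[-M, M] (@segment_compact R _ _) (@segment_compact R _ _).
pose g' x := (re (g x), im (g x)).
have hF : (g' @ F) ((`[-M, M] : set R) `*` (`[-M, M] : set R)).
  apply: (@filterS X F _ [set x | cn (g x) <= M]) hM => x /= hx; split; rewrite /= in_itv /= -ler_norml.
    exact: le_trans (re_le_cn _) hx.
  exact: le_trans (im_le_cn _) hx.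
have [[a b] [_ hc]] := cK _ _ hF.
exists (cpx a b) => e e0.
have [//|hn] := in_ultra_setVsetC [set x | cn (g x - cpx a b) < e] FU.
have h1 : nbhs (a, b) (ball a (e/2) `*` ball b (e/2)).
  exists (ball a (e/2), ball b (e/2)) => //=.
  by split; apply: nbhsx_ballx; rewrite divr_gt0.
have h2 : (g' @ F) [set p | exists2 x, ~ (cn (g x - cpx a b) < e) & p = g' x].
  by apply: (@filterS X F _ _ _ _ hn) => x hx; exists x.
have [p [[x hx ->]]] := hc _ _ h2 h1.
rewrite /= -!ball_normE /= => -[b1 b2]; exfalso; apply: hx.
apply: le_lt_trans (cn_le_reim _) _; rewrite !reimE.
by rewrite [e]splitr; apply: ltrD; rewrite distrC.
Qed.

Variables (n : nat) (phi wt : 'I_n -> C -> C) (L : {linear Hinf D -> Hinf D}) (rho W M : R).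
Hypotheses (oD : open D) (rho0 : 0 < rho) (W0 : 0 <= W).
Hypothesis DM : forall z, D z -> cn z <= M.
Hypothesis phiD : forall k z, D z -> cball (phi k z) rho `<=` D.
Hypothesis wtW : forall k z, D z -> cn (wt k z) <= W.
Hypothesis LE : forall f z, D z -> L f z = \sum_(k < n) wt k z * f (phi k z).

Lemma transfer_compact : compact_operator L.
Proof.
pose B := [set v : Hinf D | `|v| <= 1]; pose A := L @` B.
suff cA : compact A.
  rewrite /compact_operator -/B -/A -(closure_id A).1//.
  by apply: compact_closed cA; exact: norm_hausdorff.
rewrite compact_ultra => F FU FA.
have hs g : exists f, A g -> vn f <= 1 /\ L f = g.
  have [[f]|nA] := pselect (A g); last by exists 0.
  by rewrite /B /= vn_le1 => f1 <-; exists f.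
have [s {}hs] := choice hs.
have sb g z : A g -> D z -> cn (s g z) <= 1.
  by move=> /hs[h _] Dz; apply: le_trans (Hinf_norm_ubR _ Dz) h.
have hf0 z : exists l, D z -> forall e : R, 0 < e -> F [set g | cn (s g z - l) < e].
  have [Dz|] := pselect (D z); last by exists 0.
  have [|l hl] := @ultra_limit _ F (fun g => s g z) 1 FU; last by exists l.
  by apply: filterS FA => g gA; exact: sb.
have [f0 {}hf0] := choice hf0.
have pick (P : set (Hinf D)) : F P -> exists g, P g by move=> /filter_ex.
have f0b z : D z -> cn (f0 z) <= 1.
  move=> Dz; apply/ler_addgt0Pr => e e0.
  have [g [h1 h2]] := pick _ (filterI (hf0 z Dz e e0) FA).
  have := sb _ _ h2 Dz; have := @cn_ge R (f0 z) (s g z); rewrite cnC; move: h1 => /=; lra.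
(* The derivatives at z also converge along the ultrafilter, and the quadratic remainder of
   [taylor_quad], the same for all functions, survives in the limit. *)
have f0d z : D z -> exists d, cder f0 z d.
  move=> Dz; have [r r0 hr] := (copenP D).1 oD z Dz.
  have hd g : exists d, A g -> cn d <= 8 / r /\ forall w, cn (w - z) < r / 4 ->
      cn (s g w - s g z - d * (w - z)) <= 8 / r ^+ 2 * cn (w - z) ^+ 2.
    have [gA|] := pselect (A g); last by exists 0.
    have [d h1 h2] := @taylor_quad R (s g) z r 1 r0 (fun w wB => Hinf_cder (s g) (hr w wB))
      (fun w wB => sb _ _ gA (hr w wB)).
    by exists d => _; rewrite mulr1 in h1 h2.
  have [d {}hd] := choice hd.
  have [|l hl] := @ultra_limit _ F d (8 / r) FU.
    by apply: filterS FA => g /hd[].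
  exists l => e e0; exists (Num.min (r / 4) (e * r ^+ 2 / 8)).
    by rewrite lt_min !divr_gt0 ?mulr_gt0 ?exprn_gt0.
  move=> w; rewrite lt_min => /andP[w1 w2].
  have Dw : D w by apply: hr; apply: lt_le_trans w1 _; lra.
  apply: (@le_trans _ _ (8 / r ^+ 2 * cn (w - z) ^+ 2)); last first.
    rewrite [cn (w - z) ^+ 2]expr2 mulrA; apply: ler_wpM2r; first exact: cn_ge0.
    rewrite mulrC mulrA ler_pdivrMr ?exprn_gt0//.
    by move: w2; rewrite ltr_pdivlMr// => w2; exact: ltW.
  apply/ler_addgt0Pr => t t0; pose k := 2 + cn (w - z).
  have k0 : 0 < k by rewrite /k ltr_wpDr ?cn_ge0.
  have tk : 0 < t / k by rewrite divr_gt0.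
  have [g [[[h1 h2] h3] h4]] := pick _ (filterI (filterI (filterI (hf0 w Dw _ tk) (hf0 z Dz _ tk)) (hl _ tk)) FA).
  have [_ /(_ w w1) h5] := hd g h4.
  have -> : f0 w - f0 z - l * (w - z) = (s g w - s g z - d g * (w - z)) +
     ((s g z - f0 z) + (d g - l) * (w - z) - (s g w - f0 w)) by ring.
  apply: le_trans (cnD _ _) _; apply: lerD => //.
  apply: le_trans (cnB _ _) _; apply: le_trans (lerD (cnD _ _) (lexx _)) _; rewrite cnM.
  have tE : t / k * k = t by rewrite divfK// gt_eqF.
  move: h1 h2 h3 tE => /=; set t' := t / k => h1 h2 h3; rewrite /k => <-.
  have := cn_ge0 (w - z); have := cn_ge0 (d g - l); nra.
have [f fE] := Hinf_exists f0d oD f0b.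
exists (L f); split.
  exists f => //; rewrite /B /= vn_le1; apply: Hinf_norm_leR => // z Dz.
  by rewrite fE// f0b.
(* If uniformity fails, the offending points of the image have a limit p along the ultrafilter; p
   lies in D, and convergence at p together with equicontinuity near p gives a contradiction. *)
have key (k : 'I_n) (e : R) : 0 < e -> F [set g | forall z, D z -> cn (s g (phi k z) - f (phi k z)) <= e].
  move=> e0; apply: contrapT => hn.
  have [//|{}hn] := in_ultra_setVsetC [set g | forall z, D z -> cn (s g (phi k z) - f (phi k z)) <= e] FU.
  have hz g : exists z, ~ (forall z, D z -> cn (s g (phi k z) - f (phi k z)) <= e) ->
      D z /\ e < cn (s g (phi k z) - f (phi k z)).
    have [h|/existsNP[z /not_implyP[Dz /negP]]] := pselect (forall z, D z -> cn (s g (phi k z) - f (phi k z)) <= e).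
      by exists 0 => /(_ h).
    by rewrite -ltNge => h; exists z.
  have [z {}hz] := choice hz.
  have phiDD w : D w -> D (phi k w).
    by move=> Dw; apply: (phiD (k := k) Dw); rewrite /cball /= subrr cn0.
  have [|p hp] := @ultra_limit _ F (fun g => phi k (z g)) M FU.
    by apply: filterS hn => g /hz[Dz _]; apply/DM/phiDD.
  (* The first bound places the offending point within a quarter of the radius [rho] / 2 around p,
     as [taylor_lip] asks; the second makes its Lipschitz estimate at most e/4. *)
  pose d := Num.min (rho / 8) (e * rho / 32).
  have d0 : 0 < d by rewrite lt_min !divr_gt0 ?mulr_gt0.
  have [g1 [h1 h2]] := pick _ (filterI (hp d d0) hn).
  have dr : d <= rho / 8 by rewrite ge_min lexx.
  have de : d <= e * rho / 32 by rewrite ge_min lexx orbT.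
  have Bp w : cn (w - p) < rho / 2 -> D w.
    move=> hw; apply: (phiD (hz _ h2).1); rewrite /cball /=.
    apply: le_lt_trans (cnDB _ _ p) _; rewrite (cnC p); move: h1 => /=; lra.
  have Dp : D p by apply: Bp; rewrite subrr cn0; lra.
  have e4 : 0 < e / 4 by lra.
  have [g [[[h3 h4] h5] h6]] := pick _ (filterI (filterI (filterI (hp d d0) (hf0 p Dp _ e4)) FA) hn).
  have [Dz hlt] := hz _ h6.
  have lipf (u : Hinf D) : vn u <= 1 -> cn (u (phi k (z g)) - u p) <= e / 4.
    move=> u1; have r20 : 0 < rho / 2 by lra.
    have := @taylor_lip R u p (rho / 2) 1 (phi k (z g)) r20
      (fun w wB => Hinf_cder u (Bp w wB)) (fun w wB => le_trans (Hinf_norm_ubR u (Bp w wB)) u1).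
    rewrite mulr1 => h; have {h}h := h ltac:(by move: h3 => /=; lra).
    apply: le_trans h _; move: h3 => /= h3.
    apply: (@le_trans _ _ (4 / (rho / 2) * d)); first by apply: ler_wpM2l; [rewrite divr_ge0// ltW|exact: ltW].
    apply: (@le_trans _ _ (4 / (rho / 2) * (e * rho / 32))); first by apply: ler_wpM2l; rewrite // divr_ge0// ltW.
    by rewrite le_eqVlt; apply/orP; left; apply/eqP; field; rewrite gt_eqF.
  have f1 : vn f <= 1 by apply: Hinf_norm_leR => // w Dw; rewrite fE// f0b.
  have l1 := lipf f f1; have l2 := lipf (s g) (hs _ h5).1.
  move: h4 => /=; rewrite -fE// => h4.
  have : cn (s g (phi k (z g)) - f (phi k (z g))) <= cn (s g (phi k (z g)) - s g p) + cn (s g p - f p) + cn (f p - f (phi k (z g))).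
    by apply: le_trans (cnDB _ _ (f p)) _; rewrite lerD2r; exact: cnDB.
  by rewrite (cnC (f p)); lra.
move=> P /vnbhsP[e e0 hP].
have ek : 0 < e / 2 / (n%:R * W + 1) by rewrite !divr_gt0// ltr_wpDl// mulr_ge0.
have hall : F [set g | forall k, forall z, D z -> cn (s g (phi k z) - f (phi k z)) <= e / 2 / (n%:R * W + 1)].
  by apply: filter_forall => k; exact: key.
apply: filterS (filterI hall FA) => g [h1 h2]; apply: hP.
apply: (@le_lt_trans _ _ (e / 2)); last by lra.
have [_ <-] := hs _ h2; apply: Hinf_norm_leR; first by lra.
move=> z Dz; have -> : (L (s g) - L f) z = L (s g) z - L f z by [].
rewrite !LE// -sumrB; apply: le_trans (cn_sum _ _ _) _.
set t := e / 2 / _ in ek h1.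
have tE : (n%:R * W + 1) * t = e / 2 by rewrite mulrC /t divfK// gt_eqF// ltr_wpDl// mulr_ge0.
apply: (@le_trans _ _ (\sum_(k < n) W * t)).
  apply: ler_sum => k _; rewrite -mulrBr cnM.
  by apply: ler_pM; rewrite ?cn_ge0 ?wtW// h1.
rewrite sumr_const card_ord -tE mulrDl mul1r -[leLHS]mulr_natl mulrA lerDl; exact: ltW.
Qed.

End HinfCompact.

(** * Logarithm, square root and arcsine as primitives *)

Section Arcsine.
Variable R : realType.
Local Notation C := (Cplx R).
Implicit Types (f g : C -> C) (z w : C).

Lemma real_on_reals (D : set C) f (df : C -> C) (x0 x : R) : cconvex D ->
  (forall z, D z -> cder f z (df z)) -> (forall t : R, D (ofR t) -> im (df (ofR t)) = 0) ->
  D (ofR x0) -> D (ofR x) -> im (f (ofR x0)) = 0 -> im (f (ofR x)) = 0.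
Proof.
move=> cD hf hr D0 D1 h0.
have := @rder_mvi R (fun t => cpx (im (f (ofR x0 + ofR t * (ofR x - ofR x0)))) 0) (fun=> 0) 0.
rewrite /= !ofRE !mul0r addr0 mul1r [ofR x0 + _]addrC subrK => H.
have : cn (cpx (im (f (ofR x))) 0 - cpx (im (f (ofR x0))) 0) <= 0.
  apply: H => [t t01|t _]; last by rewrite cn0.
  have E : ofR x0 + ofR t * (ofR x - ofR x0) = ofR (x0 + t * (x - x0)) by rewrite !ofRE.
  have Dt : D (ofR (x0 + t * (x - x0))) by rewrite -E; exact: cD.
  have hc : cder f (ofR x0 + ofR t * (ofR x - ofR x0)) (df (ofR (x0 + t * (x - x0)))).
    by rewrite E; exact: hf.
  have h1 := rder_cder hc.
  have h2 := rder_re (- ci) h1.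
  have : rder (fun s => cpx (re (- ci * f (ofR x0 + ofR s * (ofR x - ofR x0)))) 0) t 0.
    have -> : (0 : C) = cpx (re (- ci * (df (ofR (x0 + t * (x - x0))) * (ofR x - ofR x0)))) 0.
      apply: cplx_ext; rewrite !reimE//.
      by rewrite (hr _ Dt); ring.
    by apply: rder_pair => //; exact: is_derive_cst.
  by congr (rder _ _ _); apply/funext => s; congr cpx; rewrite !reimE; ring.
by move=> /cn_le0/eqP; rewrite subr_eq0 => /eqP[->].
Qed.

(** A primitive of 1/z normalised at 1: the quotient of its exponential by z has derivative 0. It is
    real on the positive axis because its derivative is. *)
Lemma log_exists : exists Lg : C -> C, forall z, 0 < re z ->
  [/\ cder Lg z z^-1, cexp (Lg z) = z & im z = 0 -> im (Lg z) = 0].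
Proof.
pose D := hplane 1 (0 : C).
have DE z : D z <-> 0 < re z by rewrite /D /hplane /= mul1r subr0.
have D0 z : D z -> z != 0 by move=> /DE h; apply/eqP => z0; move: h; rewrite z0 ltxx.
have cD : cconvex D by exact: hplane_convex.
have [L hL] := @convex_primitive R D (fun z => z^-1) cD
  (fun z Dz => ex_intro _ _ (cder_inv (D0 z Dz))) (@hplane_open _ _ _).
have D1 : D 1 by apply/DE; rewrite reimE.
pose M z := L z - L 1.
have hM z : D z -> cder M z z^-1.
  by move=> Dz; apply: cder_eq (cderB (hL z Dz) (cder_cst _ _)) _; rewrite subr0.
exists M => z /DE Dz; split; first exact: hM.
  have h : cexp (M z) * z^-1 = cexp (M 1) * 1^-1.
    apply: (@cder0_const R D (fun z => cexp (M z) * z^-1)) => // w Dw.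
    apply: cder_eq (cderM (cder_comp (hM w Dw) (cder_cexp _)) (cder_inv (D0 w Dw))) _.
    by have := D0 w Dw => w0; field.
  rewrite /M subrr cexp0 invr1 mulr1 in h.
  by rewrite -[LHS](divfK (D0 z Dz)) h mul1r.
move=> iz; have zE : z = ofR (re z) by apply: cplx_ext; rewrite !reimE ?iz.
rewrite zE; apply: (@real_on_reals D M (fun z => z^-1) 1) => //.
- by move=> t _; rewrite -ofRV im_ofR.
- by rewrite -zE.
- by rewrite /M subrr.
Qed.

(** [S] is the square root exp(log(1 - w^2) / 2), available because 1 - w^2 has positive real part
    in the disc; [As] is the primitive of 1/[S] that vanishes at 0. *)
Lemma asin_exists : exists As S : C -> C,
  [/\ forall w, cn w < 1 -> cder As w (S w)^-1,
      forall w, cn w < 1 -> cder S w (- w / S w),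
      forall w, cn w < 1 -> S w ^+ 2 = 1 - w ^+ 2 /\ cexp (ci * As w) = ci * w + S w,
      forall w, cn w < 1 -> As (- w) = - As w &
      forall w, cn w < 1 -> im w = 0 -> [/\ im (As w) = 0, im (S w) = 0 & 0 < re (S w)]].
Proof.
have [Lg hLg] := log_exists.
pose D := cball (0 : C) 1.
have DE w : D w <-> cn w < 1 by rewrite /D /cball /= subr0.
have cD : cconvex D by exact: cball_convex.
have p1 w : cn w < 1 -> 0 < re (1 - w ^+ 2).
  move=> w1; rewrite reB re1; have := re_le_cn (w ^+ 2); rewrite cnX ler_norml => /andP[_ h].
  by have := cn_ge0 w; nra.
pose S w := cexp (Lg (1 - w ^+ 2) / 2).
have S0 w : S w != 0 by exact: cexp_neq0.
have S2 w : cn w < 1 -> S w ^+ 2 = 1 - w ^+ 2.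
  move=> w1; have [_ <- _] := hLg _ (p1 w w1); rewrite /S -cexpMn; congr cexp; by field.
have dS w : cn w < 1 -> cder S w (- w / S w).
  move=> w1; have [h1 _ _] := hLg _ (p1 w w1).
  have h2 := cderB (cder_cst 1 w) (cderX 2 (cder_id w)).
  have h3 := cderZ 2^-1 (cder_comp h2 h1).
  have h4 := cder_comp h3 (cder_cexp _).
  have -> : S = fun w => cexp (2^-1 * Lg (1 - w ^+ 2)).
    by apply/funext => u; rewrite /S mulrC.
  apply: cder_eq h4 _ => /=.
  have -> : cexp (2^-1 * Lg (1 - w ^+ 2)) = S w by rewrite /S mulrC.
  rewrite -S2//.
  by have := S0 w => sw; rewrite expr1; field.
have [A hA] := @convex_primitive R D (fun w => (S w)^-1) cD
  ltac:(by move=> w /DE w1; eexists; exact: (cderV (S0 w) (dS w w1))) (@cball_open _ _ _).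
have D0 : D 0 by apply/DE; rewrite cn0.
pose As w := A w - A 0.
have hAs w : D w -> cder As w (S w)^-1.
  by move=> Dw; apply: cder_eq (cderB (hA w Dw) (cder_cst _ _)) _; rewrite subr0.
have hE w : cn w < 1 -> cexp (ci * As w) = ci * w + S w.
  move=> w1.
  (* S - i w is the inverse of i w + S, and its product with e^{i As} has derivative 0 and value 1
     at the origin. *)
  have key (u : C) : cn u < 1 -> (ci * u + S u) * (S u - ci * u) = 1.
    move=> u1; have -> : (ci * u + S u) * (S u - ci * u) = S u ^+ 2 - (ci * ci) * u ^+ 2 by ring.
    by rewrite S2// ci2; ring.
  have h : cexp (ci * As w) * (S w - ci * w) = cexp (ci * As 0) * (S 0 - ci * 0).
    apply: (@cder0_const R D (fun w => cexp (ci * As w) * (S w - ci * w))) => //; last by apply/DE.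
    move=> u /[dup] Du /DE u1.
    apply: cder_eq (cderM (cder_comp (cderZ ci (hAs u Du)) (cder_cexp _)) (cderB (dS u u1) (cderZ ci (cder_id u)))) _.
    have := S0 u => su; have -> : - u = ci * ci * u by rewrite ci2; ring.
    by field.
  have S00 : S 0 = 1.
    rewrite /S expr0n subr0; have [_ _ h1] := hLg 1 ltac:(by rewrite reimE ltr01).
    have [_ h2 _] := hLg 1 ltac:(by rewrite reimE ltr01).
    have {}h1 := h1 erefl.
    have : Lg 1 = 0; last by move=> ->; rewrite mul0r cexp0.
    apply: cplx_ext; rewrite ?h1 ?reimE//.
    have := congr1 (@cn R) h2; rewrite cn_cexp cn1 -[1 in RHS](@expR0 R) => /expR_inj ->.
    by [].
  rewrite /As subrr mulr0 cexp0 mul1r subr0 S00 -/(As w) in h.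
  have k := key w w1; have k0 : S w - ci * w != 0.
    by apply/eqP => k0; move: k; rewrite k0 mulr0 => /eqP; rewrite eq_sym oner_eq0.
  by apply: (mulIf k0); rewrite h k.
exists As, S; split.
- by move=> w /DE /hAs.
- exact: dS.
- by move=> w w1; split; [exact: S2|exact: hE].
- move=> w w1; have h : As w + As (- w) = As 0 + As (- 0).
    apply: (@cder0_const R D (fun w => As w + As (- w))) => //; last by apply/DE.
    move=> u Du; have Dnu : D (- u) by apply/DE; rewrite cnN; apply/DE.
    apply: cder_eq (cderD (hAs u Du) (cder_comp (cderN (cder_id u)) (hAs _ Dnu))) _.
    by rewrite /S sqrrN mulrN1 subrr.
  move: h; rewrite oppr0 /As subrr addr0 -/(As w) -/(As (- w)) => /eqP.
  by rewrite addrC addr_eq0 => /eqP.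
- move=> w w1 iw.
  have rS u : cn u < 1 -> im u = 0 -> im (S u) = 0 /\ 0 < re (S u).
    move=> u1 iu; have [_ _ h] := hLg _ (p1 u u1).
    have {}h : im (Lg (1 - u ^+ 2)) = 0.
      by apply: h; rewrite expr2 !reimE iu; ring.
    have -> : S u = ofR (expR (re (Lg (1 - u ^+ 2)) / 2)).
      rewrite -cexp_ofR /S; congr cexp; apply: cplx_ext; rewrite -(ofRn R 2) -ofRV !reimE ?h; ring.
    by rewrite !reimE expR_gt0.
  have [h1 h2] := rS w w1 iw; split => //.
  have wE : w = ofR (re w) by apply: cplx_ext; rewrite !reimE ?iw.
  rewrite wE; apply: (@real_on_reals D As (fun w => (S w)^-1) 0) => //.
  + move=> t /DE /rS/(_ erefl)[hi _].
    have -> : S (ofR t) = ofR (re (S (ofR t))) by apply: cplx_ext; rewrite ?re_ofR ?im_ofR ?hi.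
    by rewrite -ofRV im_ofR.
  + by rewrite -wE; apply/DE.
  + by rewrite /As subrr.
Qed.

End Arcsine.

(** * Holomorphic inverse branches on a strip around the real line *)

Section Branches.
Variable R : realType.
Local Notation C := (Cplx R).
Implicit Types (z w : C).

(* [c0 * ce z] is the point of the circle with parameter [z]; [cb_sum] and
   [cb_prod] say that the points with parameters [ph k z] are the two solutions
   [Z] of [tau lam Z = c0 * ce z]. *)
Record complex_branches (lam c0 : C) (eps kap K mu : R) (ph : 'I_2 -> C -> C) : Prop :=
  ComplexBranches {
  cb_eps : 0 < eps;
  cb_kap : 0 <= kap < 1;
  cb_der : forall k z, `|im z| < eps -> exists d,
    [/\ cder (ph k) z d, cn (d - 2^-1) <= kap / 2 & im z = 0 -> im d = 0];
  cb_der2 : forall k z, `|im z| < eps -> exists d, cder (derive1 (ph k)) z d;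
  cb_shift0 : forall z, `|im z| < eps -> ph ord0 (z + 2) = ph ord_max z;
  cb_shift1 : forall z, `|im z| < eps -> ph ord_max (z + 2) = ph ord0 z + 2;
  cb_sum : forall z, `|im z| < eps ->
    c0 * ce (ph ord0 z) + c0 * ce (ph ord_max z) = lam + lam^* * (c0 * ce z);
  cb_prod : forall z, `|im z| < eps ->
    (c0 * ce (ph ord0 z)) * (c0 * ce (ph ord_max z)) = c0 * ce z;
  cb_real : forall k z, im z = 0 -> im (ph k z) = 0;
  cb_left : ph ord0 (- 1) = - 1;
  cb_right : ph ord_max 1 = 1;
  cb_mu : cder (ph ord0) (- 1) (ofR mu);
  cb_bnd : forall k z, `|im z| < eps -> cn (ph k z - z / 2) <= K
}.

Section Construction.
Variables (lam : C) (As S : C -> C).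
Hypothesis lam1 : cn lam < 1.
Hypothesis hAs : forall w, cn w < 1 -> cder As w (S w)^-1.
Hypothesis hS : forall w, cn w < 1 -> cder S w (- w / S w).
Hypothesis hS2 : forall w, cn w < 1 -> S w ^+ 2 = 1 - w ^+ 2 /\ cexp (ci * As w) = ci * w + S w.
Hypothesis hodd : forall w, cn w < 1 -> As (- w) = - As w.
Hypothesis hre : forall w, cn w < 1 -> im w = 0 -> [/\ im (As w) = 0, im (S w) = 0 & 0 < re (S w)].

Let r := cn lam.
(** A value between r^2 and 1 for which 1 + r^2 - 2 [rho2] = (1 - r^2) / 2; this surplus is what
    [A'_bound] consumes. *)
Let rho2 : R := (1 + 3 * r ^+ 2) / 4.
Let rho : R := Num.sqrt rho2.

Let r0 : 0 <= r. Proof. exact: cn_ge0. Qed.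
Let rr1 : r ^+ 2 < 1. Proof. by rewrite expr_lt1// ltW. Qed.
Let rho2_bnd : r ^+ 2 < rho2 /\ rho2 < 1.
Proof. rewrite /rho2; have := rr1; lra. Qed.
Let rho_sq : rho ^+ 2 = rho2.
Proof. by rewrite sqr_sqrtr// ltW//; have [h _] := rho2_bnd; apply: le_lt_trans h; exact: sqr_ge0. Qed.
Let rho_r : r < rho.
Proof. by rewrite -(@ltr_pXn2r _ 2) ?nnegrE ?sqrtr_ge0// rho_sq; have [] := rho2_bnd. Qed.
Let rho1 : rho < 1.
Proof. by rewrite -(@ltr_pXn2r _ 2) ?nnegrE ?sqrtr_ge0// rho_sq expr1n; have [] := rho2_bnd. Qed.
Let rho_gt0 : 0 < rho. Proof. exact: le_lt_trans rho_r. Qed.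

Let a1 : R := 1 - re lam.
Let m1 : R := cn (1 - lam).

Let a10 : 0 < a1.
Proof.
by rewrite /a1; have := re_le_cn lam; rewrite ler_norml => /andP[_ h]; move: lam1; lra.
Qed.

Let m1sq : m1 ^+ 2 = a1 ^+ 2 + im lam ^+ 2.
Proof. by rewrite /m1 cn_sqr !reimE /a1; ring. Qed.

Let m10 : 0 < m1.
Proof.
rewrite lt_def cn_ge0 andbT; apply/eqP => h; have := m1sq; rewrite h.
by have := a10; have := sqr_ge0 (im lam); nra.
Qed.

(** The value of [q] at -1, see [q_left]. Its arcsine [beta] is the phase that makes -1 a fixed
    point of the first branch. *)
Let q1 : R := - im lam / m1.

Let q1E : q1 ^+ 2 = 1 - (a1 / m1) ^+ 2.
Proof.
have h := m1sq; have m0 : m1 != 0 by rewrite gt_eqF// m10.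
apply: (mulIf (x := m1 ^+ 2)); first by rewrite expf_neq0.
by rewrite /q1 mulrBl -!exprMn !divfK// mul1r h; ring.
Qed.

Let cnq1 : cn (ofR q1) < 1.
Proof.
rewrite cn_ofR -(@ltr_pXn2r _ 2) ?nnegrE// expr1n real_normK ?num_real// q1E.
by have : 0 < (a1 / m1) ^+ 2; [rewrite exprn_gt0// divr_gt0 ?a10 ?m10|lra].
Qed.

Let beta : R := re (As (ofR q1)).

Let betaE : As (ofR q1) = ofR beta.
Proof. by have [h _ _] := hre cnq1 erefl; apply: cplx_ext; rewrite ?re_ofR ?im_ofR. Qed.

Let Sq1 : S (ofR q1) = ofR (a1 / m1).
Proof.
have [_ h1 h2] := hre cnq1 erefl; have [h3 _] := hS2 cnq1.
have SE : S (ofR q1) = ofR (re (S (ofR q1))) by apply: cplx_ext; rewrite ?re_ofR ?im_ofR.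
have : ofR (re (S (ofR q1)) ^+ 2) = ofR ((a1 / m1) ^+ 2).
  rewrite ofRX -SE h3 -ofRX q1E !ofRE; ring.
move=> /(@ofR_inj R)/eqP; rewrite eqrXn2//; first by rewrite {2}SE => /eqP ->.
  exact: ltW.
by rewrite ltW// divr_gt0 ?a10 ?m10.
Qed.

Let eb : C := cexp (ci * ofR beta).

(** Identifies [beta] as an argument of 1 - lam, so that the square of [eb] is (1 - lam) / (1 -
    conj(lam)), the base point of the circle parameter. *)
Let ebE : eb = (1 - lam) / ofR m1.
Proof.
have [_ h] := hS2 cnq1; rewrite /eb -betaE h Sq1.
have m0 : ofR m1 != 0 by rewrite -cn_eq0 cn_ofR normr_eq0 gt_eqF// m10.
have m0' : m1 != 0 by rewrite gt_eqF// m10.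
apply: (mulIf m0); rewrite divfK// mulrDl -mulrA -!ofRM /q1 !divfK//.
by apply: cplx_ext; rewrite !reimE /a1; ring.
Qed.

(** A holomorphic square root of the circle point [c0 * ce z]. It changes sign under translation by
    2, and this makes the two branches exchange places. *)
Let s z : C := cexp (ci * (ofR (pi / 2) * z + ofR beta)).
Let c0 : C := eb ^+ 2.

Let sE z : s z = eb * cexp (ci * (ofR (pi / 2) * z)).
Proof. by rewrite /s mulrDr addrC cexpD. Qed.

Let s0 z : s z != 0. Proof. exact: cexp_neq0. Qed.

Let s_sq z : s z ^+ 2 = c0 * ce z.
Proof.
rewrite sE exprMn -(cexpMn (ci * (ofR (pi / 2) * z)) 2); congr (_ * _); rewrite /ce; congr cexp.
have -> : ofR (pi / 2 : R) = ofR pi / 2 by rewrite ofRM ofRV ofRn.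
by move: (ofR pi) => p; field.
Qed.

Let cexp_hpi : cexp (ci * ofR (pi / 2 : R)) = ci.
Proof.
apply: cplx_ext; rewrite /cexp !reimE.
  by have -> : 0 * 0 + 1 * (pi / 2) = pi / 2 :> R; [ring|rewrite cos_pihalf mulr0].
have -> : 0 * 0 + 1 * (pi / 2) = pi / 2 :> R by ring.
by rewrite sin_pihalf !mul0r mulr1 mulr0 subr0 expR0.
Qed.

Let cexp_pi : cexp (ci * ofR (pi : R)) = -1.
Proof.
have -> : ci * ofR (pi : R) = 2%:R * (ci * ofR (pi / 2)).
  have -> : ofR (pi / 2 : R) = ofR pi / 2 by rewrite ofRM ofRV ofRn.
  by move: (ofR pi) => p; field.
by rewrite cexpMn cexp_hpi expr2 ci2.
Qed.

Let s_shift z : s (z + 2) = - s z.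
Proof.
have -> : - s z = s z * cexp (ci * ofR pi) by rewrite cexp_pi mulrN1.
rewrite /s -cexpD; congr cexp.
have -> : ofR (pi / 2 : R) = ofR pi / 2 by rewrite ofRM ofRV ofRn.
by move: (ofR pi) => p; field.
Qed.

(** Half the sum of the two roots Z of tau Z = s^2, divided by s; the product of the roots so
    divided is 1. *)
Let q z : C := (lam^* * s z + lam / s z) / 2.

Let q_shift z : q (z + 2) = - q z.
Proof. by rewrite /q s_shift invrN; field; exact: s0. Qed.

Let cn_s z : cn (s z) = expR (- (pi / 2 * im z)).
Proof. by rewrite /s cn_cexp !reimE; congr expR; ring. Qed.

(** On the real line |q| <= r < [rho], and leaving the line costs at most a factor e^{pi |Im z| /
    2}. For r = 0 the quotient [rho / r] in the width has no meaning, but q vanishes. *)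
Lemma strip_width : exists2 eps : R, 0 < eps & forall z, `|im z| < eps -> cn (q z) < rho.
Proof.
have hq z : cn (q z) <= r * expR (pi / 2 * `|im z|).
  rewrite /q cnM cnV -(ofRn R 2) cn_ofR ger0_norm//.
  have h1 : cn (lam^* * s z) <= r * expR (pi / 2 * `|im z|).
    rewrite cnM cn_conj cn_s; apply: ler_wpM2l => //; rewrite ler_expR -mulrN.
    by apply: ler_wpM2l; [rewrite divr_ge0// pi_ge0|rewrite -normrN ler_norm].
  have h2 : cn (lam / s z) <= r * expR (pi / 2 * `|im z|).
    rewrite cnM cnV cn_s -expRN opprK; apply: ler_wpM2l => //; rewrite ler_expR.
    by apply: ler_wpM2l; [rewrite divr_ge0// pi_ge0|rewrite ler_norm].
  rewrite ler_pdivrMr//; apply: le_trans (cnD _ _) _; lra.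
have [r00|rn0] := eqVneq r 0.
  exists 1 => // z _; apply: le_lt_trans (hq z) _; by rewrite r00 mul0r rho_gt0.
have rp : 0 < r by rewrite lt_def rn0 r0.
have t1 : 1 < rho / r by rewrite ltr_pdivlMr// mul1r rho_r.
have l0 : 0 < ln (rho / r) by rewrite ln_gt0.
have pp : 0 < pi / 2 :> R by rewrite divr_gt0// pi_gt0.
exists (ln (rho / r) / (pi / 2)); first by rewrite divr_gt0.
move=> z; rewrite ltr_pdivlMr// mulrC => hz; apply: le_lt_trans (hq z) _.
rewrite mulrC -ltr_pdivlMr// -[X in _ < X]lnK ?posrE ?divr_gt0 ?rho_gt0//.
by rewrite ltr_expR.
Qed.

Let der_s z : cder s z (ci * ofR (pi / 2) * s z).
Proof.
have h := cderD (cderZ (ofR (pi / 2)) (cder_id z)) (cder_cst (ofR beta) z).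
apply: cder_eq (cder_comp (cderZ ci h) (cder_cexp _)) _.
by rewrite addr0 mulr1 mulrC.
Qed.

Let q' z : C := ci * ofR (pi / 2) * ((lam^* * s z - lam / s z) / 2).

Let der_q z : cder q z (q' z).
Proof.
have h := cderD (cderZ (lam^*) (der_s z)) (cderZ lam (cderV (s0 z) (der_s z))).
have hh : cder (fun w => 2^-1 * (lam^* * s w + lam / s w)) z (q' z).
  apply: cder_eq (cderZ 2^-1 h) _; rewrite /q'; have := s0 z => sz.
  by move: (ofR _) => p; field.
by apply: cder_near hh; exists 1 => // w _; rewrite mulrC.
Qed.

Let der_q' z : exists d, cder q' z d.
Proof.
have h := cderB (cderZ (lam^*) (der_s z)) (cderZ lam (cderV (s0 z) (der_s z))).
have h2 := cderZ (ci * ofR (pi / 2)) (cderZ 2^-1 h).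
eexists; apply: cder_near h2; exists 1 => // w _; by rewrite /q' [2^-1 * _]mulrC.
Qed.

Let A' z : C := q' z / S (q z).

Let SN0 w : cn w < 1 -> S w != 0.
Proof.
move=> w1; have [h _] := hS2 w1; apply/eqP => S0; move: h; rewrite S0 expr0n /= => /esym/eqP.
rewrite subr_eq0 => /eqP h; have := congr1 (@cn R) h; rewrite cn1 cnX => h2.
have := cn_ge0 w; nra.
Qed.

Let der_A z : cn (q z) < 1 -> cder (fun z => As (q z)) z (A' z).
Proof.
move=> h; apply: cder_eq (cder_comp (der_q z) (hAs h)) _.
by rewrite /A' mulrC.
Qed.

Let der_A' z : cn (q z) < 1 -> exists d, cder A' z d.
Proof.
move=> h; have [d hd] := der_q' z.
eexists; exact: (cderM hd (cderV (SN0 h) (cder_comp (der_q z) (hS h)))).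
Qed.

(** A fourth root, because the estimate concerns the squared modulus of [A' z ^+ 2]. The 1/8 is the
    1/2 left by the choice of [rho2], divided by the bound 4 for |1 - q^2|^2. *)
Let kap : R := Num.sqrt (Num.sqrt (1 - (1 - r ^+ 2) ^+ 2 / 8)).

Let kap_in : 0 <= 1 - (1 - r ^+ 2) ^+ 2 / 8 < 1.
Proof. have := rr1; have := sqr_ge0 r; set x := r ^+ 2 => *; apply/andP; split; nra. Qed.

Let kap_sq : (kap ^+ 2) ^+ 2 = 1 - (1 - r ^+ 2) ^+ 2 / 8.
Proof. by rewrite sqr_sqrtr ?sqrtr_ge0// sqr_sqrtr//; case/andP: kap_in. Qed.

Let kap01 : 0 <= kap < 1.
Proof.
apply/andP; split; first exact: sqrtr_ge0.
rewrite -(@ltr_pXn2r _ 2) ?nnegrE ?sqrtr_ge0// expr1n.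
rewrite -(@ltr_pXn2r _ 2) ?nnegrE ?sqr_ge0// kap_sq expr1n.
by case/andP: kap_in.
Qed.

(* [(2 A' / pi)^2 = (r^2 - q^2) / (1 - q^2) = 1 - (1 - r^2) / (1 - q^2)]. *)
Let A'_bound z : cn (q z) < rho -> cn (A' z) <= pi / 2 * kap.
Proof.
move=> hq; have h1 : cn (q z) < 1 by apply: lt_trans hq rho1.
have [e _] := hS2 h1; have sn := SN0 h1.
have E : A' z ^+ 2 = ofR ((pi / 2) ^+ 2) * ((ofR (r ^+ 2) - q z ^+ 2) / (1 - q z ^+ 2)).
  rewrite /A' exprMn exprVn e [RHS]mulrA; congr (_ * _).
  have -> : q z ^+ 2 = ofR (r ^+ 2) + ((lam^* * s z - lam / s z) / 2) ^+ 2.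
    rewrite -mulcconj /q; have := s0 z => sz; by field.
  by rewrite /q' !exprMn [ci ^+ 2]expr2 ci2 ofRX; ring.
have p0 : 0 <= pi / 2 :> R by rewrite divr_ge0// pi_ge0.
have k0 : 0 <= kap by case/andP: kap01.
have pk0 : 0 <= pi / 2 * kap by exact: mulr_ge0.
rewrite -(@ler_pXn2r _ 2) ?nnegrE ?cn_ge0//.
rewrite -cnX E cnM cn_ofR ger0_norm ?sqr_ge0// [(pi / 2 * kap) ^+ 2]exprMn; apply: ler_wpM2l; first exact: sqr_ge0.
set c := q z ^+ 2 in e *.
have hc : cn c <= rho2 by rewrite /c cnX -rho_sq; apply: lerXn2r; rewrite ?nnegrE ?cn_ge0 ?ltW.
have d0 : 1 - c != 0 by rewrite -e expf_neq0.
have dp : 0 < cn (1 - c) by rewrite cn_gt0.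
have [b1 b2] := rho2_bnd.
rewrite -(@ler_pXn2r _ 2) ?nnegrE ?cn_ge0 ?sqr_ge0//.
rewrite cnM cnV exprMn exprVn ler_pdivrMr ?exprn_gt0// kap_sq.
have h2 : cn (1 - c) ^+ 2 <= 4.
  have -> : 4 = 2 ^+ 2 :> R by rewrite expr2; ring.
  apply: lerXn2r; rewrite ?nnegrE ?cn_ge0//.
  by apply: le_trans (cnB _ _) _; rewrite cn1; lra.
have h3 : re c <= rho2 by apply: le_trans (ler_norm _) (le_trans (re_le_cn c) hc).
have h4 : cn (ofR (r ^+ 2) - c) ^+ 2 = cn (1 - c) ^+ 2 - (1 - r ^+ 2) * (1 + r ^+ 2 - 2 * re c).
  by rewrite !cn_sqr !reB !imB re_ofR im_ofR re1 im1; ring.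
rewrite h4; move: h2 h3 rr1; rewrite /rho2; set u := r ^+ 2; set v := cn (1 - c) ^+ 2; set x := re c.
(* The choice of [rho2] gives this bound; the next one uses |1 - q^2|^2 <= 4. *)
move=> h2 h3 u1; have k1 : (1 - u) * ((1 - u) / 2) <= (1 - u) * (1 + u - 2 * x).
  by apply: ler_wpM2l; lra.
have k2 : (1 - u) ^+ 2 / 8 * v <= (1 - u) ^+ 2 / 8 * 4.
  by apply: ler_wpM2l => //; rewrite divr_ge0 ?sqr_ge0.
lra.
Qed.

(** Dividing the argument of a root by pi: z/2 comes from [s], the shift by 1/2 from the factor -i
    or i in front of e^{+- i As(q)}, and beta/pi from [s] and [c0] together. *)
Let ph (k : 'I_2) z : C :=
  if k == ord0 then (z - 1) / 2 + (As (q z) - ofR beta) / ofR pi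
  else (z + 1) / 2 - (As (q z) + ofR beta) / ofR pi.

Let sg (k : 'I_2) : C := if k == ord0 then 1 else -1.

Let sg0 : sg ord0 = 1. Proof. by []. Qed.
Let sg1 : sg ord_max = -1. Proof. by []. Qed.

Let pi0 : ofR (pi : R) != 0.
Proof. by rewrite -cn_eq0 cn_ofR normr_eq0 gt_eqF// pi_gt0. Qed.

Let der_ph k z : cn (q z) < 1 -> cder (ph k) z (2^-1 + sg k * (A' z / ofR pi)).
Proof.
move=> h; have hA := der_A h.
have pn := pi0.
rewrite /ph /sg; case: (k == ord0).
  have := cderD (cderZ 2^-1 (cderB (cder_id z) (cder_cst 1 z)))
    (cderZ (ofR pi)^-1 (cderB hA (cder_cst (ofR beta) z))).
  move=> /cder_near h1; apply: cder_eq (h1 _ _) _.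
    by exists 1 => // w _; rewrite [2^-1 * _]mulrC [_^-1 * _]mulrC.
  by rewrite !subr0 mulr1 mul1r mulrC [_ / _]mulrC; congr (_ + _); rewrite mulrC.
have := cderB (cderZ 2^-1 (cderD (cder_id z) (cder_cst 1 z)))
    (cderZ (ofR pi)^-1 (cderD hA (cder_cst (ofR beta) z))).
move=> /cder_near h1; apply: cder_eq (h1 _ _) _.
  by exists 1 => // w _; rewrite [2^-1 * _]mulrC [_^-1 * _]mulrC.
by rewrite !addr0 mulr1 mulN1r [_^-1 * _]mulrC.
Qed.

Let q_left : q (- 1) = ofR q1.
Proof.
have sm : s (- 1) = - ci * eb.
  rewrite sE mulrC; congr (_ * _).
  by rewrite mulrN1 mulrN cexpN cexp_hpi ciV.
have m0 : ofR m1 != 0 by rewrite -cn_eq0 cn_ofR normr_eq0 gt_eqF// m10.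
have l0 : 1 - lam != 0 by rewrite -cn_gt0 m10.
have eV : eb^-1 = (1 - lam^*) / ofR m1.
  rewrite ebE; have : (1 - lam) * (1 - lam^*) = ofR m1 ^+ 2.
    rewrite -ofRX -mulcconj; congr (_ * _); apply: cplx_ext; rewrite !reimE; ring.
  by move=> h; apply: (mulfI (x := (1 - lam) / ofR m1)); rewrite ?mulf_neq0 ?invr_neq0// divff ?mulf_neq0 ?invr_neq0// mulrACA h; field.
rewrite /q sm invfM eV invrN ciV opprK ebE /q1.
have -> : ofR (- im lam / m1) = ofR (- im lam) / ofR m1 by rewrite ofRM ofRV.
have -> : ofR (- im lam) = (lam^* * (- ci) * (1 - lam) + lam * ci * (1 - lam^*)) / 2.
  apply: (mulIf (x := 2)) => //; rewrite divfK//.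
  by apply: cplx_ext; rewrite -(ofRn R 2) !reimE; ring.
by field.
Qed.

Let q_real z : im z = 0 -> im (q z) = 0.
Proof.
move=> iz; have sc : (s z)^* = (s z)^-1.
  rewrite /s -cexp_conj -cexpN; congr cexp; apply: cplx_ext; rewrite !reimE iz; ring.
have -> : q z = ofR (re (lam^* * s z)).
  have -> : q z = (lam^* * s z + (lam^* * s z)^*) / 2.
    by rewrite /q rmorphM /= conjCK sc.
  apply: (mulIf (x := 2)) => //; rewrite divfK//.
  by apply: cplx_ext; rewrite -(ofRn R 2) !reimE; ring.
by rewrite im_ofR.
Qed.

Let q'_real z : im z = 0 -> im (q' z) = 0.
Proof.
move=> iz; have sc : (s z)^* = (s z)^-1.
  rewrite /s -cexp_conj -cexpN; congr cexp; apply: cplx_ext; rewrite !reimE iz; ring.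
have -> : q' z = ofR (- (pi / 2) * im (lam^* * s z)).
  have -> : q' z = ci * ofR (pi / 2) * ((lam^* * s z - (lam^* * s z)^*) / 2).
    by rewrite /q' rmorphM /= conjCK sc.
  apply: (mulIf (x := 2)) => //; rewrite -[LHS]mulrA divfK//.
  by apply: cplx_ext; rewrite -(ofRn R 2) !reimE; ring.
by rewrite im_ofR.
Qed.

Let A'_real z : im z = 0 -> cn (q z) < 1 -> im (A' z) = 0.
Proof.
move=> iz qz; have [_ h _] := hre qz (q_real iz).
rewrite /A'; have -> : S (q z) = ofR (re (S (q z))) by apply: cplx_ext; rewrite ?re_ofR ?im_ofR.
have -> : q' z = ofR (re (q' z)) by apply: cplx_ext; rewrite ?re_ofR ?im_ofR ?q'_real.
by rewrite -ofRV -ofRM im_ofR.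
Qed.

Let q_lt1 z : im z = 0 -> cn (q z) < 1.
Proof.
by have [eps e0 h] := strip_width => iz; apply: lt_trans (h z _) rho1; rewrite iz normr0.
Qed.

Let phE k z : c0 * ce (ph k z) = - sg k * ci * s z * cexp (sg k * (ci * As (q z))).
Proof.
have hp : ofR (pi / 2 : R) = ofR pi / 2 by rewrite ofRM ofRV ofRn.
have hsg : - sg k * ci = cexp (- (sg k * (ci * ofR (pi / 2)))).
  rewrite /sg; case: (k == ord0).
    by rewrite mul1r cexpN cexp_hpi ciV mulN1r.
  by rewrite mulN1r !opprK cexp_hpi mul1r.
rewrite hsg /s -!cexpD /c0 /eb -(cexpMn _ 2) /ce -cexpD; congr cexp.
rewrite hp; have := pi0; rewrite /ph /sg; case: (k == ord0); move: (ofR pi) => p p0; field;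
  exact: p0.
Qed.

Let cb_sum' z : cn (q z) < 1 ->
  c0 * ce (ph ord0 z) + c0 * ce (ph ord_max z) = lam + lam^* * (c0 * ce z).
Proof.
move=> h; have [h2 h3] := hS2 h.
have n0 : ci * q z + S (q z) != 0 by rewrite -h3 cexp_neq0.
rewrite (phE ord0 z) (phE ord_max z) sg0 sg1 [1 * (ci * _)]mul1r [-1 * (ci * As _)]mulN1r cexpN h3.
have -> : (ci * q z + S (q z))^-1 = S (q z) - ci * q z.
  apply: (mulfI n0); rewrite divff//.
  have -> : (ci * q z + S (q z)) * (S (q z) - ci * q z) = S (q z) ^+ 2 - (ci * ci) * q z ^+ 2 by ring.
  by rewrite h2 ci2; ring.
have -> : - 1 * ci * s z * (ci * q z + S (q z)) + - -1 * ci * s z * (S (q z) - ci * q z) =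
  - (ci * ci) * s z * q z * 2 by ring.
by rewrite ci2 -s_sq /q; have := s0 z => sz; field.
Qed.

Let cb_prod' z : (c0 * ce (ph ord0 z)) * (c0 * ce (ph ord_max z)) = c0 * ce z.
Proof.
rewrite (phE ord0 z) (phE ord_max z) sg0 sg1 [1 * (ci * _)]mul1r [-1 * (ci * As _)]mulN1r cexpN -s_sq.
have := cexp_neq0 (ci * As (q z)); set E := cexp _ => E0.
have -> : - 1 * ci * s z * E * (- -1 * ci * s z / E) = - (ci * ci) * s z ^+ 2 * (E / E) by ring.
by rewrite ci2 divff//; ring.
Qed.

Let dphE k z : cn (q z) < 1 -> derive1 (ph k) z = 2^-1 + sg k * (A' z / ofR pi).
Proof. by move=> /(der_ph k)/cder_derive1. Qed.

Let cn_sg k : cn (sg k) = 1.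
Proof. by rewrite /sg; case: ifP; rewrite ?cnN cn1. Qed.

(** The reciprocal of T'(-1), that is the derivative of the first branch at its fixed point. *)
Let mu : R := (1 - r ^+ 2) / (2 * a1).

Let mu_der : 2^-1 + A' (- 1) / ofR pi = ofR mu.
Proof.
rewrite /A' q_left Sq1.
have sm : s (- 1) = - ci * eb.
  rewrite sE mulrC; congr (_ * _).
  by rewrite mulrN1 mulrN cexpN cexp_hpi ciV.
have m0 : m1 != 0 by rewrite gt_eqF// m10.
have a0 : a1 != 0 by rewrite gt_eqF// a10.
have cm0 : ofR m1 != 0 by rewrite -cn_eq0 cn_ofR normr_eq0.
have ca0 : ofR a1 != 0 by rewrite -cn_eq0 cn_ofR normr_eq0.
have iq : im (q' (- 1)) = 0 by apply: q'_real; rewrite !reimE oppr0.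
have -> : q' (- 1) = ofR (pi / 2 * ((re lam - r ^+ 2) / m1)).
  have sc : (s (- 1))^* = (s (- 1))^-1.
    rewrite /s -cexp_conj -cexpN; congr cexp; apply: cplx_ext; rewrite !reimE; ring.
  have -> : q' (- 1) = ci * ofR (pi / 2) * ((lam^* * s (- 1) - (lam^* * s (- 1))^*) / 2).
    by rewrite /q' rmorphM /= conjCK sc.
  have -> : lam^* * s (- 1) = (- ci * lam^* * (1 - lam)) / ofR m1 by rewrite sm ebE; ring.
  rewrite rmorphM /= fmorphV /= conjcofR -mulrBl.
  have -> : - ci * lam^* * (1 - lam) - (- ci * lam^* * (1 - lam))^* = - ci * 2 * ofR (re lam - r ^+ 2).
    by rewrite /r cn_sqr; apply: cplx_ext; rewrite -(ofRn R 2) !reimE; ring.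
  rewrite [in RHS]ofRM [in X in _ = _ * X]ofRM ofRV.
  have -> : ci * ofR (pi / 2) * (- ci * 2 * ofR (re lam - r ^+ 2) / ofR m1 / 2) =
    - (ci * ci) * (ofR (pi / 2) * (ofR (re lam - r ^+ 2) / ofR m1)) by field.
  by rewrite ci2; ring.
rewrite -(ofRn R 2) -!ofRV -!ofRM -ofRD; congr ofR.
have pn : (pi : R) != 0 by rewrite gt_eqF// pi_gt0.
have -> : pi / 2 * ((re lam - r ^+ 2) / m1) * (a1 / m1)^-1 / pi = (re lam - r ^+ 2) / (2 * a1).
  by move: (pi : R) pn => p pn; field; rewrite a0 m0 pn.
rewrite /mu; have -> : re lam = 1 - a1 by rewrite /a1; ring.
by field.
Qed.

Lemma complex_branches_construct : exists (eps kap K : R) (ph : 'I_2 -> C -> C),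
  complex_branches lam ((1 - lam) / (1 - lam^*)) eps kap K ((1 - cn lam ^+ 2) / (2 * (1 - re lam))) ph.
Proof.
have [eps e0 heps] := strip_width.
have c0E : (1 - lam) / (1 - lam^*) = c0.
  have h : (1 - lam) * (1 - lam^*) = ofR m1 ^+ 2.
    rewrite -ofRX -mulcconj; congr (_ * _); apply: cplx_ext; rewrite !reimE; ring.
  have cm0 : ofR m1 != 0 by rewrite -cn_eq0 cn_ofR normr_eq0 gt_eqF// m10.
  have n0 : 1 - lam^* != 0.
    by apply/eqP => z; move: h; rewrite z mulr0 => /esym/eqP; rewrite expf_eq0 (negbTE cm0) andbF.
  rewrite /c0 ebE exprMn exprVn -h; field; rewrite n0.
  by apply/eqP => z; move: h; rewrite z mul0r => /esym/eqP; rewrite expf_eq0 (negbTE cm0) andbF.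
have hq1 z : `|im z| < eps -> cn (q z) < 1 by move=> /heps h; apply: lt_trans h rho1.
have i1 : `|im (- 1 : C)| < eps by rewrite !reimE oppr0 normr0.
have i1' : `|im (1 : C)| < eps by rewrite reimE normr0.
rewrite c0E.
(* Bounds 1/S on the disc of radius [rho]: |S|^2 >= 1 - rho^2, and as this number is at most 1, it
   also bounds |S| from below. *)
pose KA := (1 - rho ^+ 2)^-1.
have shift0 z : `|im z| < eps -> ph ord0 (z + 2) = ph ord_max z.
  move=> hz; rewrite /ph /= q_shift hodd ?hq1//.
  by have := pi0; move: (ofR pi) => p p0; field.
have shift1 z : `|im z| < eps -> ph ord_max (z + 2) = ph ord0 z + 2.
  move=> hz; rewrite /ph /= q_shift hodd ?hq1//.
  by have := pi0; move: (ofR pi) => p p0; field.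
have left : ph ord0 (- 1) = - 1.
  by rewrite /ph /= q_left betaE subrr mul0r; field.
exists eps, kap, (1 / 2 + (KA + `|beta|) / pi), ph; split => //.
- move=> k z hz; exists (2^-1 + sg k * (A' z / ofR pi)); split.
  + exact: der_ph (hq1 z hz).
  + rewrite addrAC subrr add0r cnM cn_sg mul1r cnM cnV cn_ofR ger0_norm ?pi_ge0//.
    rewrite ler_pdivrMr ?pi_gt0//; apply: le_trans (A'_bound (heps z hz)) _.
    by rewrite le_eqVlt; apply/orP; left; apply/eqP; ring.
  + move=> iz; have h := A'_real iz (hq1 z hz).
    have -> : A' z = ofR (re (A' z)) by apply: cplx_ext; rewrite ?re_ofR ?im_ofR.
    have -> : sg k = ofR (re (sg k)) by rewrite /sg; case: ifP => _; apply: cplx_ext; rewrite !reimE ?oppr0.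
    by rewrite -(ofRn R 2) -!ofRV -!ofRM -ofRD im_ofR.
- move=> k z hz; have [d hd] := der_A' (hq1 z hz).
  have h := cderD (cder_cst 2^-1 z) (cderZ (sg k) (cderZ (ofR pi)^-1 hd)).
  eexists; apply: cder_near h; exists (eps - `|im z|); first by rewrite subr_gt0.
  move=> w hw; have hw2 : `|im w| < eps.
    have := im_le_cn (w - z); have -> : im w = im (w - z) + im z by rewrite -imD subrK.
    have := ler_normD (im (w - z)) (im z); move: hw; lra.
  by rewrite dphE ?hq1// [_^-1 * _]mulrC.
- by move=> z /hq1/cb_sum'.
- move=> k z iz; have [h _ _] := hre (q_lt1 iz) (q_real iz).
  rewrite /ph; have -> : As (q z) = ofR (re (As (q z))) by apply: cplx_ext; rewrite ?re_ofR ?im_ofR.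
  have zE : z = ofR (re z) by apply: cplx_ext; rewrite ?re_ofR ?im_ofR.
  move: (re (As _)) => a; rewrite zE -(ofRn R 2) -ofR1 -!ofRV.
  by case: ifP => _; rewrite -?ofRB -?ofRD -?ofRM -?ofRB -?ofRD im_ofR.
- have -> : (1 : C) = -1 + 2 by ring.
  by rewrite shift1// left; ring.
- have := der_ph ord0 (hq1 _ i1); rewrite /sg /= mul1r mu_der; exact.
- move=> k z hz.
  have hA : cn (As (q z)) <= KA.
    have D0 : cball (0 : C) rho 0 by rewrite /cball /= subrr cn0 rho_gt0.
    have Dq : cball (0 : C) rho (q z) by rewrite /cball /= subr0; exact: heps.
    have dA w : cball (0 : C) rho w -> cder As w (S w)^-1.
      by rewrite /cball /= subr0 => h; apply: hAs; apply: lt_trans h rho1.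
    have bS w : cball (0 : C) rho w -> cn (S w)^-1 <= KA.
      rewrite /cball /= subr0 => h; have w1 : cn w < 1 by apply: lt_trans h rho1.
      have [e _] := hS2 w1.
      have d0 : 0 < 1 - rho ^+ 2 by rewrite rho_sq; have [] := rho2_bnd; lra.
      have k1 : 1 - rho ^+ 2 <= cn (S w) ^+ 2.
        rewrite -cnX e; apply: le_trans (@cn_ge R _ _); rewrite cn1 cnX lerD2l lerN2.
        by apply: lerXn2r; rewrite ?nnegrE ?cn_ge0 ?ltW// rho_gt0.
      have d1 : 1 - rho ^+ 2 <= 1 by rewrite lerBlDr lerDl sqr_ge0.
      have sp : 0 < cn (S w) by rewrite cn_gt0 SN0.
      rewrite cnV /KA lef_pV2 ?posrE//.
      have [hs|hs] := lerP 1 (cn (S w)); first exact: le_trans d1 hs.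
      by apply: le_trans k1 _; rewrite expr2 ler_piMl ?ltW.
    have As0 : As 0 = 0.
      have := hodd (w := 0); rewrite cn0 ltr01 oppr0 => /(_ erefl)/eqP.
      by rewrite -addr_eq0 -mulr2n mulrn_eq0 /= => /eqP.
    have := @mvi R _ As _ KA _ _ (@cball_convex R 0 rho) dA bS D0 Dq.
    rewrite As0 !subr0 => h; apply: le_trans h _.
    rewrite -[leRHS]mulr1; apply: ler_wpM2l; last by apply/ltW/hq1.
    by apply: le_trans (bS 0 D0); exact: cn_ge0.
  have pp := pi_gt0 R.
  have -> : ph k z - z / 2 = - sg k / 2 + sg k * ((As (q z) - sg k * ofR beta) / ofR pi).
    rewrite /ph /sg; have := pi0; case: (k == ord0); move: (ofR pi) => p p0; field; exact: p0.
  apply: le_trans (cnD _ _) _; rewrite !cnM cnN cn_sg !mul1r !cnV -(ofRn R 2) !cn_ofR (ger0_norm (pi_ge0 R)) (ger0_norm (ler0n R 2)).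
  rewrite lerD2l ler_pM2r ?invr_gt0//.
  apply: le_trans (cnB _ _) _; apply: lerD => //.
  by rewrite cnM cn_sg mul1r cn_ofR.
Qed.

End Construction.

Theorem complex_branches_exist (lam : C) : cn lam < 1 ->
  exists (eps kap K : R) (ph : 'I_2 -> C -> C),
  complex_branches lam ((1 - lam) / (1 - lam^*)) eps kap K ((1 - cn lam ^+ 2) / (2 * (1 - re lam))) ph.
Proof.
move=> l1; have [As [S [h1 h2 h3 h4 h5]]] := asin_exists R.
exact: (complex_branches_construct l1 h1 h2 h3 h4 h5).
Qed.

End Branches.

(** * The real branches and the interval map *)

Section IntervalBranches.
Variable R : realType.
Local Notation C := (Cplx R).
Implicit Types (z w : C) (x y : R).

(** Clearing the denominator of tau loses nothing: if it vanished, the quadratic equation would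
    force Z = 0 or Z = lam, and neither makes 1 - conj(lam) Z zero when |lam| < 1. *)
Lemma tau_root (lam Z p : C) : cn lam < 1 -> Z ^+ 2 + p = (lam + lam^* * p) * Z ->
  tau lam Z = p.
Proof.
move=> l1 h; have h2 : Z * (lam - Z) = p * (1 - lam^* * Z).
  have -> : Z * (lam - Z) = lam * Z - (Z ^+ 2 + p) + p by ring.
  by rewrite h; ring.
have n0 : 1 - lam^* * Z != 0.
  apply/eqP => e; move: h2; rewrite e mulr0 => /eqP; rewrite mulf_eq0 => /orP[/eqP Z0|/eqP Zl].
    by move: e; rewrite Z0 mulr0 subr0 => /eqP; rewrite oner_eq0.
  have ZE : Z = lam by apply/esym/eqP; rewrite -subr_eq0 Zl.
  move: e; rewrite ZE mulrC mulcconj => /eqP.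
  rewrite subr_eq0 -ofR1 => /eqP/(@ofR_inj R) e.
  by have := cn_ge0 lam; move: l1; nra.
by rewrite /tau h2 mulfK.
Qed.

Lemma tau_rootE (lam Z p : C) : cn lam < 1 -> cn Z = 1 -> tau lam Z = p ->
  Z ^+ 2 + p = (lam + lam^* * p) * Z.
Proof.
move=> l1 Z1; have n0 : 1 - lam^* * Z != 0.
  rewrite -cn_gt0; apply: lt_le_trans (@cn_ge R 1 (lam^* * Z)).
  by rewrite cn1 cnM cn_conj Z1 mulr1 subr_gt0.
rewrite /tau => h; have h2 : Z * (lam - Z) = p * (1 - lam^* * Z) by rewrite -h divfK.
have -> : (lam + lam^* * p) * Z = Z * (lam - Z) + Z ^+ 2 + p - p * (1 - lam^* * Z) by ring.
by rewrite h2; ring.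
Qed.

Variables (lam : C) (eps kap K mu : R) (ph : 'I_2 -> C -> C).
Hypothesis lam1 : cn lam < 1.
Let c0 : C := (1 - lam) / (1 - lam^*).
Hypothesis cb : complex_branches lam c0 eps kap K mu ph.

Definition strip : set C := [set z | `|im z| < eps].

Lemma convex_comb_gt0 (u v t : R) : 0 < u -> 0 < v -> 0 <= t <= 1 -> 0 < (1 - t) * u + t * v.
Proof.
move=> u0 v0 /andP[t0 t1]; have [->|tn] := eqVneq t 0; first by rewrite subr0 mul0r mul1r addr0.
have tp : 0 < t by rewrite lt_def tn.
by apply: ltr_wpDl; rewrite ?mulr_gt0// mulr_ge0 ?subr_ge0// ltW.
Qed.

Lemma strip_convex : cconvex strip.
Proof.
move=> z w t; rewrite /strip /= => hz hw ht.
have -> : im (z + ofR t * (w - z)) = (1 - t) * im z + t * im w by rewrite !reimE; ring.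
move: hz hw; rewrite !ltr_norml => /andP[h1 h2] /andP[h3 h4].
have := @convex_comb_gt0 (im z + eps) (im w + eps) t ltac:(by lra) ltac:(by lra) ht.
have := @convex_comb_gt0 (eps - im z) (eps - im w) t ltac:(by lra) ltac:(by lra) ht.
by move=> *; apply/andP; split; lra.
Qed.

Lemma strip_real x : strip (ofR x).
Proof. by rewrite /strip /= ?im_ofR normr0; exact: cb_eps cb. Qed.

(** The mean value inequality for [ph k] minus z/2. Contraction, monotonicity on the reals and
    invariance of the half planes are all read off from it. *)
Lemma branch_half k z w : strip z -> strip w ->
  cn (ph k w - ph k z - (w - z) / 2) <= kap / 2 * cn (w - z).
Proof.
move=> hz hw.
have [d hd] : exists d : C -> C, forall u, strip u -> cder (ph k) u (d u) /\ cn (d u - 2^-1) <= kap / 2.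
  have h u : exists d, strip u -> cder (ph k) u d /\ cn (d - 2^-1) <= kap / 2.
    have [su|] := pselect (strip u); last by exists 0.
    by have [d [h1 h2 _]] := cb_der cb k su; exists d.
  by have [d hd] := choice h; exists d.
have := @mvi R strip (fun u => ph k u - 2^-1 * u) (fun u => d u - 2^-1) (kap / 2) z w strip_convex.
have -> : ph k w - ph k z - (w - z) / 2 = ph k w - 2^-1 * w - (ph k z - 2^-1 * z) by field.
apply => // [u su|u su]; last by have [] := hd u su.
have [h _] := hd u su.
by apply: cder_eq (cderB h (cderZ 2^-1 (cder_id u))) _; rewrite mulr1.
Qed.

Lemma branch_contract k z w : strip z -> strip w ->
  cn (ph k w - ph k z) <= (1 + kap) / 2 * cn (w - z).
Proof.
move=> hz hw; have h := branch_half k hz hw.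
have -> : ph k w - ph k z = (ph k w - ph k z - (w - z) / 2) + (w - z) / 2 by rewrite subrK.
apply: le_trans (cnD _ _) _; rewrite [cn (_ / _)]cnM cnV -(ofRn R 2) cn_ofR ger0_norm//.
by move: h; rewrite -(ofRn R 2); lra.
Qed.

Definition phr k x : R := re (ph k (ofR x)).

Lemma phrE k x : ph k (ofR x) = ofR (phr k x).
Proof. by apply: cplx_ext; rewrite ?re_ofR ?im_ofR//; exact: cb_real cb k _ _. Qed.

Lemma phr_half k x y : `|phr k y - phr k x - (y - x) / 2| <= kap / 2 * `|y - x|.
Proof.
have := branch_half k (strip_real x) (strip_real y); rewrite !phrE -!ofRB.
by rewrite -(ofRn R 2) -ofRV -ofRM -ofRB !cn_ofR.
Qed.

Lemma phr_incr k x y : x < y -> phr k x < phr k y.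
Proof.
move=> xy; have := phr_half k x y; have /andP[k0 k1] := cb_kap cb.
rewrite [`|y - x|]gtr0_norm ?subr_gt0// ler_norml => /andP[h _].
have : 0 < y - x by rewrite subr_gt0.
nra.
Qed.

Lemma phr_incr_le k x y : x <= y -> phr k x <= phr k y.
Proof. by rewrite le_eqVlt => /predU1P[->//|/(phr_incr k)/ltW]. Qed.

Lemma phr_cont k : continuous (phr k).
Proof.
move=> x A /nbhs_ballP[e /= e0 he]; apply/nbhs_ballP; exists e => //= y.
rewrite -ball_normE /= => hxy; apply: he; rewrite -ball_normE /=.
have h := phr_half k y x; have /andP[k0 k1] := cb_kap cb.
apply: le_lt_trans hxy.
have -> : phr k x - phr k y = (phr k x - phr k y - (x - y) / 2) + (x - y) / 2 by ring.
apply: le_trans (ler_normD _ _) _; rewrite [`|(x - y) / 2|]normrM [`|2^-1|]gtr0_norm//.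
have := normr_ge0 (x - y); nra.
Qed.

Lemma phr_left : phr ord0 (-1) = -1.
Proof. by apply: (@ofR_inj R); rewrite -phrE !ofRE (cb_left cb). Qed.
Lemma phr_right : phr ord_max 1 = 1.
Proof. by apply: (@ofR_inj R); rewrite -phrE !ofRE (cb_right cb). Qed.
Lemma phr_mid : phr ord0 1 = phr ord_max (-1).
Proof.
apply: (@ofR_inj R); rewrite -!phrE -(cb_shift0 cb); first by congr (ph _ _); rewrite !ofRE; ring.
exact: strip_real.
Qed.
Let m := phr ord0 1.
Lemma phr_mid_bnd : -1 < m < 1.
Proof.
rewrite /m; apply/andP; split.
  by rewrite -phr_left; apply: phr_incr; lra.
by rewrite phr_mid -[X in _ < X]phr_right; apply: phr_incr; lra.
Qed.

(** The shift by 1 in the argument contributes a factor -1, which turns [z0] into [c0]. *)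
Lemma circle_paramE x : circle_param lam x = c0 * ce (ofR x).
Proof.
rewrite /circle_param /z0 /c0 ce_re re_ofR im_ofR mulr0 expR0 ofR1 mul1r.
have -> : expi (pi * (x + 1)) = - expi (pi * x).
  rewrite mulrDr mulr1 /expi cosDpi sinDpi.
  by apply: cplx_ext.
rewrite mulNr -mulrN -mulNr opprB; ring.
Qed.

Lemma cn_c0 : cn c0 = 1.
Proof.
have n0 : cn (1 - lam) != 0.
  rewrite cn_eq0 subr_eq0; apply/eqP => h; move: lam1; rewrite -h cn1 ltxx//.
rewrite /c0 cnM cnV; have -> : 1 - lam^* = (1 - lam)^* by rewrite rmorphB rmorph1.
by rewrite cn_conj divff.
Qed.

Lemma c0_neq0 : c0 != 0.
Proof. by rewrite -cn_gt0 cn_c0. Qed.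

Lemma cn_circle x : cn (c0 * ce (ofR x)) = 1.
Proof. by rewrite cnM cn_c0 mul1r cn_ce im_ofR mulr0 expR0. Qed.

Lemma tau_branch k z : strip z -> tau lam (c0 * ce (ph k z)) = c0 * ce z.
Proof.
move=> sz; apply: tau_root => //; have := cb_sum cb sz; have := cb_prod cb sz.
set Z0 := c0 * ce (ph ord0 z); set Z1 := c0 * ce (ph ord_max z); set p := c0 * ce z => e1 e2.
have : k = ord0 \/ k = ord_max.
  by case: k => -[|[|]]// i; [left|right]; apply: val_inj.
by case=> ->; rewrite -/Z0 -/Z1 -e2 -e1; ring.
Qed.

Lemma circle_inj x y : c0 * ce (ofR x) = c0 * ce (ofR y) -> `|x - y| < 2 -> x = y.
Proof.
move=> /(mulfI c0_neq0) h; rewrite ltr_norml => /andP[h1 h2].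
have key (u v : R) : ce (ofR u) = ce (ofR v) -> u - v < 2 -> u <= v.
  move=> e uv; rewrite leNgt; apply/negP => vu.
  have : ce (ofR u - ofR v) != 1.
    by apply: ce_neq1; rewrite -ofRB re_ofR im_ofR eqxx /= uv subr_gt0 vu.
  by rewrite ceB e divff ?eqxx// ce_neq0.
by apply/eqP; rewrite eq_le !key//; lra.
Qed.

(** Sum and product of the two known solutions agree with the coefficients of the quadratic
    equation, so a third solution would be a further root. *)
Lemma circle_branches (Z : R) x : tau lam (c0 * ce (ofR Z)) = c0 * ce (ofR x) ->
  exists k, c0 * ce (ofR Z) = c0 * ce (ofR (phr k x)).
Proof.
move=> /(tau_rootE lam1 (cn_circle Z)); set W := c0 * ce (ofR Z).
have := cb_sum cb (strip_real x); have := cb_prod cb (strip_real x).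
rewrite !phrE; set Z0 := c0 * ce (ofR (phr ord0 x)); set Z1 := c0 * ce (ofR (phr ord_max x)).
set p := c0 * ce (ofR x) => e1 e2 h.
have : (W - Z0) * (W - Z1) = 0.
  have -> : (W - Z0) * (W - Z1) = W ^+ 2 + Z0 * Z1 - (Z0 + Z1) * W by ring.
  by rewrite e1 e2 h subrr.
move=> /eqP; rewrite mulf_eq0 !subr_eq0 => /orP[/eqP e|/eqP e]; by [exists ord0|exists ord_max].
Qed.

Lemma ord2P (k : 'I_2) : k = ord0 \/ k = ord_max.
Proof. by case: k => -[|[|]]// i; [left|right]; apply: val_inj. Qed.

Lemma phr_in k x : x \in `[-1, 1] -> -1 <= phr k x <= 1.
Proof.
rewrite in_itv /= => /andP[x0 x1]; have /andP[b1 b2] := phr_mid_bnd.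
case: (ord2P k) => ->.
  have := phr_incr_le ord0 x0; have := phr_incr_le ord0 x1; rewrite phr_left -/m => *.
  by apply/andP; split; lra.
have := phr_incr_le ord_max x0; have := phr_incr_le ord_max x1; rewrite phr_right -phr_mid -/m => *.
by apply/andP; split; lra.
Qed.

Lemma phr_in_oo k x : -1 < x < 1 -> -1 < phr k x < 1.
Proof.
move=> /andP[x0 x1]; have /andP[b1 b2] := phr_mid_bnd.
case: (ord2P k) => ->.
  have := phr_incr ord0 x0; have := phr_incr ord0 x1; rewrite phr_left -/m => *.
  by apply/andP; split; lra.
have := phr_incr ord_max x0; have := phr_incr ord_max x1; rewrite phr_right -phr_mid -/m => *.
by apply/andP; split; lra.
Qed.

(** Each value [Phi k x] sits over the same circle point as some [phr j x], hence equals it for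
    interior x; monotonicity on either side of the break point forces j = k. *)
Lemma interval_map_unique T Phi : interval_map lam T Phi ->
  forall k x, x \in `[-1, 1] -> Phi k x = phr k x.
Proof.
move=> im; have /andP[b1 b2] := phr_mid_bnd.
have i1 : (1 : R) \in `[-1, 1] by rewrite in_itv /= lexx andbT; lra.
have im1 : (-1 : R) \in `[-1, 1] by rewrite in_itv /= lexx /=; lra.
have cand k x : x \in `[-1, 1] -> exists j, c0 * ce (ofR (Phi k x)) = c0 * ce (ofR (phr j x)).
  move=> hx; apply: circle_branches; rewrite -!circle_paramE.
  exact: (im_branch_tau im k hx).
have rng k x : x \in `[-1, 1] -> -1 <= Phi k x <= 1.
  by move=> hx; have := im_branch_maps im k hx; rewrite in_itv.
(* Strict monotonicity places this value strictly between -1 and 1, which excludes the other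
   candidate 1. *)
have P01 : Phi ord0 1 = m.
  have h1 : -1 < Phi ord0 1.
    by rewrite -(im_branch_left im); apply: (im_branch_incr im ord0 im1 i1); lra.
  have h2 : Phi ord0 1 < 1.
    by rewrite (im_branch_mid im) -[X in _ < X](im_branch_right im); apply: (im_branch_incr im ord_max im1 i1); lra.
  have [j hj] := cand ord0 1 i1; case: (ord2P j) => jE; rewrite jE in hj.
    by apply: (circle_inj hj); rewrite ltr_norml -/m; apply/andP; split; lra.
  rewrite phr_right in hj.
  have := circle_inj hj; rewrite ltr_norml => h; have {}h : Phi ord0 1 = 1 by apply: h; apply/andP; split; lra.
  by move: h2; rewrite h ltxx.
have P1m : Phi ord_max (-1) = m by rewrite -(im_branch_mid im).
move=> k x hx; have := hx; rewrite in_itv /= => /andP[x0 x1].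
move: x0 x1; rewrite le_eqVlt => /predU1P[<- _|x0].
  by case: (ord2P k) => ->; [rewrite phr_left (im_branch_left im)|rewrite P1m -phr_mid].
rewrite le_eqVlt => /predU1P[->|x1].
  by case: (ord2P k) => ->; [rewrite P01|rewrite phr_right (im_branch_right im)].
have [j hj] := cand k x hx.
have /andP[r1 r2] := rng k x hx.
have /andP[r3 r4] := phr_in_oo j (introT andP (conj x0 x1)).
have e := circle_inj hj; rewrite ltr_norml in e.
have {}e : Phi k x = phr j x by apply: e; apply/andP; split; lra.
(* With exchanged indices the value would lie on the wrong side of [m]. *)
rewrite e; case: (ord2P k) e => kE; case: (ord2P j) => jE; rewrite kE jE // => e.
- have := im_branch_incr im ord0 hx i1 x1; rewrite P01 e.
  by have := phr_incr ord_max x0; rewrite -phr_mid -/m; lra.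
- have := im_branch_incr im ord_max im1 hx x0; rewrite P1m e.
  by have := phr_incr ord0 x1; rewrite -/m; lra.
Qed.

Lemma phr_analytic k : real_analytic_on `[-1, 1]%classic (phr k).
Proof.
move=> x _; have e0 := cb_eps cb.
pose M := K + (cn (ofR x) + eps) / 2.
have inS z : cball (ofR x) eps z -> strip z.
  rewrite /cball /strip /= => h; apply: le_lt_trans h.
  by have := im_le_cn (z - ofR x); rewrite imB im_ofR subr0.
have hM z : cball (ofR x) eps z -> cn (ph k z) <= M.
  move=> zB; have -> : ph k z = (ph k z - z / 2) + z / 2 by rewrite subrK.
  apply: le_trans (cnD _ _) _; apply: lerD; first exact: (cb_bnd cb k (inS z zB)).
  rewrite cnM cnV -(ofRn R 2) cn_ofR ger0_norm// ler_pM2r ?invr_gt0//.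
  have := cnD (ofR x) (z - ofR x); rewrite [ofR x + _]addrC subrK => h.
  by apply: le_trans h _; rewrite lerD2l; exact: ltW.
have hD z : cball (ofR x) eps z -> exists d, cder (ph k) z d.
  by move=> /inS/(cb_der cb k)[d []]; exists d.
have [c _ hc] := taylor e0 hD hM.
(* The remainder is geometric with ratio |y - x| / (eps / 2), which is less than 1 exactly within
   this radius. *)
exists (fun n => re (c n)), (eps / 2); first by rewrite divr_gt0.
move=> y _ hy; pose q := cn (ofR y - ofR x) / (eps / 2).
have cxy : cn (ofR y - ofR x) = `|y - x| by rewrite -ofRB cn_ofR.
have q1 : `|q| < 1.
  rewrite ger0_norm; last by rewrite divr_ge0 ?cn_ge0//; lra.
  by rewrite ltr_pdivrMr; lra.
have hg : geometric (M / (1 - q)) q @ \oo --> (0 : R) by apply: cvg_geometric.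
apply/cvgrPdist_le => e e1.
move/cvgrPdist_le : hg => /(_ e e1) [N _ hN]; exists N => // n Nn.
have := hN n Nn; rewrite /= sub0r normrN => h.
apply: le_trans h; have := hc (eps / 2) n (ofR y) ltac:(by apply/andP; split; lra) ltac:(by lra).
rewrite -/q => h; apply: le_trans (le_trans _ h) _; last first.
  by rewrite /geometric /= mulrAC ler_norm.
have -> : phr k y - pseries (fun n0 => re (c n0)) (y - x) n =
   re (ph k (ofR y) - \sum_(k0 < n) c k0 * (ofR y - ofR x) ^+ k0).
  rewrite reB /phr; congr (_ - _); rewrite /pseries /series /= big_mkord.
  elim: n {Nn h} => [|n IH]; first by rewrite !big_ord0.
  rewrite !big_ord_recr /= reD -IH; congr (_ + _).
  by rewrite -ofRB -ofRX !reimE mulr0 subr0.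
exact: re_le_cn.
Qed.

Lemma interval_map_exists : exists T, interval_map lam T phr.
Proof.
have /andP[b1 b2] := phr_mid_bnd.
(* On the half-open interval the two branches have disjoint images [-1, m) and [m, 1), so the
   preimage is unique; x = 1 has none and receives the default 1 of [xget], the value required
   there. *)
pose A x : set R := [set y | -1 <= y < 1 /\ exists k, phr k y = x].
pose T x := xget 1 (A x).
have ivt k (v : R) : phr k (-1) <= v <= phr k 1 -> exists2 y, -1 <= y <= 1 & phr k y = v.
  move=> hv; have [|||c hc <-] := @IVT R (phr k) (-1) 1 v.
  - by lra.
  - by apply: continuous_subspaceT; exact: phr_cont.
  - case/andP: hv => h1 h2; have h3 := le_trans h1 h2.
    by rewrite (min_idPl h3) (max_idPr h3) h1.
  by exists c => //; move: hc; rewrite in_itv.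
have TA x : x \in `[-1, 1] -> x < 1 -> A x (T x).
  rewrite in_itv /= => /andP[x0 _] x1; apply: (@xgetPex R 1 (A x)).
  have [xm|xm] := ltP x m.
    have [y /andP[y0 y1] yx] := ivt ord0 x ltac:(by rewrite phr_left -/m x0 ltW).
    exists y; split; last by exists ord0.
    rewrite y0 /= lt_def y1 andbT; apply/eqP => y1'; move: xm; rewrite -yx -y1' /m ltxx//.
  have [y /andP[y0 y1] yx] := ivt ord_max x ltac:(by rewrite phr_right -phr_mid -/m xm ltW).
  exists y; split; last by exists ord_max.
  rewrite y0 /= lt_def y1 andbT; apply/eqP => y1'; move: x1; rewrite -yx -y1' phr_right ltxx//.
have lt1 k y : y < 1 -> phr k y < 1.
  move=> y1; case: (ord2P k) => ->; last by rewrite -[X in _ < X]phr_right; exact: phr_incr.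
  by apply: lt_trans (phr_incr ord0 y1) _.
have inj k x y : phr k x = phr k y -> x = y.
  by move=> e; apply/eqP; rewrite eq_le !leNgt; apply/andP; split; apply/negP => /(phr_incr k); rewrite e ltxx.
have dis j k x y : -1 <= y < 1 -> -1 <= x < 1 -> phr j y = phr k x -> y = x.
  move=> /andP[y0 y1] /andP[x0 x1].
  case: (ord2P j) => ->; case: (ord2P k) => -> // e; try exact: inj e.
    have := phr_incr ord0 y1; have := phr_incr_le ord_max x0; rewrite -phr_mid; lra.
  have := phr_incr ord0 x1; have := phr_incr_le ord_max y0; rewrite -phr_mid; lra.
have T1 : T 1 = 1.
  rewrite /T; case: xgetP => // y -> [/andP[y0 y1] [k hk]].
  by have := lt1 k _ y1; rewrite hk ltxx.
have i1 : (1 : R) \in `[-1, 1] by rewrite in_itv /= lexx andbT; lra.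
have im1 : (-1 : R) \in `[-1, 1] by rewrite in_itv /= lexx /=; lra.
have Tin x : x \in `[-1, 1] -> T x \in `[-1, 1].
  move=> hx; have := hx; rewrite in_itv /= => /andP[x0].
  rewrite le_eqVlt => /predU1P[->|x1]; first by rewrite T1.
  by have [/andP[y0 /ltW y1] _] := TA x hx x1; rewrite in_itv /= y0 y1.
exists T; split => //.
- move=> x hx; have := hx; rewrite in_itv /= => /andP[x0].
  rewrite le_eqVlt !circle_paramE => /predU1P[->|x1].
    by rewrite T1 -[LHS](tau_branch ord_max (strip_real 1)) phrE phr_right.
  have [_ [k hk]] := TA x hx x1.
  by rewrite -[in RHS]hk -phrE (tau_branch k (strip_real _)).
- have [h [k hk]] := TA (-1) im1 ltac:(by lra).
  have h2 : -1 <= (-1 : R) < 1 by rewrite lexx /=; lra.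
  by apply: (dis k ord0 (-1) (T (-1)) h h2); rewrite hk phr_left.
- by move=> k x /(phr_in k); rewrite in_itv.
- by move=> k x y _ _; exact: phr_incr.
- exact: phr_analytic.
- move=> k x; rewrite in_itv /= => hx; have /andP[p1 p2] := phr_in_oo k hx.
  have [h [j hj]] := TA (phr k x) ltac:(by rewrite in_itv /= !ltW) p2.
  by apply: (dis j k x _ h _ hj); move: hx => /andP[/ltW -> ->].
- move=> k x _; rewrite !circle_paramE -phrE; exact: tau_branch (strip_real x).
- exact: phr_left.
- exact: phr_mid.
- exact: phr_right.
Qed.

End IntervalBranches.

(** * The domain and the transfer operator on it *)

Section TransferDomain.
Variable R : realType.
Local Notation C := (Cplx R).
Implicit Types (z w : C) (x y : R).

Lemma closed_bounded_compact (A : set C) (M : R) :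
  closed A -> (forall z, A z -> cn z <= M) -> compact A.
Proof.
move=> cA bA; rewrite compact_ultra => F FU FA.
have [|l hl] := @ultra_limit R C F id M FU; first exact: filterS bA FA.
have Fl : F --> l by move=> P /cnbhsP[e e0 he]; apply: filterS (hl e e0) => z /he.
exists l; split => //; apply: cA => P /Fl FP.
by have [z zP] := filter_ex (@filterI _ F _ _ _ FA FP); exists z.
Qed.

Lemma lip_continuous (f : C -> C) (M : R) : (forall z w, cn (f w - f z) <= M * cn (w - z)) ->
  continuous f.
Proof.
move=> h z; apply/ccontP => e e0; have M0 : 0 < `|M| + 1 by rewrite ltr_wpDl.
exists (e / (`|M| + 1)); first by rewrite divr_gt0.
move=> w; rewrite ltr_pdivlMr// => hw; apply: le_lt_trans (h _ _) _.
by have := ler_norm M; have := cn_ge0 (w - z); nra.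
Qed.

Lemma sum_ord2 (F : 'I_2 -> C) : \sum_(k < 2) F k = F ord0 + F ord_max.
Proof. by rewrite !big_ord_recl big_ord0 addr0; congr (_ + F _); apply: val_inj. Qed.

Section Ellipse.
Variables (a b : R).
Hypotheses (a0 : 0 < a) (b0 : 0 < b).

(** Convex, and a disc up to a linear change of scale. The two half axes can be chosen
    independently: b is the width of the strip, while a must be large compared with the real
    displacement of the branches. *)
Definition ellipse : set C := [set z | (re z / a) ^+ 2 + (im z / b) ^+ 2 < 1].

Definition stretch (u v : R) z : C := cpx (re z * u) (im z * v).

Lemma stretch_lip (u v : R) z w : cn (stretch u v w - stretch u v z) <= (`|u| + `|v|) * cn (w - z).
Proof.
apply: le_trans (cn_le_reim _) _; rewrite /stretch !reB !imB !re_cpx !im_cpx -!mulrBl !normrM.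
have := re_le_cn (w - z); have := im_le_cn (w - z); rewrite reB imB.
by move: (normr_ge0 u) (normr_ge0 v); set s := `|u|; set t := `|v|; nra.
Qed.

Lemma ellipseE z : ellipse z <-> cn (stretch a^-1 b^-1 z) < 1.
Proof.
rewrite /ellipse /=.
have -> : (re z / a) ^+ 2 + (im z / b) ^+ 2 = cn (stretch a^-1 b^-1 z) ^+ 2.
  by rewrite cn_sqr /stretch re_cpx im_cpx.
by rewrite expr_lt1 ?cn_ge0.
Qed.

Lemma stretchK z : stretch a b (stretch a^-1 b^-1 z) = z.
Proof. by apply: cplx_ext; rewrite /stretch !reimE divfK// gt_eqF. Qed.
Lemma stretchVK z : stretch a^-1 b^-1 (stretch a b z) = z.
Proof. by apply: cplx_ext; rewrite /stretch !reimE mulfK// gt_eqF. Qed.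

Lemma ellipse_convex : cconvex ellipse.
Proof.
move=> z w t /ellipseE hz /ellipseE hw ht; apply/ellipseE.
have hz' : cball (0 : C) 1 (stretch a^-1 b^-1 z) by rewrite /cball /= subr0.
have hw' : cball (0 : C) 1 (stretch a^-1 b^-1 w) by rewrite /cball /= subr0.
have := cball_convex hz' hw' ht; rewrite /cball /= subr0; congr (cn _ < _).
by apply: cplx_ext; rewrite /stretch !reimE; ring.
Qed.

Lemma ellipse_open : open ellipse.
Proof.
apply/copenP => z /ellipseE hz.
have M0 : 0 < `|a^-1| + `|b^-1| + 1 by rewrite ltr_wpDl ?addr_ge0.
exists ((1 - cn (stretch a^-1 b^-1 z)) / (`|a^-1| + `|b^-1| + 1)); first by rewrite divr_gt0 ?subr_gt0.
move=> w; rewrite ltr_pdivlMr// => hw; apply/ellipseE.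
have := stretch_lip a^-1 b^-1 z w; have := @cn_ge R (stretch a^-1 b^-1 w) (stretch a^-1 b^-1 z).
by have := cn_ge0 (w - z); nra.
Qed.

Lemma ellipse_bounds z : ellipse z -> `|re z| < a /\ `|im z| < b.
Proof.
have h x (c : R) : 0 < c -> (x / c) ^+ 2 < 1 -> `|x| < c.
  move=> c0 hx; have : `|x / c| < 1.
    by rewrite -(@ltr_pXn2r _ 2) ?nnegrE// expr1n real_normK ?num_real.
  by rewrite normrM normfV (gtr0_norm c0) ltr_pdivrMr// mul1r.
rewrite /ellipse /= => hz; split; apply: h => //; apply: le_lt_trans hz.
  by rewrite lerDl sqr_ge0.
by rewrite lerDr sqr_ge0.
Qed.

Lemma ellipse_cn z : ellipse z -> cn z <= a + b.
Proof.
by move=> /ellipse_bounds[/ltW h1 /ltW h2]; apply: le_trans (cn_le_reim _) _; exact: lerD.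
Qed.

Lemma ellipse_disk : bounded_topological_disk ellipse.
Proof.
split; first exact: ellipse_open.
  apply: (bounded_onP ellipse id).2; exists (a + b) => z /ellipse_cn.
  by rewrite cn_le.
have dE z : (`|z| < 1) = (cn z < 1) by rewrite cnE -ofR1 ltcR'.
exists (stretch a^-1 b^-1), (stretch a b); split; [split|split].
- by move=> z /ellipseE; rewrite /= dE.
- by move=> w; rewrite /= dE => hw; apply/ellipseE; rewrite stretchVK.
- by move=> z _; exact: stretchK.
- by move=> z _; exact: stretchVK.
- by apply: continuous_subspaceT; exact: lip_continuous (stretch_lip _ _).
- by apply: continuous_subspaceT; exact: lip_continuous (stretch_lip _ _).
Qed.

End Ellipse.

Variables (lam : C) (eps kap K mu : R) (ph : 'I_2 -> C -> C).
Hypothesis lam1 : cn lam < 1.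
Let c0 : C := (1 - lam) / (1 - lam^*).
Hypothesis cb : complex_branches lam c0 eps kap K mu ph.

(** The bound 3 on real points leaves room for the interval and for its translate by 2, where jumps
    and periods are formed. *)
Record transfer_domain (D : set C) (rho M : R) : Prop := TransferDomain {
  td_open : open D;
  td_convex : cconvex D;
  td_disk : bounded_topological_disk D;
  td_bounded : forall z, D z -> cn z <= M;
  td_strip : forall z, D z -> `|im z| < eps;
  td_real_ball : forall x, `|x| <= 3 -> cball (ofR x) rho `<=` D;
  td_rho : 0 < rho;
  td_ball : forall k z, D z -> cball (ph k z) rho `<=` D }.

(** X and Y are coordinates divided by the half axes. A branch halves X up to the shift t and
    contracts Y by c; the summand (1 - c^2) / 32 is the margin for a ball around the image. *)
Lemma shrink_lt1 (c X Y t : R) : 2^-1 <= c -> c < 1 -> 0 <= X -> 0 <= Y ->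
  X ^+ 2 + Y ^+ 2 < 1 -> 0 <= t <= (1 - c ^+ 2) / 8 ->
  (X / 2 + t + (1 - c ^+ 2) / 32) ^+ 2 + (c * Y + (1 - c ^+ 2) / 32) ^+ 2 < 1.
Proof.
move=> c12 c1 X0 Y0 XY; have cu : c ^+ 2 = 1 - (1 - c ^+ 2) by ring.
have u1 : 1 - c ^+ 2 <= 3 / 4 by nra.
have u0 : 0 < 1 - c ^+ 2 by nra.
move: cu u1 u0; set u := 1 - c ^+ 2 => cu u1 u0 /andP[t0 t1].
have X1 : X <= 1 by nra.
have Y1 : Y <= 1 by nra.
have cY : c * Y <= 1 by nra.
have cY0 : 0 <= c * Y by apply: mulr_ge0 => //; lra.
have s1 : (X / 2 + t + u / 32) ^+ 2 <= (X / 2 + (u / 8 + u / 32)) ^+ 2.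
  by apply: lerXn2r; rewrite ?nnegrE; lra.
have {t0 t1} s2 : (c * Y + u / 32) ^+ 2 = (1 - u) * Y ^+ 2 + u / 16 * (c * Y) + (u / 32) ^+ 2.
  by rewrite -cu; field.
have s3 : (X / 2 + (u / 8 + u / 32)) ^+ 2 = X ^+ 2 / 4 + u * 5 / 32 * X + (u * 5 / 32) ^+ 2 by field.
have s4 : X ^+ 2 / 4 <= (1 - u) * X ^+ 2.
  by rewrite mulrC; apply: ler_wpM2r; [exact: sqr_ge0|lra].
have s5 : u * 5 / 32 * X <= u * 5 / 32 * 1.
  by apply: ler_wpM2l => //; lra.
have s6 : u / 16 * (c * Y) <= u / 16 * 1.
  by apply: ler_wpM2l => //; lra.
have s7 : (1 - u) * (X ^+ 2 + Y ^+ 2) <= (1 - u) * 1.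
  by apply: ler_wpM2l; [lra|exact: ltW].
have s8 : (u * 5 / 32) ^+ 2 <= u * 5 / 32 * (1 / 2).
  by rewrite expr2; apply: ler_wpM2l; lra.
have s9 : (u / 32) ^+ 2 <= u / 32 * (1 / 2).
  by rewrite expr2; apply: ler_wpM2l; lra.
apply: le_lt_trans (lerD s1 (lexx _)) _; rewrite s2 s3.
move: s4 s5 s6 s7 s8 s9; move: ((_ / 32) ^+ 2) ((_ * 5 / 32) ^+ 2) (X ^+ 2) (Y ^+ 2) (c * Y).
by move=> A B E F G *; lra.
Qed.

Lemma transfer_domain_exists : exists D rho M, transfer_domain D rho M.
Proof.
have e0 := cb_eps cb; have /andP[k0 k1] := cb_kap cb.
pose c := (1 + kap) / 2; have c12 : 2^-1 <= c by rewrite /c; lra.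
have c1 : c < 1 by rewrite /c; lra.
have K0 : 0 <= K by apply: le_trans (cb_bnd cb ord0 (strip_real cb 0)); exact: cn_ge0.
have w0 : 0 < 1 - c ^+ 2 by nra.
(* The 4 leaves a margin around [-3, 3]; the second entry makes the shift K / a at most (1 - c^2) /
   8. *)
pose a := Num.max 4 (8 * (K + 1) / (1 - c ^+ 2)).
have a4 : 4 <= a by rewrite le_max lexx.
have a0 : 0 < a by lra.
have aK : K / a <= (1 - c ^+ 2) / 8.
  have h : 8 * (K + 1) / (1 - c ^+ 2) <= a by rewrite le_max lexx orbT.
  rewrite ler_pdivrMr//; move: h; rewrite ler_pdivrMr//; lra.
pose th := c ^+ 2 + (1 - c ^+ 2) / 2.
have th1 : th < 1 by rewrite /th; lra.
pose dl := (1 - th) / 16.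
have d0 : 0 < dl by rewrite /dl; lra.
have d1 : dl <= 1 / 16 by rewrite /dl /th; have := sqr_ge0 c; lra.
(* A displacement below [rho] changes either normalised coordinate by at most [dl], which equals (1
   - c^2) / 32. *)
pose rho := dl * Num.min a eps.
have r0 : 0 < rho by rewrite mulr_gt0// lt_min a0.
have rE x (s : R) : 0 < s -> Num.min a eps <= s -> `|x| < rho -> `|x / s| <= dl.
  move=> s0 hs hx; rewrite normrM normfV (gtr0_norm s0) ler_pdivrMr//.
  by apply: ltW; apply: lt_le_trans hx _; rewrite /rho ler_pM2l.
exists (ellipse a eps), rho, (a + eps); split => //.
- exact: ellipse_open.
- exact: ellipse_convex.
- exact: ellipse_disk.
- exact: ellipse_cn.
- by move=> z /(ellipse_bounds a0 e0)[].
- move=> x hx w; rewrite /cball /= => hw.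
  have h1 : `|(re w - x) / a| <= dl.
    apply: rE => //; first by rewrite ge_min lexx.
    by apply: le_lt_trans hw; have := re_le_cn (w - ofR x); rewrite reB re_ofR.
  have h2 : `|im w / eps| <= dl.
    apply: rE => //; first by rewrite ge_min lexx orbT.
    by apply: le_lt_trans hw; have := im_le_cn (w - ofR x); rewrite imB im_ofR subr0.
  have h3 : `|x / a| <= 3 / 4.
    by rewrite normrM normfV (gtr0_norm a0) ler_pdivrMr//; lra.
  have h4 : `|re w / a| <= 13 / 16.
    have -> : re w / a = (re w - x) / a + x / a by ring.
    by apply: le_trans (ler_normD _ _) _; apply: le_trans (lerD h1 h3) _; lra.
  have h5 := le_trans h2 d1.
  rewrite /ellipse /= -[(re w / a) ^+ 2]real_normK ?num_real// -[(im w / eps) ^+ 2]real_normK ?num_real//.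
  move: h4 h5 (normr_ge0 (re w / a)) (normr_ge0 (im w / eps)).
  move: (`|re w / a|) (`|im w / eps|) => s t *; nra.
move=> k z Dz w; rewrite /cball /= => hw.
have [bx by_] := ellipse_bounds a0 e0 Dz.
have hs : strip eps z by [].
(* Compare with the real point below z, whose image is real. *)
have him : `|im (ph k z)| <= c * `|im z|.
  have := branch_contract cb k (strip_real cb (re z)) hs.
  have -> : z - ofR (re z) = ofR (im z) * ci by apply: cplx_ext; rewrite !reimE; ring.
  rewrite cnM cn_ci mulr1 cn_ofR; apply: le_trans.
  have := im_le_cn (ph k z - ph k (ofR (re z))); rewrite imB (cb_real cb k (im_ofR _)) subr0.
  by [].
have hre : `|re (ph k z)| <= `|re z| / 2 + K.
  have := cb_bnd cb k hs; have := re_le_cn (ph k z - z / 2).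
  rewrite reB; have -> : re (z / 2) = re z / 2 by rewrite -(ofRn R 2) -ofRV !reimE; ring.
  move=> h1 h2; have -> : re (ph k z) = re (ph k z) - re z / 2 + re z / 2 by ring.
  apply: le_trans (ler_normD _ _) _; rewrite [`|re z / 2|]normrM [`|2^-1|]gtr0_norm//; lra.
have hdx : `|(re w - re (ph k z)) / a| <= dl.
  apply: rE => //; first by rewrite ge_min lexx.
  by rewrite -reB; apply: le_lt_trans (re_le_cn _) hw.
have hdy : `|(im w - im (ph k z)) / eps| <= dl.
  apply: rE => //; first by rewrite ge_min lexx orbT.
  by rewrite -imB; apply: le_lt_trans (im_le_cn _) hw.
rewrite /ellipse /=.
pose X := `|re z| / a; pose Y := `|im z| / eps.
have X0 : 0 <= X by rewrite divr_ge0// ltW.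
have Y0 : 0 <= Y by rewrite divr_ge0// ltW.
have XY : X ^+ 2 + Y ^+ 2 < 1.
  by move: Dz; rewrite /ellipse /= /X /Y !expr_div_n !real_normK ?num_real.
have hX : `|re w / a| <= X / 2 + K / a + dl.
  have -> : re w / a = re (ph k z) / a + (re w - re (ph k z)) / a by ring.
  apply: le_trans (ler_normD _ _) _; apply: lerD => //.
  rewrite normrM normfV (gtr0_norm a0) ler_pdivrMr//.
  have -> : (X / 2 + K / a) * a = `|re z| / 2 + K by rewrite /X; field; rewrite gt_eqF.
  by [].
have hY : `|im w / eps| <= c * Y + dl.
  have -> : im w / eps = im (ph k z) / eps + (im w - im (ph k z)) / eps by ring.
  apply: le_trans (ler_normD _ _) _; apply: lerD => //.
  by rewrite normrM normfV (gtr0_norm e0) /Y mulrA; apply: ler_wpM2r => //; rewrite invr_ge0 ltW.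
have X1 : X < 1 by nra.
have Y1 : Y < 1 by nra.
have hX2 : (re w / a) ^+ 2 <= (X / 2 + K / a + dl) ^+ 2.
  by rewrite -[leLHS]real_normK ?num_real//; apply: lerXn2r; rewrite ?nnegrE//; exact: le_trans (normr_ge0 _) hX.
have hY2 : (im w / eps) ^+ 2 <= (c * Y + dl) ^+ 2.
  by rewrite -[leLHS]real_normK ?num_real//; apply: lerXn2r; rewrite ?nnegrE//; exact: le_trans (normr_ge0 _) hY.
have t0 : 0 <= K / a by rewrite divr_ge0// ltW.
apply: le_lt_trans (lerD hX2 hY2) _.
have -> : dl = (1 - c ^+ 2) / 32 by rewrite /dl /th; field.
by apply: shrink_lt1 => //; apply/andP.
Qed.

Section OnDomain.
Variables (D : set C) (rho M : R).
Hypothesis td : transfer_domain D rho M.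

Lemma td_real x : `|x| <= 3 -> D (ofR x).
Proof.
by move=> hx; apply: (td_real_ball td hx); rewrite /cball /= subrr cn0; exact: td_rho td.
Qed.

Lemma branch_maps k z : D z -> D (ph k z).
Proof.
move=> Dz; apply: (td_ball td (k := k) Dz).
by rewrite /cball /= subrr cn0; exact: td_rho td.
Qed.

Lemma branch_der k z : D z -> exists d,
  [/\ cder (ph k) z d, derive1 (ph k) z = d, cn (d - 2^-1) <= kap / 2 & im z = 0 -> im d = 0].
Proof.
move=> /(td_strip td)/(cb_der cb k)[d [h1 h2 h3]]; exists d; split => //.
exact: cder_derive1.
Qed.

Lemma branch_derive1 k z : D z -> cder (ph k) z (derive1 (ph k) z).
Proof. by move=> /(branch_der k)[d [h1 -> _ _]]. Qed.

Lemma branch_derive1_le1 k z : D z -> cn (derive1 (ph k) z) <= 1.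
Proof.
move=> /(branch_der k)[d [_ -> h _]]; have /andP[k0 k1] := cb_kap cb.
have := @cn_ge R d (2^-1); rewrite cnV -(ofRn R 2) cn_ofR gtr0_norm//.
by move: h; rewrite -(ofRn R 2); lra.
Qed.

Lemma branch_holomorphic k : holomorphic D (ph k).
Proof. by move=> z /(branch_derive1 k)/cderP[]. Qed.

Lemma branch_compactly k : maps_compactly_into D (ph k).
Proof.
have sub : closure (ph k @` D) `<=` D.
  move=> z hz; have : nbhs z (cball z rho).
    by apply/cnbhsP; exists rho => //; exact: td_rho td.
  move=> /hz[_ [[w Dw <-]]]; rewrite /cball /= => h; apply: (td_ball td (k := k) Dw).
  by rewrite /cball /= cnC.
split => //; apply: (@closed_bounded_compact _ M); first exact: closed_closure.
by move=> z /sub Dz; exact: (td_bounded td Dz).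
Qed.

Lemma branch_contracting k : contracting D (ph k).
Proof.
split; first exact: branch_compactly.
have /andP[k0 k1] := cb_kap cb.
exists (ofR ((1 + kap) / 2)).
  by rewrite -ofR0 -ofR1 lecR' ltcR'; apply/andP; split; lra.
move=> z w Dz Dw; rewrite !cnE -ofRM lecR'.
by apply: (branch_contract cb); [exact: (td_strip td Dw)|exact: (td_strip td Dz)].
Qed.

Lemma branch_fixed_point k : real_fixed_point_and_multiplier D (ph k).
Proof.
have /andP[k0 k1] := cb_kap cb.
have [x [hx hf]] : exists x, `|x| <= 3 /\ ph k (ofR x) = ofR x.
  case: (ord2P k) => ->.
    by exists (-1); rewrite normrN normr1 !ofRE (cb_left cb); split => //; lra.
  by exists 1; rewrite normr1 !ofRE (cb_right cb); split => //; lra.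
have Dx := td_real hx.
exists (ofR x); split => //.
- move=> w Dw hw; apply/eqP; rewrite -subr_eq0; apply/eqP/cn_le0.
  have := branch_contract cb k (td_strip td Dx) (td_strip td Dw); rewrite hw hf.
  by have := cn_ge0 (w - ofR x); nra.
- by rewrite cplx_realP.
- by have [d [_ -> _ h]] := branch_der k Dx; rewrite cplx_realP h.
Qed.

Lemma transfer_operator_exists : exists L : {linear Hinf D -> Hinf D}, is_transfer_operator ph L.
Proof.
have oD := td_open td.
have h (f : Hinf D) : exists g : Hinf D, forall z, D z ->
    g z = \sum_(k < 2) derive1 (ph k) z * f (ph k z).
  apply: (@Hinf_exists R D _ (2 * vn f)) => // z Dz.
    have d1 k : exists d, cder (fun z => derive1 (ph k) z * f (ph k z)) z d.
      have [d hd] := cb_der2 cb k (td_strip td Dz).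
      have [e he] := Hinf_cder f (branch_maps k Dz).
      by eexists; exact: (cderM hd (cder_comp (branch_derive1 k Dz) he)).
    have [d hd] := d1 ord0; have [e he] := d1 ord_max.
    exists (d + e); apply: cder_near (cderD hd he); exists 1 => // w _.
    by rewrite sum_ord2.
  rewrite sum_ord2; apply: le_trans (cnD _ _) _; rewrite !cnM.
  have b k : cn (derive1 (ph k) z) * cn (f (ph k z)) <= vn f.
    rewrite -[leRHS]mul1r; apply: ler_pM; rewrite ?cn_ge0//.
      exact: branch_derive1_le1.
    by apply: Hinf_norm_ubR; exact: branch_maps.
  by apply: le_trans (lerD (b _) (b _)) _; rewrite mulr_natl mulr2n.
have [L hL] := choice h.
have lin : linear L.
  move=> a f g; apply: Hinf_ext => z Dz.
  have -> : (a *: L f + L g) z = a * L f z + L g z by [].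
  rewrite !hL// mulr_sumr -big_split /=; apply: eq_bigr => k _.
  transitivity (derive1 (ph k) z * (a * f (ph k z) + g (ph k z))); first by [].
  by ring.
by exists (linear_of lin) => f z /hL.
Qed.

Lemma transfer_operator_compact (L : {linear Hinf D -> Hinf D}) :
  is_transfer_operator ph L -> compact_operator L.
Proof.
move=> hL; apply: (@transfer_compact R D 2 ph (fun k => derive1 (ph k)) L rho 1 M) => //.
- exact: td_open td.
- exact: td_rho td.
- by move=> z Dz; exact: (td_bounded td Dz).
- by move=> k z Dz; exact: (td_ball td Dz).
- exact: branch_derive1_le1.
Qed.

End OnDomain.
End TransferDomain.

(** * Order of vanishing read off from Taylor remainders *)

Section TaylorOrder.
Variable R : realType.
Local Notation C := (Cplx R).
Implicit Types (f g : C -> C) (z w : C).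

Definition taylor_coefs f z0 (r M : R) (c : nat -> C) :=
  forall (rho : R) n w, 0 < rho < r -> cn (w - z0) < rho ->
    cn (f w - \sum_(k < n) c k * (w - z0) ^+ k) <=
      M * (cn (w - z0) / rho) ^+ n / (1 - cn (w - z0) / rho).

Variables (f : C -> C) (z0 : C) (r M : R) (c : nat -> C).
Hypotheses (r0 : 0 < r) (M0 : 0 <= M) (hc : taylor_coefs f z0 r M c).

Lemma taylor_order k : (forall j, (j < k)%N -> c j = 0) ->
  exists2 B : R, 0 <= B & forall w, cn (w - z0) < r / 4 ->
    cn (f w - c k * (w - z0) ^+ k) <= B * cn (w - z0) ^+ k.+1.
Proof.
move=> ck; exists (2 * M * (2 / r) ^+ k.+1).
  by rewrite !mulr_ge0// exprn_ge0// divr_ge0// ltW.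
move=> w hw; have rp := r0; have := @hc (r / 2) k.+1 w ltac:(by apply/andP; split; lra) ltac:(by lra).
rewrite big_ord_recr /= big1 ?add0r; last by move=> i _; rewrite ck ?mul0r.
move=> h; apply: le_trans h _; set q := cn (w - z0) / (r / 2).
have q2 : q <= 1 / 2 by rewrite /q ler_pdivrMr; lra.
have q0 : 0 <= q by rewrite divr_ge0 ?cn_ge0//; lra.
have -> : 2 * M * (2 / r) ^+ k.+1 * cn (w - z0) ^+ k.+1 = 2 * (M * q ^+ k.+1).
  have -> : q = 2 / r * cn (w - z0) by rewrite /q; field; rewrite gt_eqF.
  by rewrite [(2 / r * _) ^+ _]exprMn !mulrA.
rewrite ler_pdivrMr; last by lra.
have : 0 <= M * q ^+ k.+1 by rewrite mulr_ge0 ?exprn_ge0.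
by move: (M * _) => t t0; nra.
Qed.

Lemma taylor_flat : (forall k, c k = 0) -> forall w, cn (w - z0) < r / 4 -> f w = 0.
Proof.
move=> c0 w hw; have rp := r0; apply: cn_le0; apply/ler_addgt0Pr => e e0; rewrite add0r.
pose q := cn (w - z0) / (r / 2).
have q2 : q <= 2^-1 by rewrite /q ler_pdivrMr; lra.
have q0 : 0 <= q by rewrite divr_ge0 ?cn_ge0//; lra.
have [n hn] := half_lt_eps (2 * M) e0.
have := @hc (r / 2) n w ltac:(by apply/andP; split; lra) ltac:(by lra).
rewrite big1 ?subr0; last by move=> i _; rewrite c0 mul0r.
move=> h; apply: le_trans h _; rewrite -/q ler_pdivrMr; last by lra.
have qn : M * q ^+ n <= M * 2^-1 ^+ n.
  by apply: ler_wpM2l => //; apply: lerXn2r; rewrite ?nnegrE.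
by move: hn qn; rewrite -mulrA; move: (M * 2^-1 ^+ n) (M * q ^+ n) => s t; nra.
Qed.

(** By [taylor_order] f differs from its k-th term by a multiple of |w - z0|^(k+1), so smallness of
    f at points accumulating at z0 suffices; this form also yields the identity theorem. *)
Lemma taylor_order_zero k (B : R) : (forall j, (j < k)%N -> c j = 0) ->
  (forall e : R, 0 < e -> exists w, [/\ w != z0, cn (w - z0) < e & cn (f w) <= B * cn (w - z0) ^+ k.+1]) ->
  c k = 0.
Proof.
move=> ck hf; have [B2 B20 hB] := taylor_order ck.
apply: cn_le0; apply/ler_addgt0Pr => e e0; rewrite add0r.
have N0 : 0 < `|B| + B2 + 1 by rewrite ltr_wpDl// addr_ge0.
have [w [wz w1 w2]] := hf (Num.min (r / 4) (e / (`|B| + B2 + 1))) ltac:(by rewrite lt_min !divr_gt0).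
move: w1; rewrite lt_min => /andP[w3]; rewrite ltr_pdivlMr// => w4.
have t0 : 0 < cn (w - z0) by rewrite cn_gt0 subr_eq0.
have := hB w w3; set t := cn (w - z0) in t0 w2 w4 *.
have -> : f w - c k * (w - z0) ^+ k = - (c k * (w - z0) ^+ k - f w) by ring.
rewrite cnN => h; have := @cn_ge R (c k * (w - z0) ^+ k) (f w).
rewrite cnM cnX -/t => h2.
have h3 : cn (c k) * t ^+ k <= (B + B2) * t ^+ k.+1 by rewrite mulrDl; lra.
move: h3; rewrite exprS mulrA ler_pM2r ?exprn_gt0// => h3.
apply: le_trans h3 _; apply: le_trans (ltW w4); rewrite mulrC ler_pM2l//.
by have := ler_norm B; lra.
Qed.

Lemma taylor_identity :
  (forall e : R, 0 < e -> exists w, [/\ w != z0, cn (w - z0) < e & f w = 0]) ->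
  forall w, cn (w - z0) < r / 4 -> f w = 0.
Proof.
move=> hf; apply: taylor_flat => k.
elim/ltn_ind: k => k IH; apply: (@taylor_order_zero k 0) => // e /hf[w [h1 h2 h3]].
by exists w; split => //; rewrite h3 cn0 mul0r.
Qed.

Lemma taylor_quot_cont k : (forall j, (j < k)%N -> c j = 0) ->
  {for z0, continuous (fun w => if w == z0 then c k else f w / (w - z0) ^+ k)}.
Proof.
move=> ck; have [B B0 hB] := taylor_order ck.
apply/ccontP => e e0; exists (Num.min (r / 4) (e / (B + 1))).
  by rewrite lt_min !divr_gt0 ?ltr_wpDl.
move=> w; rewrite lt_min => /andP[w1]; rewrite ltr_pdivlMr ?ltr_wpDl// => w2; rewrite eqxx.
have [_|wz] := eqVneq w z0; first by rewrite subrr cn0.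
have z1 : w - z0 != 0 by rewrite subr_eq0.
have t0 : 0 < cn (w - z0) by rewrite cn_gt0.
have -> : f w / (w - z0) ^+ k - c k = (f w - c k * (w - z0) ^+ k) / (w - z0) ^+ k.
  by rewrite mulrBl mulfK ?expf_neq0.
rewrite cnM cnV cnX ltr_pdivrMr ?exprn_gt0//.
apply: le_lt_trans (hB w w1) _; rewrite exprS mulrA ltr_pM2r ?exprn_gt0//.
by move: w2; lra.
Qed.

End TaylorOrder.

(** * A functional equation at a fixed point *)

Section JumpGerm.
Variable R : realType.
Local Notation C := (Cplx R).
Implicit Types (z w : C).

Lemma cder_quot_cont (f : C -> C) z0 d : cder f z0 d ->
  {for z0, continuous (fun w => if w == z0 then d else (f w - f z0) / (w - z0))}.
Proof.
move=> h; apply/ccontP => e e0; have [a a0 ha] := h (e / 2) ltac:(by rewrite divr_gt0).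
exists a => // w /ha; rewrite eqxx; have [_ _|wz] := eqVneq w z0; first by rewrite subrr cn0.
have z1 : w - z0 != 0 by rewrite subr_eq0.
have -> : (f w - f z0) / (w - z0) - d = (f w - f z0 - d * (w - z0)) / (w - z0).
  by rewrite [RHS]mulrBl mulfK.
rewrite cnM cnV => hh; apply: (@le_lt_trans _ _ (e / 2)); last by lra.
by rewrite ler_pdivrMr// cn_gt0.
Qed.

Lemma cder_continuous (f : C -> C) z0 d : cder f z0 d -> {for z0, continuous f}.
Proof. by move=> h; apply/ccontP; exact: cder_cont h. Qed.

Lemma ccontM (f g : C -> C) z : {for z, continuous f} -> {for z, continuous g} ->
  {for z, continuous (fun w => f w * g w)}.
Proof. by move=> hf hg; exact: (@continuousM C C f g z hf hg). Qed.

Lemma ccontD (f g : C -> C) z : {for z, continuous f} -> {for z, continuous g} ->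
  {for z, continuous (fun w => f w + g w)}.
Proof. by move=> hf hg; exact: (@continuousD C C C f g z hf hg). Qed.

Lemma ccont_cst (a z : C) : {for z, continuous (fun=> a)}.
Proof. by apply/ccontP => e e0; exists 1 => // w _; rewrite subrr cn0. Qed.

Lemma ccontX (f : C -> C) z n : {for z, continuous f} -> {for z, continuous (fun w => f w ^+ n)}.
Proof.
move=> hf.
have E0 : (fun w => f w ^+ 0) = (fun=> 1) by apply/funext.
have E1 j : (fun w => f w ^+ j.+1) = (fun w => f w * f w ^+ j).
  by apply/funext => w; rewrite exprS.
elim: n => [|j IH]; first by rewrite E0; exact: ccont_cst.
by rewrite E1; exact: (ccontM hf IH).
Qed.

Lemma continuous_eq_at (f g : C -> C) z0 (r : R) : 0 < r ->
  {for z0, continuous f} -> {for z0, continuous g} ->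
  (forall w, w != z0 -> cn (w - z0) < r -> f w = g w) -> f z0 = g z0.
Proof.
move=> r0 /ccontP hf /ccontP hg h; apply/eqP; rewrite -subr_eq0; apply/eqP/cn_le0.
apply/ler_addgt0Pr => e e0; rewrite add0r.
have [a a0 ha] := hf (e / 2) ltac:(by lra); have [b b0 hb] := hg (e / 2) ltac:(by lra).
pose t := Num.min r (Num.min a b) / 2.
have m0 : 0 < Num.min r (Num.min a b) by rewrite !lt_min r0 a0.
have t0 : 0 < t by rewrite divr_gt0.
have tm : t < Num.min r (Num.min a b) by rewrite /t; lra.
move: tm; rewrite !lt_min => /andP[tr /andP[ta tb]].
pose w := z0 + ofR t; have wE : w - z0 = ofR t by rewrite /w addrC addKr.
have cw : cn (w - z0) = t by rewrite wE cn_ofR gtr0_norm.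
have wz : w != z0 by rewrite -subr_eq0 -cn_gt0 cw.
have h1 := ha w ltac:(by rewrite cw); have h2 := hb w ltac:(by rewrite cw).
have hw := h w wz ltac:(by rewrite cw).
apply: le_trans (cnDB _ _ (f w)) _; rewrite cnC {2}hw; lra.
Qed.

(* Comparison of the coefficients of [(z - z0)^k] in [nu g = phi' (g o phi) + F]
   at the fixed point [z0] of [phi]. *)
Lemma germ_eq (g phi dphi F Fk : C -> C) z0 mu nu (r r1 M : R) c k :
  0 < r -> 0 <= M -> taylor_coefs g z0 r M c -> 0 < r1 ->
  cder phi z0 mu -> phi z0 = z0 -> mu != 0 ->
  {for z0, continuous dphi} -> dphi z0 = mu -> {for z0, continuous Fk} ->
  (forall w, cn (w - z0) < r1 -> nu * g w = dphi w * g (phi w) + F w) ->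
  (forall w, cn (w - z0) < r1 -> F w = Fk w * (w - z0) ^+ k) ->
  (forall j, (j < k)%N -> c j = 0) ->
  nu * c k = mu ^+ k.+1 * c k + Fk z0.
Proof.
move=> r0 M0 hc r10 hphi phi0 mu0 cd d0 cF hg hF ck.
pose G w := if w == z0 then c k else g w / (w - z0) ^+ k.
have cG : {for z0, continuous G} by exact: taylor_quot_cont r0 M0 hc _ ck.
pose q w := if w == z0 then mu else (phi w - phi z0) / (w - z0).
have cq : {for z0, continuous q} by exact: cder_quot_cont hphi.
(* As mu is not 0, phi is injective at z0 in this weak sense, and [G (phi w)] is a genuine
   quotient. *)
have [r2 r20 hr2] : exists2 r2 : R, 0 < r2 & forall w, w != z0 -> cn (w - z0) < r2 -> phi w != z0.
  have m2 : 0 < cn mu / 2 by rewrite divr_gt0// cn_gt0.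
  have [a a0 ha] := hphi _ m2; exists a => // w wz /ha; rewrite phi0 => h.
  apply/eqP => e; move: h; rewrite e subrr sub0r cnN cnM ler_pM2r ?cn_gt0 ?subr_eq0//.
  have : 0 < cn mu by rewrite cn_gt0.
  lra.
have cphi := cder_continuous hphi.
have cGphi : {for z0, continuous (G \o phi)}.
  have cG' : {for phi z0, continuous G} by rewrite phi0.
  exact: (continuous_comp cphi cG').
have cqk := @ccontX _ _ k cq.
have cl : {for z0, continuous (fun w => nu * G w)} by exact: (ccontM (@ccont_cst nu z0) cG).
have cr : {for z0, continuous (fun w => dphi w * (G (phi w) * q w ^+ k) + Fk w)}.
  exact: (ccontD (ccontM cd (ccontM cGphi cqk)) cF).
have m0 : 0 < Num.min r1 r2 by rewrite lt_min r10.
have key w : w != z0 -> cn (w - z0) < Num.min r1 r2 ->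
    nu * G w = dphi w * (G (phi w) * q w ^+ k) + Fk w.
  move=> wz; rewrite lt_min => /andP[w1 w2].
  have pz := hr2 w wz w2; rewrite /G /q (negbTE wz) (negbTE pz) phi0.
  have z1 : w - z0 != 0 by rewrite subr_eq0.
  have z2 : phi w - z0 != 0 by rewrite subr_eq0.
  rewrite expr_div_n mulrA hg// hF//; field.
  by rewrite !expf_neq0.
(* After division by (w - z0)^k both sides extend continuously to z0; phi' gives one factor mu and
   the quotient to the power k the remaining ones. *)
have := continuous_eq_at m0 cl cr key.
rewrite phi0 d0 /G /q eqxx => ->.
by rewrite exprS; ring.
Qed.

End JumpGerm.

(** * The action of tau on germs at the centre of the unit disc *)

Section DiscMap.
Variable R : realType.
Local Notation C := (Cplx R).
Variable lam : C.
Hypothesis lam1 : cn lam < 1.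
Implicit Types (z w : C) (G : C -> C).

Definition disc_holo G := forall z, cn z < 1 -> exists d, cder G z d.

Lemma tau_den z : cn z < 1 -> 1 - lam^* * z != 0.
Proof.
move=> z1; rewrite -cn_gt0; apply: lt_le_trans (@cn_ge R 1 (lam^* * z)).
by rewrite cn1 cnM cn_conj subr_gt0; have := lam1; have := cn_ge0 lam; have := cn_ge0 z; nra.
Qed.

Lemma blaschke_identity z :
  cn (1 - lam^* * z) ^+ 2 - cn (lam - z) ^+ 2 = (1 - cn lam ^+ 2) * (1 - cn z ^+ 2).
Proof. by rewrite !cn_sqr !reimE; ring. Qed.

(** tau is z times a Blaschke factor. By [blaschke_identity] and |1 - conj(lam) z| <= 2, the squared
    modulus of that factor is at most 1 - (1 - |lam|^2) (1 - rho^2) / 4. *)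
Lemma tau_contract (rho : R) : 0 <= rho < 1 -> exists2 kap : R, 0 <= kap < 1 &
  forall z, cn z <= rho -> cn (tau lam z) <= kap * cn z.
Proof.
move=> /andP[r0 r1]; pose t := (1 - cn lam ^+ 2) * (1 - rho ^+ 2) / 4.
have l2 : 0 <= cn lam ^+ 2 < 1 by rewrite sqr_ge0 expr_lt1 ?cn_ge0.
have rr : 0 <= rho ^+ 2 < 1 by rewrite sqr_ge0 expr_lt1.
have t01 : 0 < t <= 1.
  move: l2 rr; rewrite /t; move: (cn lam ^+ 2) (rho ^+ 2) => u v /andP[u0 u1] /andP[v0 v1].
  have h1 : 0 < (1 - u) * (1 - v) by rewrite mulr_gt0// subr_gt0.
  have h2 : (1 - u) * (1 - v) <= 1 * 1 by apply: ler_pM; lra.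
  by apply/andP; split; lra.
have s0 : 0 <= 1 - t by case/andP: t01 => *; lra.
exists (Num.sqrt (1 - t)).
  rewrite sqrtr_ge0 /= -(@ltr_pXn2r _ 2) ?nnegrE ?sqrtr_ge0// sqr_sqrtr// expr1n.
  by case/andP: t01 => *; lra.
move=> z hz; have z1 : cn z < 1 by apply: le_lt_trans r1.
have d0 := tau_den z1; have dp : 0 < cn (1 - lam^* * z) by rewrite cn_gt0.
rewrite /tau -mulrA cnM mulrC; apply: ler_wpM2r; first exact: cn_ge0.
rewrite cnM cnV ler_pdivrMr// -(@ler_pXn2r _ 2) ?nnegrE ?cn_ge0 ?mulr_ge0 ?sqrtr_ge0 ?cn_ge0//.
rewrite exprMn sqr_sqrtr//.
have h1 := blaschke_identity z.
have h2 : cn (1 - lam^* * z) <= 2.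
  apply: le_trans (cnB _ _) _; rewrite cn1 cnM cn_conj.
  by have := lam1; have := cn_ge0 lam; have := cn_ge0 z; nra.
have h3 : cn (1 - lam^* * z) ^+ 2 <= 4.
  have -> : 4 = 2 ^+ 2 :> R by rewrite expr2; ring.
  by apply: lerXn2r; rewrite ?nnegrE ?cn_ge0.
have h4 : cn z ^+ 2 <= rho ^+ 2 by apply: lerXn2r; rewrite ?nnegrE ?cn_ge0.
have h5 : t * 4 <= (1 - cn lam ^+ 2) * (1 - cn z ^+ 2).
  rewrite /t divfK//; apply: ler_wpM2l; first by case/andP: l2 => *; lra.
  by rewrite lerD2l lerN2.
have h6 : t * cn (1 - lam^* * z) ^+ 2 <= t * 4.
  by apply: ler_wpM2l => //; case/andP: t01 => /ltW.
move: h1 h5 h6; move: (cn (1 - _) ^+ 2) (cn (lam - z) ^+ 2) ((1 - _) * _) => A E F *; lra.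
Qed.

Lemma tau_le z : cn z < 1 -> cn (tau lam z) <= cn z.
Proof.
move=> z1; have [kap /andP[k0 k1] h] := @tau_contract (cn z) ltac:(by rewrite cn_ge0 z1).
by apply: le_trans (h z (lexx _)) _; rewrite ler_piMl ?cn_ge0// ltW.
Qed.

Lemma tau_disc z : cn z < 1 -> cn (tau lam z) < 1.
Proof. by move=> z1; apply: le_lt_trans (tau_le z1) z1. Qed.

Lemma tau_holo : disc_holo (tau lam).
Proof.
move=> z z1; have h1 := cderM (cder_id z) (cderB (cder_cst lam z) (cder_id z)).
have h2 := cderB (cder_cst 1 z) (cderZ (lam^*) (cder_id z)).
have h3 := cderV (f := fun w => 1 - lam^* * w) (tau_den z1) h2.
have h := cderM h1 h3.
by eexists; exact: h.
Qed.

Lemma disc_holo_tau G : disc_holo G -> disc_holo (fun z => G (tau lam z)).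
Proof.
move=> hG z z1; have [d hd] := tau_holo z1; have [e he] := hG _ (tau_disc z1).
by eexists; exact: (cder_comp hd he).
Qed.

(** G = O(z^k), with a bound on every smaller disc, because the period functional evaluates G on a
    circle that is not near 0. *)
Definition vanish_at0 (k : nat) G := disc_holo G /\ forall rho : R, 0 <= rho < 1 ->
  exists2 B : R, 0 <= B & forall z, cn z <= rho -> cn (G z) <= B * cn z ^+ k.

Lemma vanish_le j k G : (j <= k)%N -> vanish_at0 k G -> vanish_at0 j G.
Proof.
move=> jk [hG hb]; split => // rho hr; have [B B0 hB] := hb rho hr.
exists B => // z hz; apply: le_trans (hB z hz) _; apply: ler_wpM2l => //.
case/andP: hr => _ r1; apply: ler_wiXn2l => //; first exact: cn_ge0.
by apply: ltW; apply: le_lt_trans r1.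
Qed.

Lemma vanish_tau k G : vanish_at0 k G -> vanish_at0 k (fun z => G (tau lam z)).
Proof.
move=> [hG hb]; split; first exact: disc_holo_tau.
move=> rho hr; have [B B0 hB] := hb rho hr; exists B => // z hz.
case/andP: hr => _ r1; have z1 : cn z < 1 by apply: le_lt_trans r1.
have h := tau_le z1; apply: le_trans (hB _ (le_trans h hz)) _.
by apply: ler_wpM2l => //; apply: lerXn2r; rewrite ?nnegrE ?cn_ge0.
Qed.

Lemma vanish_pow k : vanish_at0 k (fun z => z ^+ k).
Proof.
split; first by move=> z _; eexists; exact: (cderX k (cder_id z)).
by move=> rho _; exists 1 => // z _; rewrite cnX mul1r.
Qed.

Lemma vanish_lin k G1 G2 (a : C) : vanish_at0 k G1 -> vanish_at0 k G2 ->
  vanish_at0 k (fun z => G1 z + a * G2 z).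
Proof.
move=> [h1 b1] [h2 b2]; split.
  move=> z z1; have [d hd] := h1 z z1; have [e he] := h2 z z1.
  by eexists; exact: (cderD hd (cderZ a he)).
move=> rho hr; have [B1 B10 hB1] := b1 rho hr; have [B2 B20 hB2] := b2 rho hr.
exists (B1 + cn a * B2); first by rewrite addr_ge0 ?mulr_ge0 ?cn_ge0.
move=> z hz; apply: le_trans (cnD _ _) _; rewrite mulrDl; apply: lerD; first exact: hB1.
by rewrite cnM -mulrA; apply: ler_wpM2l; [exact: cn_ge0|exact: hB2].
Qed.

(* Only a bound near 0 is needed: away from 0, [|z| ^ k] is at most [8 |z| ^ k.+1]. *)
Lemma vanish_near0 k G (B : R) : vanish_at0 k G -> 0 <= B ->
  (forall z, cn z < 8^-1 -> cn (G z) <= B * cn z ^+ k.+1) -> vanish_at0 k.+1 G.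
Proof.
move=> [hG hb] B0 hB; split => // rho hr; have [B1 B10 hB1] := hb rho hr.
exists (B + 8 * B1); first by rewrite addr_ge0 ?mulr_ge0.
move=> z hz; have [z8|z8] := ltP (cn z) 8^-1.
  apply: le_trans (hB z z8) _; apply: ler_wpM2r; first by rewrite exprn_ge0 ?cn_ge0.
  by rewrite lerDl mulr_ge0.
apply: le_trans (hB1 z hz) _.
have h : cn z ^+ k <= 8 * cn z ^+ k.+1.
  rewrite exprS mulrA ler_peMl ?exprn_ge0 ?cn_ge0//; lra.
apply: (@le_trans _ _ (B1 * (8 * cn z ^+ k.+1))); first exact: ler_wpM2l.
have x0 : 0 <= cn z ^+ k.+1 by rewrite exprn_ge0 ?cn_ge0.
by move: (cn z ^+ k.+1) x0 => X X0; nra.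
Qed.

Lemma vanish_split k G : vanish_at0 k G ->
  exists a : C, vanish_at0 k.+1 (fun z => G z + a * z ^+ k).
Proof.
move=> vG; have [hG hb] := vG.
have [B B0 hB] := hb 2^-1 ltac:(by apply/andP; split; lra).
have h2 : (0 : R) < 2^-1 by rewrite invr_gt0.
have hM z : cball (0 : C) 2^-1 z -> cn (G z) <= B.
  rewrite /cball /= subr0 => hz; apply: le_trans (hB z (ltW hz)) _.
  rewrite ler_piMr// exprn_ile1 ?cn_ge0//; lra.
have hD z : cball (0 : C) 2^-1 z -> exists d, cder G z d.
  by rewrite /cball /= subr0 => hz; apply: hG; lra.
have [c _ hc] := taylor h2 hD hM.
have c0 j : (j < k)%N -> c j = 0.
  elim/ltn_ind: j => j IH jk; apply: (@taylor_order_zero R G 0 2^-1 B c h2 B0 hc j B).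
    by move=> i ij; apply: IH => //; apply: ltn_trans jk.
  move=> e e0; pose t := Num.min (e / 2) 2^-1.
  have t0 : 0 < t by rewrite lt_min invr_gt0 ltr0n divr_gt0.
  have te : t <= e / 2 by rewrite ge_min lexx.
  have t2 : t <= 2^-1 by rewrite ge_min lexx orbT.
  have ct : cn (ofR t) = t by rewrite cn_ofR gtr0_norm.
  exists (ofR t); rewrite subr0 ct; split.
  - by rewrite -cn_eq0 ct gt_eqF.
  - lra.
  - apply: le_trans (hB (ofR t) _) _; rewrite ct//.
    apply: ler_wpM2l => //; apply: ler_wiXn2l; rewrite ?ltW//; lra.
have [B2 B20 hB2] := taylor_order h2 B0 hc c0.
exists (- c k); apply: (vanish_near0 (B := B2)) => //.
  exact: vanish_lin vG (vanish_pow k).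
move=> z hz; have := hB2 z; rewrite subr0 mulNr; apply; lra.
Qed.

(** tau fixes 0 with multiplier lam. The second-order error of tau is multiplied by at most k when
    passing to k-th powers, by telescoping the difference of powers. *)
Lemma tau_pow_split k : vanish_at0 k.+1 (fun z => tau lam z ^+ k + (- lam ^+ k) * z ^+ k).
Proof.
have vk : vanish_at0 k (fun z => tau lam z ^+ k + (- lam ^+ k) * z ^+ k).
  exact: vanish_lin (vanish_tau (vanish_pow k)) (vanish_pow k).
pose q := (1 - cn lam)^-1; have q0 : 0 < q by rewrite invr_gt0 subr_gt0.
apply: (vanish_near0 (B := k%:R * q)) => //; first by rewrite mulr_ge0// ltW.
move=> z hz; have z1 : cn z < 1 by lra.
have den : 1 - cn lam <= cn (1 - lam^* * z).
  apply: le_trans (@cn_ge R 1 (lam^* * z)); rewrite cn1 cnM cn_conj lerD2l lerN2.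
  by rewrite ler_piMr ?cn_ge0// ltW.
have h1 : cn (tau lam z - lam * z) <= q * cn z ^+ 2.
  have d0 := tau_den z1.
  have -> : tau lam z - lam * z = (lam * lam^* - 1) * z ^+ 2 / (1 - lam^* * z).
    by rewrite /tau; field.
  rewrite cnM cnM cnV cnX mulrC mulrCA mulrA.
  apply: ler_wpM2r; first by rewrite sqr_ge0.
  have : cn (lam * lam^* - 1) <= 1.
    rewrite mulcconj -ofR1 -ofRB cn_ofR ler0_norm; last first.
      by rewrite subr_le0 expr_le1 ?cn_ge0// ltW.
    by rewrite opprB lerBlDr lerDl sqr_ge0.
  move=> h; rewrite -[leRHS]mul1r; apply: ler_pM => //; rewrite ?invr_ge0 ?cn_ge0//.
  rewrite /q lef_pV2 ?posrE ?subr_gt0//.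
  by apply: lt_le_trans den; rewrite subr_gt0.
rewrite mulNr; elim: k {vk} => [|k IH].
  by rewrite !expr0 mul1r subrr cn0 mul0r mul0r.
have -> : tau lam z ^+ k.+1 - lam ^+ k.+1 * z ^+ k.+1 =
  tau lam z * (tau lam z ^+ k - lam ^+ k * z ^+ k) + (lam ^+ k * z ^+ k) * (tau lam z - lam * z).
  by rewrite !exprS; ring.
apply: le_trans (cnD _ _) _.
rewrite (cnM (tau lam z)) (cnM (lam ^+ k * z ^+ k)) (cnM (lam ^+ k)) !cnX.
have a1 : cn (tau lam z) * cn (tau lam z ^+ k - lam ^+ k * z ^+ k) <= cn z * (k%:R * q * cn z ^+ k.+1).
  by apply: ler_pM; rewrite ?cn_ge0// tau_le.
have a2 : cn lam ^+ k * cn z ^+ k * cn (tau lam z - lam * z) <= cn z ^+ k * (q * cn z ^+ 2).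
  apply: ler_pM; rewrite ?mulr_ge0 ?exprn_ge0 ?cn_ge0//.
  by rewrite ler_piMl ?exprn_ge0 ?cn_ge0// exprn_ile1 ?cn_ge0// ltW.
apply: le_trans (lerD a1 a2) _; rewrite -natr1 !exprS.
by rewrite le_eqVlt; apply/orP; left; apply/eqP; ring.
Qed.

Lemma tau_iter_bound (rho : R) : 0 <= rho < 1 -> exists2 kap : R, 0 <= kap < 1 &
  forall N z, cn z <= rho -> cn (iter N (tau lam) z) <= kap ^+ N * cn z.
Proof.
move=> hr; have [kap /andP[k0 k1] hk] := tau_contract hr; exists kap; first by rewrite k0.
move=> N z hz; elim: N => [|N IH]; first by rewrite mul1r.
rewrite iterS; have h : cn (iter N (tau lam) z) <= rho.
  apply: le_trans IH _; apply: le_trans hz; rewrite ler_piMl ?cn_ge0// exprn_ile1// ltW//.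
apply: le_trans (hk _ h) _; rewrite exprS -mulrA; exact: ler_wpM2l.
Qed.

End DiscMap.

(** * Period integrals against functions on the disc, for one abstract half of the domain *)

Section PeriodFunctional.
Variable R : realType.
Local Notation C := (Cplx R).
Implicit Types (z w : C) (G h f : C -> C).

Variables (U : set C) (ph dph : 'I_2 -> C -> C) (PP : C -> C) (lam v0 : C) (rho0 : R).
Hypotheses (cU : cconvex U) (oU : open U).
Hypothesis hph : forall k z, U z -> cder (ph k) z (dph k z).
Hypothesis phU : forall k z, U z -> U (ph k z).
Hypothesis sh0 : forall z, U z -> ph ord0 (z + 2) = ph ord_max z.
Hypothesis sh1 : forall z, U z -> ph ord_max (z + 2) = ph ord0 z + 2.
Hypothesis hPP : forall z, U z -> exists d, cder PP z d.
Hypothesis PPper : forall z, PP (z + 2) = PP z.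
Hypothesis PP1 : forall z, U z -> cn (PP z) < 1.
Hypothesis tauP : forall k z, U z -> tau lam (PP (ph k z)) = PP z.
Hypothesis lam1 : cn lam < 1.
Hypotheses (Uv : U v0) (Uv2 : U (v0 + 2)).
Hypothesis rho01 : 0 <= rho0 < 1.
Hypothesis line : forall t : R, 0 <= t <= 1 -> cn (PP (v0 + ofR t * 2)) <= rho0.

Definition holo_on h := forall z, U z -> exists d, cder h z d.
Definition periodic_on h := forall z, U z -> U (z + 2) -> h (z + 2) = h z.
Definition is_prim Q h G := forall z, U z -> cder Q z (h z * G (PP z)).

(* The integral of [h (G o PP)] over one period. *)
Definition lf h G : C := xget 0 [set l | exists2 Q, is_prim Q h G & l = Q (v0 + 2) - Q v0].

Lemma prim_exists h G : holo_on h -> disc_holo G -> exists Q, is_prim Q h G.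
Proof.
move=> hh hG; apply: convex_primitive => // z Uz.
have [d hd] := hh z Uz; have [e he] := hPP Uz; have [g hg] := hG _ (PP1 Uz).
by eexists; exact: (cderM hd (cder_comp he hg)).
Qed.

Lemma lf_eq h G Q : is_prim Q h G -> lf h G = Q (v0 + 2) - Q v0.
Proof.
move=> hQ; rewrite /lf; case: xgetP => [l -> [Q' hQ' ->]|/(_ (Q (v0 + 2) - Q v0))[]].
  exact: (prim_diff cU hQ' hQ Uv Uv2).
by exists Q.
Qed.

Lemma lf_prim h G : holo_on h -> disc_holo G ->
  exists2 Q, is_prim Q h G & lf h G = Q (v0 + 2) - Q v0.
Proof.
by move=> hh hG; have [Q hQ] := prim_exists hh hG; exists Q => //; exact: lf_eq.
Qed.

Lemma lf_lin h G1 G2 (a : C) : holo_on h -> disc_holo G1 -> disc_holo G2 ->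
  lf h (fun z => G1 z + a * G2 z) = lf h G1 + a * lf h G2.
Proof.
move=> hh h1 h2; have [Q1 p1 ->] := lf_prim hh h1; have [Q2 p2 ->] := lf_prim hh h2.
rewrite (@lf_eq _ _ (fun z => Q1 z + a * Q2 z)); first by ring.
by move=> z Uz; apply: cder_eq (cderD (p1 z Uz) (cderZ a (p2 z Uz))) _; ring.
Qed.

Lemma lf_bound h G (B S : R) : holo_on h -> disc_holo G ->
  (forall z, U z -> cn (h z) <= B) -> (forall z, cn z <= rho0 -> cn (G z) <= S) ->
  cn (lf h G) <= 2 * (B * S).
Proof.
move=> hh hG hB hS; have [Q hQ ->] := lf_prim hh hG.
have Ut (t : R) : 0 <= t <= 1 -> U (v0 + ofR t * 2).
  by move=> ht; have := cU Uv Uv2 ht; congr U; ring.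
have := @rder_mvi R (fun t => Q (v0 + ofR t * 2))
  (fun t => h (v0 + ofR t * 2) * G (PP (v0 + ofR t * 2)) * 2) (2 * (B * S)).
rewrite ofR1 ofR0 mul1r mul0r addr0; apply.
- by move=> t ht; apply: rder_cder; apply: hQ; exact: Ut.
- move=> t ht; rewrite !cnM -{3}(ofRn R 2) cn_ofR ger0_norm// mulrC ler_pM2l//.
  by apply: ler_pM; rewrite ?cn_ge0 ?hB ?hS//; [exact: Ut|exact: line].
Qed.

Section Equation.
Variables (h f : C -> C) (nu : C) (B : R).
Hypotheses (hh : holo_on h) (hf : holo_on f) (hper : periodic_on h).
Hypothesis hB : forall z, U z -> cn (h z) <= B.
Hypothesis eqn : forall z, U z ->
  nu * h z - (dph ord0 z * h (ph ord0 z) + dph ord_max z * h (ph ord_max z)) = f z.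
Hypothesis nu0 : nu != 0.

Lemma lf_tau G : disc_holo G -> nu * lf h G = lf h (fun z => G (tau lam z)) + lf f G.
Proof.
move=> hG; have hGt := disc_holo_tau lam1 hG.
have [Q1 p1 e1] := lf_prim hh hGt; have [Q2 p2 ->] := lf_prim hf hG.
have [Q3 p3 ->] := lf_prim hh hG.
pose Q z := Q1 (ph ord0 z) + Q1 (ph ord_max z) + Q2 z.
have hQ z : U z -> cder Q z (nu * (h z * G (PP z))).
  move=> Uz.
  have c k := cder_comp (hph k Uz) (p1 _ (phU k Uz)).
  apply: cder_eq (cderD (cderD (c ord0) (c ord_max)) (p2 z Uz)) _.
  by rewrite !tauP// -eqn//; ring.
have h3 z : U z -> cder (fun w => nu * Q3 w) z (nu * (h z * G (PP z))).
  by move=> Uz; exact: cderZ (p3 z Uz).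
have E := prim_diff cU h3 hQ Uv Uv2.
rewrite mulrBr E /Q sh0// sh1//.
have U1 := phU ord0 Uv.
have U2 : U (ph ord0 v0 + 2) by rewrite -sh1//; exact: phU.
have hp z : U z -> U (z + 2) -> h (z + 2) * G (tau lam (PP (z + 2))) = h z * G (tau lam (PP z)).
  by move=> Uz Uz2; rewrite hper// PPper.
rewrite e1 -(@period_const R U _ Q1 2 (ph ord0 v0) v0 cU p1 hp U1 U2 Uv Uv2); ring.
Qed.

(** On a class stable under composition with tau on which the functional of f vanishes, the
    inhomogeneous term never appears during the iteration. *)
Lemma lf_tau_iter (Z : (C -> C) -> Prop) G N : (forall G, Z G -> disc_holo G) ->
  (forall G, Z G -> Z (fun z => G (tau lam z))) -> (forall G, Z G -> lf f G = 0) -> Z G ->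
  nu ^+ N * lf h G = lf h (fun z => G (iter N (tau lam) z)).
Proof.
move=> Zd Zt Zf; elim: N G => [|N IH] G ZG; first by rewrite mul1r.
rewrite exprSr -mulrA (lf_tau (Zd _ ZG)) (Zf _ ZG) addr0 IH; last exact: Zt.
congr lf; apply/funext => z; rewrite -iterS//.
Qed.

(** For G of order K, the iterates G o tau^N decay like (kap^K)^N while the equation only divides by
    nu^N; so K is chosen with kap^K < |nu|. *)
Lemma lf_high (M : nat) : (forall G, vanish_at0 M G -> lf f G = 0) ->
  exists K, forall G, vanish_at0 K G -> lf h G = 0.
Proof.
move=> hM; have [kap /andP[k0 k1] hk] := tau_iter_bound lam1 rho01.
have n0 : 0 < cn nu by rewrite cn_gt0.
have [n hn] : exists n, kap ^+ n < cn nu.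
  have c : (fun n => kap ^+ n) @ \oo --> (0 : R) by apply: cvg_expr; rewrite ger0_norm.
  move/cvgrPdist_lt : c => /(_ _ n0)[n _ h']; exists n.
  by have := h' n (leqnn n); rewrite /= sub0r normrN ger0_norm// exprn_ge0.
exists (maxn n.+1 M) => G vG; set K := maxn n.+1 M in vG *.
have kK : kap ^+ K < cn nu.
  by apply: le_lt_trans hn; apply: ler_wiXn2l; rewrite ?(ltW k1)// ltnW// leq_maxl.
have [hG hb] := vG; have [S S0 hS] := hb rho0 rho01.
have B0 : 0 <= B by apply: le_trans (hB Uv); exact: cn_ge0.
apply: cn_le0; apply/ler_addgt0Pr => e e0; rewrite add0r.
pose q := kap ^+ K / cn nu.
have q0 : 0 <= q by rewrite divr_ge0 ?exprn_ge0// ltW.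
have q1 : `|q| < 1 by rewrite ger0_norm// ltr_pdivrMr// mul1r.
have cq : (fun N => q ^+ N) @ \oo --> (0 : R) by apply: cvg_expr.
have T0 : 0 < 2 * (B * S) + 1 by rewrite ltr_wpDl// !mulr_ge0.
move/cvgrPdist_lt : cq => /(_ (e / (2 * (B * S) + 1))).
rewrite divr_gt0// => /(_ erefl)[N _ hN].
have := hN N (leqnn N); rewrite /= sub0r normrN ger0_norm ?exprn_ge0// => qN.
have E := @lf_tau_iter (vanish_at0 K) G N (fun G v => v.1)
  (fun G v => vanish_tau lam1 v) (fun G v => hM G (vanish_le (leq_maxr _ _) v)) vG.
have dG : disc_holo (fun z => G (iter N (tau lam) z)).
  elim: N {hN qN E} G hG {vG hb hS} => [|N IH] G hG //.
  exact: (IH (fun y => G (tau lam y)) (disc_holo_tau lam1 hG)).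
have bd : cn (lf h (fun z => G (iter N (tau lam) z))) <= 2 * (B * (S * (kap ^+ K) ^+ N)).
  apply: lf_bound => // z hz; case/andP: rho01 => r0 r1.
  have h1 := hk N z hz.
  have kN1 : kap ^+ N <= 1 by apply: exprn_ile1 => //; exact: ltW.
  have h2 : cn (iter N (tau lam) z) <= rho0.
    by apply: le_trans h1 _; apply: le_trans hz; rewrite ler_piMl ?cn_ge0.
  apply: le_trans (hS _ h2) _; apply: ler_wpM2l => //.
  rewrite exprAC; apply: lerXn2r; rewrite ?nnegrE ?cn_ge0 ?exprn_ge0//.
  apply: le_trans h1 _; rewrite ler_piMr ?exprn_ge0//.
  by apply: le_trans hz _; exact: ltW.
move: bd; rewrite -E cnM cnX => bd.
have nN : 0 < cn nu ^+ N by rewrite exprn_gt0.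
have h3 : cn (lf h G) <= 2 * (B * S) * q ^+ N.
  rewrite -(ler_pM2l nN); apply: le_trans bd _.
  rewrite /q expr_div_n; rewrite le_eqVlt; apply/orP; left; apply/eqP.
  by move: nN; move: (cn nu ^+ N) ((kap ^+ K) ^+ N) => x y x0; field; rewrite gt_eqF.
apply: le_trans h3 _; move: qN; rewrite ltr_pdivlMr// => qN.
have := exprn_ge0 N q0; move: qN T0; move: (2 * (B * S)) (q ^+ N) => x y; nra.
Qed.

(** Modulo order k + 1, z^k is an eigenvector of composition with tau for lam^k. Hence (nu - lam^k)
    times the functional at z^k is 0, and [vanish_split] reduces any G of order k to z^k. *)
Lemma lf_descend (k : nat) : nu != lam ^+ k ->
  (forall G, vanish_at0 k G -> lf f G = 0) ->
  (forall G, vanish_at0 k.+1 G -> lf h G = 0) ->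
  forall G, vanish_at0 k G -> lf h G = 0.
Proof.
move=> nk hfk hk.
have pd : disc_holo (fun z => z ^+ k) by have [] := @vanish_pow R k.
have p0 : lf h (fun z => z ^+ k) = 0.
  have h1 := lf_tau pd; rewrite (hfk _ (vanish_pow R k)) addr0 in h1.
  have h2 := hk _ (tau_pow_split lam1 k).
  rewrite (lf_lin (- lam ^+ k) hh (disc_holo_tau lam1 pd) pd) in h2.
  move: h2; rewrite -h1 mulNr -mulrBl => /eqP; rewrite mulf_eq0 subr_eq0 (negbTE nk) /=.
  by move/eqP.
move=> G vG; have [b hb] := vanish_split vG.
by have := hk _ hb; rewrite lf_lin// ?p0 ?mulr0 ?addr0//; case: vG.
Qed.

Lemma lf_vanish (M : nat) : (forall G, vanish_at0 M G -> lf f G = 0) ->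
  (forall k, (M <= k)%N -> nu != lam ^+ k) ->
  forall G, vanish_at0 M G -> lf h G = 0.
Proof.
move=> hM hk; have [K hK] := lf_high hM.
have [KM|MK] := leqP K M; first by move=> G vG; apply: hK; exact: vanish_le vG.
have key j : (j <= K - M)%N -> forall G, vanish_at0 (K - j) G -> lf h G = 0.
  elim: j => [|j IH] jK; first by rewrite subn0.
  have e : (K - j = (K - j.+1).+1)%N by rewrite subnSK//; apply: leq_trans jK _; exact: leq_subr.
  have Mj : (M <= K - j.+1)%N by rewrite -{1}(subKn (ltnW MK)) leq_sub2l.
  apply: (@lf_descend (K - j.+1)).
  - exact: hk.
  - by move=> G vG; apply: hM; exact: vanish_le vG.
  - by rewrite -e; apply: IH; exact: ltnW.
have := key (K - M)%N (leqnn _); rewrite subKn//; exact: ltnW.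
Qed.

(** Higher powers of lam have smaller modulus, hence differ from nu, and the functional of h
    vanishes to order n + 1. At z^n both sides of [lf_tau] then contain lam^n times the same number,
    and only the term of f remains. *)
Lemma lf_obstruction (n : nat) : (0 < n)%N -> nu = lam ^+ n ->
  (forall G, vanish_at0 n.+1 G -> lf f G = 0) -> lf f (fun z => z ^+ n) = 0.
Proof.
move=> n1 nE hn.
have l0 : 0 < cn lam.
  by rewrite cn_gt0; apply: contraNneq nu0 => l0; rewrite nE l0 expr0n gtn_eqF.
have hk k : (n.+1 <= k)%N -> nu != lam ^+ k.
  move=> nk; apply/eqP => e; have := congr1 (@cn R) e; rewrite nE !cnX => e2.
  have e3 : cn lam ^+ k < cn lam ^+ n by rewrite ltr_iXn2l.
  by move: e3; rewrite -e2 ltxx.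
have hv := lf_vanish hn hk.
have pd : disc_holo (fun z => z ^+ n) by have [] := @vanish_pow R n.
have h1 := lf_tau pd.
have h2 := hv _ (tau_pow_split lam1 n).
rewrite (lf_lin (- lam ^+ n) hh (disc_holo_tau lam1 pd) pd) in h2.
apply: (addrI (lf h (fun z => tau lam z ^+ n))); rewrite -h1 addr0 nE.
by move/eqP: h2; rewrite mulNr subr_eq0 => /eqP <-.
Qed.

End Equation.
End PeriodFunctional.

(** * The jump at the fixed point and the powers of its multiplier *)

Section JumpSpectrum.
Variable R : realType.
Local Notation C := (Cplx R).
Implicit Types (z w nu : C) (x y : R).

Variables (lam : C) (eps kap K : R) (ph : 'I_2 -> C -> C) (D : set C) (rho M : R).
Variable L : {linear Hinf D -> Hinf D}.
Hypothesis lam1 : cn lam < 1.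
Let c0 : C := (1 - lam) / (1 - lam^*).
Let mu : R := (1 - cn lam ^+ 2) / (2 * (1 - re lam)).
Hypothesis cb : complex_branches lam c0 eps kap K mu ph.
Hypothesis td : transfer_domain eps ph D rho M.
Hypothesis hL : is_transfer_operator ph L.

Local Notation d0 := (derive1 (ph ord0)).
Local Notation d1 := (derive1 (ph ord_max)).

Lemma mu01 : 0 < mu < 1.
Proof.
have l1 := lam1; have l0 := cn_ge0 lam.
have h := re_le_cn lam; rewrite ler_norml in h; case/andP: h => h1 h2.
have hs : re lam ^+ 2 <= cn lam ^+ 2 by rewrite cn_sqr lerDl sqr_ge0.
have a0 : 0 < 2 * (1 - re lam) by lra.
have r2 : cn lam ^+ 2 < 1 by rewrite expr_lt1.
rewrite /mu divr_gt0 ?subr_gt0//= ltr_pdivrMr// mul1r.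
have : 0 < (1 - re lam) ^+ 2 by rewrite exprn_gt0// subr_gt0; lra.
by move: hs; move: (cn lam ^+ 2) => u; rewrite !expr2; nra.
Qed.

Lemma transferE (f : Hinf D) z : D z ->
  L f z = d0 z * f (ph ord0 z) + d1 z * f (ph ord_max z).
Proof. by move=> Dz; rewrite hL// sum_ord2. Qed.

Lemma small_pow (c X e : R) : 0 <= c < 1 -> 0 < e -> exists N, c ^+ N * X < e.
Proof.
move=> /andP[c0' c1] e0; have X0 : 0 < `|X| + 1 by rewrite ltr_wpDl.
have h : (fun n => c ^+ n) @ \oo --> (0 : R) by apply: cvg_expr; rewrite ger0_norm.
move/cvgrPdist_lt : h => /(_ (e / (`|X| + 1))); rewrite divr_gt0// => /(_ erefl)[N _ hN].
exists N; have := hN N (leqnn N); rewrite /= sub0r normrN ger0_norm ?exprn_ge0//.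
rewrite ltr_pdivlMr// => h; apply: le_lt_trans h; apply: ler_wpM2l; first exact: exprn_ge0.
by apply: le_trans (ler_norm _) _; rewrite lerDl.
Qed.

Lemma derive1_shift0 z : D z -> D (z + 2) -> d0 (z + 2) = d1 z.
Proof.
move=> Dz Dz2; have h := cder_shift (branch_derive1 cb td ord0 Dz2).
apply/esym/cder_derive1; apply: cder_near h.
have [e e0 he] := (copenP D).1 (td_open td) z Dz; exists e => // w /he Dw.
by rewrite (cb_shift0 cb)//; exact: (td_strip td Dw).
Qed.

Lemma derive1_shift1 z : D z -> D (z + 2) -> d1 (z + 2) = d0 z.
Proof.
move=> Dz Dz2; have h := cder_shift (branch_derive1 cb td ord_max Dz2).
have h2 : cder (ph ord0) z (d1 (z + 2)).
  have := cderB h (cder_cst 2 z); rewrite subr0; apply: cder_near.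
  have [e e0 he] := (copenP D).1 (td_open td) z Dz; exists e => // w /he Dw.
  by rewrite (cb_shift1 cb) ?addrK//; exact: (td_strip td Dw).
exact/esym/cder_derive1.
Qed.

Lemma branch_shift_in z : D z -> D (z + 2) -> D (ph ord0 z + 2).
Proof.
by move=> Dz Dz2; rewrite -(cb_shift1 cb (td_strip td Dz)); exact: (branch_maps td).
Qed.

(** Translation by 2 turns [ph ord0] into [ph ord_max], and [ph ord_max] into [ph ord0] plus 2. In
    the difference the terms at [ph ord_max z] cancel and only a jump of h at [ph ord0 z] is
    left. *)
Lemma jump_eq (h f : Hinf D) nu : (forall z, D z -> nu * h z - L h z = f z) ->
  forall z, D z -> D (z + 2) ->
  nu * (h (z + 2) - h z) = d0 z * (h (ph ord0 z + 2) - h (ph ord0 z)) + (f (z + 2) - f z).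
Proof.
move=> e z Dz Dz2; rewrite -(e _ Dz) -(e _ Dz2) (transferE h Dz) (transferE h Dz2).
rewrite (derive1_shift0 Dz Dz2) (derive1_shift1 Dz Dz2).
rewrite (cb_shift0 cb (td_strip td Dz)) (cb_shift1 cb (td_strip td Dz)).
move: (h (z + 2)) (h z) (d0 z) (d1 z) (h (ph ord0 z + 2)) (h (ph ord0 z)) (h (ph ord_max z)).
by move=> a b p q u v w; ring.
Qed.

Lemma near_left w : cball (- 1) rho w -> D w /\ D (w + 2).
Proof.
have mE : (- 1 : C) = ofR (- 1) by rewrite !ofRE.
move=> hw; split.
  by apply: (td_real_ball td (x := - 1)); rewrite ?normrN ?normr1 -?mE//; lra.
have h1 : `|1 : R| <= 3 by rewrite normr1; lra.
apply: (td_real_ball td h1); move: hw; rewrite /cball /= !ofRE.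
by have -> : w + 2 - 1 = w - - 1 by ring.
Qed.

Lemma jump_taylor (h : Hinf D) : exists2 c : nat -> C,
  taylor_coefs (fun w => h (w + 2) - h w) (- 1) rho (2 * vn h) c & c 0%N = h 1 - h (- 1).
Proof.
have hD w : cball (- 1) rho w -> exists d, cder (fun w => h (w + 2) - h w) w d.
  move=> /near_left[Dw Dw2]; have [d hd] := Hinf_cder h Dw; have [e he] := Hinf_cder h Dw2.
  by eexists; exact: (cderB (cder_shift he) hd).
have hB w : cball (- 1) rho w -> cn (h (w + 2) - h w) <= 2 * vn h.
  move=> /near_left[Dw Dw2]; apply: le_trans (cnB _ _) _.
  by rewrite mulr_natl mulr2n; apply: lerD; exact: Hinf_norm_ubR.
have [c c0E hc] := taylor (td_rho td) hD hB; exists c => //.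
by rewrite c0E; congr (h _ - _); ring.
Qed.

Lemma jump_coefs (h f : Hinf D) nu c k (Fk : C -> C) :
  (forall z, D z -> nu * h z - L h z = f z) ->
  taylor_coefs (fun w => h (w + 2) - h w) (- 1) rho (2 * vn h) c ->
  {for (- 1), continuous Fk} ->
  (forall w, D w -> D (w + 2) -> f (w + 2) - f w = Fk w * (w + 1) ^+ k) ->
  (forall j, (j < k)%N -> c j = 0) ->
  nu * c k = ofR mu ^+ k.+1 * c k + Fk (- 1).
Proof.
move=> e hc cF hF ck; have r0 := td_rho td.
have m0 : ofR mu != 0.
  by rewrite -cn_eq0 cn_ofR normr_eq0; case/andP: mu01 => /gt_eqF ->.
have M0 : 0 <= 2 * vn h by rewrite mulr_ge0// vn_ge0.
have [Dm _] : D (- 1) /\ D (- 1 + 2) by apply: near_left; rewrite /cball /= subrr cn0.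
have cd : {for (- 1), continuous d0}.
  by have [d hd] := cb_der2 cb ord0 (td_strip td Dm); exact: cder_continuous hd.
have dm : d0 (- 1) = ofR mu by exact: cder_derive1 (cb_mu cb).
apply: (@germ_eq R (fun w => h (w + 2) - h w) (ph ord0) d0 (fun w => f (w + 2) - f w) Fk (- 1) (ofR mu)
   nu rho rho (2 * vn h) c k r0 M0 hc r0 (cb_mu cb) (cb_left cb) m0 cd dm cF) => //.
- by move=> w hw; have [Dw Dw2] := near_left hw; exact: jump_eq e _ Dw Dw2.
- by move=> w hw; have [Dw Dw2] := near_left hw; rewrite hF// opprK.
Qed.

Lemma jump_zero (h f : Hinf D) nu : (forall z, D z -> nu * h z - L h z = f z) ->
  (forall z, D z -> D (z + 2) -> f (z + 2) = f z) -> nu != 0 ->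
  (forall n, (0 < n)%N -> nu != ofR mu ^+ n) ->
  forall z, D z -> D (z + 2) -> h (z + 2) = h z.
Proof.
move=> e fper nu0 nun; have [c hc _] := jump_taylor h; have r0 := td_rho td.
have M0 : 0 <= 2 * vn h by rewrite mulr_ge0// vn_ge0.
have c00 k : c k = 0.
  elim/ltn_ind: k => k IH.
  have := @jump_coefs h f nu c k (fun=> 0) e hc (@ccont_cst R 0 (- 1)).
  have F0 w : D w -> D (w + 2) -> f (w + 2) - f w = 0 * (w + 1) ^+ k.
    by move=> Dw Dw2; rewrite fper// subrr mul0r.
  move=> /(_ F0 IH)/eqP; rewrite addr0 -subr_eq0 -mulrBl mulf_eq0 subr_eq0.
  by rewrite (negbTE (nun _ _))//= => /eqP.
have near w : cn (w - - 1) < rho / 4 -> h (w + 2) - h w = 0.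
  by move=> hw; exact: (taylor_flat r0 M0 hc c00 hw).
pose ct := (1 + kap) / 2.
have ct01 : 0 <= ct < 1 by have /andP[k0 k1] := cb_kap cb; rewrite /ct; apply/andP; split; lra.
(* The first branch contracts towards -1, so the jump equation carries vanishing near -1 back to
   every z for which z and z + 2 lie in D. *)
have dyn N z : D z -> D (z + 2) -> ct ^+ N * cn (z - - 1) < rho / 4 -> h (z + 2) - h z = 0.
  elim: N z => [|N IH] z Dz Dz2; first by rewrite mul1r; exact: near.
  move=> hz; have := jump_eq e Dz Dz2; rewrite fper// subrr addr0 (IH (ph ord0 z)).
  - by rewrite mulr0 => /eqP; rewrite mulf_eq0 (negbTE nu0) => /eqP.
  - exact: (branch_maps td).
  - exact: branch_shift_in.
  have [Dm _] : D (- 1) /\ D (- 1 + 2) by apply: near_left; rewrite /cball /= subrr cn0.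
  have := branch_contract cb ord0 (td_strip td Dm) (td_strip td Dz); rewrite (cb_left cb) -/ct => hh.
  apply: le_lt_trans hz; rewrite exprSr -mulrA; apply: ler_wpM2l => //.
  by apply: exprn_ge0; case/andP: ct01.
move=> z Dz Dz2; apply/eqP; rewrite -subr_eq0; apply/eqP.
have [N hN] := @small_pow ct (cn (z - - 1)) (rho / 4) ct01 ltac:(by rewrite divr_gt0).
exact: (dyn N).
Qed.

Lemma circle_bound z : D z -> cn (c0 * ce z) <= expR (pi * eps).
Proof.
move=> Dz; rewrite cnM (cn_c0 lam1) mul1r cn_ce ler_expR mulNr -mulrN.
apply: ler_wpM2l; first exact: pi_ge0.
have := td_strip td Dz; rewrite ltr_norml => /andP[h1 h2]; lra.
Qed.

Lemma circle_boundV z : D z -> cn (c0 * ce z)^-1 <= expR (pi * eps).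
Proof.
move=> Dz; rewrite cnV cnM (cn_c0 lam1) mul1r cn_ce -expRN ler_expR mulNr opprK.
apply: ler_wpM2l; first exact: pi_ge0.
have := td_strip td Dz; rewrite ltr_norml => /andP[h1 h2]; lra.
Qed.

Lemma circle_der z : cder (fun z => c0 * ce z) z (c0 * (ci * ofR pi * ce z)).
Proof. exact: cderZ (cder_ce z). Qed.

Lemma resolvent_solution nu : resolvent_set L nu -> forall f : Hinf D,
  exists h : Hinf D, forall z, D z -> nu * h z - L h z = f z.
Proof.
move=> [S [_ _ hS]] f; exists (S f) => z Dz; have e := hS f.
by rewrite -[in RHS]e.
Qed.

Lemma mu_pow_spectrum n : (0 < n)%N -> spectrum L (ofR mu ^+ n).
Proof.
case: n => // n _ /resolvent_solution hres.
have oD := td_open td; have /andP[mu0 mu1] := mu01.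
pose P z : C := c0 * ce z.
(* The continuous quotient of P - P(-1) by w + 1; its value at -1 is P'(-1), which is not 0. *)
pose kp w : C := if w == - 1 then c0 * (ci * ofR pi * ce (- 1)) else (P w - P (- 1)) / (w - - 1).
have kpE w : P w - P (- 1) = kp w * (w + 1).
  rewrite /kp; have [->|wm] := eqVneq w (- 1); first by rewrite subrr addNr mulr0.
  by rewrite opprK divfK// -[1]opprK subr_eq0.
have ckp : {for (- 1), continuous kp} by exact: cder_quot_cont (circle_der (- 1)).
(* P has period 2, so only the factor z jumps, by 2, and the jump of f vanishes at -1 to the exact
   order n. *)
have [f hf] : exists f : Hinf D, forall z, D z -> f z = z * (P z - P (- 1)) ^+ n.
  pose T := expR (pi * eps) + cn (P (- 1)).
  apply: (@Hinf_exists R D _ (M * T ^+ n)) => //.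
    move=> z Dz; eexists; apply: cderM (cder_id z) _.
    exact: cderX n (cderB (circle_der z) (cder_cst _ _)).
  move=> z Dz; rewrite cnM cnX; have hM := td_bounded td Dz.
  apply: ler_pM; rewrite ?cn_ge0 ?exprn_ge0 ?cn_ge0//.
  apply: lerXn2r; rewrite ?nnegrE ?cn_ge0 ?addr_ge0 ?expR_ge0 ?cn_ge0//.
  by apply: le_trans (cnB _ _) _; rewrite lerD2r; exact: circle_bound.
have [h hh] := hres f; have [c hc _] := jump_taylor h.
have Fk k : (k <= n)%N -> forall w, D w -> D (w + 2) ->
    f (w + 2) - f w = (2 * kp w ^+ n * (w + 1) ^+ (n - k)) * (w + 1) ^+ k.
  move=> kn w Dw Dw2; rewrite !hf// /P ce_period -/(P w) -/(P (- 1)) kpE exprMn.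
  by rewrite -mulrA -exprD subnK//; ring.
have cw : {for (- 1), continuous (fun w : C => w + 1)}.
  by have h1 := cderD (cder_id (- 1 : C)) (cder_cst 1 _); exact: cder_continuous h1.
have cFk k : {for (- 1), continuous (fun w => 2 * kp w ^+ n * (w + 1) ^+ (n - k))}.
  exact: (ccontM (ccontM (@ccont_cst R 2 (- 1)) (@ccontX R _ _ n ckp)) (@ccontX R _ _ (n - k) cw)).
have ck k : (k < n)%N -> c k = 0.
  elim/ltn_ind: k => k IH kn.
  have := jump_coefs hh hc (@cFk k) (Fk k (ltnW kn)) (fun j jk => IH j jk (ltn_trans jk kn)).
  (* Below order n the jump of f contributes nothing, and mu^(n+1) differs from mu^(k+1). *)
  rewrite addNr [0 ^+ _]expr0n subn_eq0 leqNgt kn /= mulr0 addr0 => /eqP.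
  rewrite -subr_eq0 -mulrBl mulf_eq0 => /orP[|/eqP//].
  rewrite -!ofRX subr_eq0 => /eqP/(@ofR_inj R) e; exfalso.
  have e2 : mu ^+ n.+1 < mu ^+ k.+1 by rewrite ltr_iXn2l.
  by move: e2; rewrite e ltxx.
(* At order n the two terms with [c n] cancel, as the spectral parameter is mu^(n+1); this leaves 2
   P'(-1)^n = 0, which is absurd. *)
have := jump_coefs hh hc (@cFk n) (Fk n (leqnn n)) ck.
rewrite subnn expr0 mulr1 => /eqP; rewrite eq_sym -subr_eq0 addrAC subrr add0r.
rewrite mulf_eq0 expf_eq0; have -> : (2 : C) == 0 = false by apply/negbTE.
rewrite /= /kp eqxx => /andP[_]; apply/negP.
have pi0 : ofR (pi : R) != 0 by rewrite -cn_eq0 cn_ofR normr_eq0 gt_eqF// pi_gt0.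
exact: mulf_neq0 (c0_neq0 lam1) (mulf_neq0 (mulf_neq0 (ci_neq0 R) pi0) (ce_neq0 (- 1))).
Qed.

End JumpSpectrum.

(** * The two half domains, the powers of lambda, and the vanishing of other eigenvectors *)

Section CircleSpectrum.
Variable R : realType.
Local Notation C := (Cplx R).
Implicit Types (z w nu : C) (x y : R) (b : bool).

Variables (lam : C) (eps kap K : R) (ph : 'I_2 -> C -> C) (D : set C) (rho M : R).
Variable L : {linear Hinf D -> Hinf D}.
Hypothesis lam1 : cn lam < 1.
Let c0 : C := (1 - lam) / (1 - lam^*).
Let mu : R := (1 - cn lam ^+ 2) / (2 * (1 - re lam)).
Hypothesis cb : complex_branches lam c0 eps kap K mu ph.
Hypothesis td : transfer_domain eps ph D rho M.
Hypothesis hL : is_transfer_operator ph L.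

(** The boolean is [true] for the upper and [false] for the lower half, so that both are instances
    of the abstract period functional. *)
Let s b : C := if b then - ci else ci.
Let sg b : R := if b then 1 else - 1.
Let U b : set C := D `&` hplane (s b) 0.
(* On the lower half plane the circle map is replaced by its inverse, which
   conjugates [tau lam] to [tau lam^*]. *)
Let PP b z : C := if b then c0 * ce z else (c0 * ce z)^-1.
Let lam_ b : C := if b then lam else lam^*.
(** Within [rho] of -1, so that this point and its translate lie in the balls around -1 and 1
    contained in D; [rho0] is the modulus of [PP] at this height. *)
Let v0 b : C := cpx (- 1) (sg b * (rho / 2)).
Let rho0 : R := expR (- pi * (rho / 2)).

Let hplE b z : re (s b * (z - 0)) = sg b * im z.
Proof. by rewrite /s /sg subr0; case: b; rewrite !reimE; ring. Qed.

Let UE b z : U b z <-> D z /\ 0 < sg b * im z.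
Proof. by rewrite /U /setI /hplane /= hplE. Qed.

Let cU b : cconvex (U b).
Proof. by apply: cconvexI; [exact: (td_convex td)|exact: hplane_convex]. Qed.

Let oU b : open (U b).
Proof. by apply: openI; [exact: (td_open td)|exact: hplane_open]. Qed.

Let UD b z : U b z -> D z. Proof. by case. Qed.

Let hph b k z : U b z -> cder (ph k) z (derive1 (ph k) z).
Proof. by move=> /UD; exact: (branch_derive1 cb td k). Qed.

(** Comparison with the real point below z shows that the imaginary part of the image is half that
    of z up to a relative error [kap] < 1, hence of the same sign. *)
Let phU b k z : U b z -> U b (ph k z).
Proof.
move=> /UE[Dz hz]; apply/UE; split; first exact: (branch_maps td).
have sz := td_strip td Dz.
have sr : strip eps (ofR (re z)) := strip_real cb (re z).
have h := branch_half cb k sr sz.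
have /andP[k0 k1] := cb_kap cb.
have e : z - ofR (re z) = ci * ofR (im z) by apply: cplx_ext; rewrite !reimE; ring.
have := le_trans (im_le_cn _) h; rewrite e cnM cn_ci mul1r cn_ofR.
have -> : im (ph k z - ph k (ofR (re z)) - ci * ofR (im z) / 2) = im (ph k z) - im z / 2.
  rewrite 2!imB (cb_real cb k (im_ofR _)) subr0; congr (_ - _).
  have -> : ci * ofR (im z) / 2 = ci * ofR (im z / 2) by rewrite !ofRE; ring.
  by rewrite imM im_ofR re_ofR im_ci re_ci; ring.
rewrite ler_norml => /andP[]; move: hz; rewrite /sg; move: (im z) (im (ph k z)) => a c.
by case: b; [rewrite !mul1r|rewrite !mulN1r !oppr_gt0] => ha;
  [rewrite (ger0_norm (ltW ha))|rewrite (ler0_norm (ltW ha))] => h1 h2; nra.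
Qed.

Let sh0 b z : U b z -> ph ord0 (z + 2) = ph ord_max z.
Proof. by move=> /UD Dz; exact: (cb_shift0 cb (td_strip td Dz)). Qed.

Let sh1 b z : U b z -> ph ord_max (z + 2) = ph ord0 z + 2.
Proof. by move=> /UD Dz; exact: (cb_shift1 cb (td_strip td Dz)). Qed.

Let P0 z : c0 * ce z != 0.
Proof. exact: mulf_neq0 (c0_neq0 lam1) (ce_neq0 z). Qed.

Let PPn b z : PP b z != 0.
Proof. by rewrite /PP; case: b; rewrite ?invr_eq0. Qed.

Let derPP b z : exists d, cder (PP b) z d.
Proof.
by rewrite /PP; case: b; eexists; [|apply: cderV => //]; exact: (cderZ c0 (cder_ce z)).
Qed.

Let PPper b z : PP b (z + 2) = PP b z.
Proof. by rewrite /PP ce_period. Qed.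

Let cnPP b z : cn (PP b z) = expR (- pi * (sg b * im z)).
Proof.
rewrite /PP /sg; case: b; rewrite ?cnV cnM (cn_c0 lam1) mul1r cn_ce ?mul1r//.
by rewrite -expRN mulN1r mulrN.
Qed.

Let PP1 b z : 0 < sg b * im z -> cn (PP b z) < 1.
Proof. by move=> h; rewrite cnPP -expR0 ltr_expR mulNr oppr_lt0 mulr_gt0// pi_gt0. Qed.

Let PP1U b z : U b z -> cn (PP b z) < 1.
Proof. by move=> /UE[_]; exact: PP1. Qed.

Let lam_1 b : cn (lam_ b) < 1.
Proof. by rewrite /lam_; case: b; rewrite ?cn_conj. Qed.

Let tauP b k z : U b z -> tau (lam_ b) (PP b (ph k z)) = PP b z.
Proof.
move=> /UD Dz; have sz := td_strip td Dz; rewrite /PP /lam_; case: b; first exact: (tau_branch lam1 cb k sz).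
apply: tau_root; first by rewrite cn_conj.
(* Dividing the quadratic equation for Z by P Z^2 gives the equation of the same form for the
   inverses, with lam conjugated. *)
have E : forall Z Z' P : C, Z != 0 -> P != 0 -> Z + Z' = lam + lam^* * P -> Z * Z' = P ->
    Z^-1 ^+ 2 + P^-1 = (lam^* + lam * P^-1) * Z^-1.
  move=> Z Z' P Z0 Pn h1 h2.
  have h3 : Z ^+ 2 + P = (lam + lam^* * P) * Z by rewrite -h1 -h2; ring.
  have -> : (lam^* + lam * P^-1) * Z^-1 = (lam + lam^* * P) * Z / (P * Z ^+ 2) by field; exact/andP.
  by rewrite -h3; field; exact/andP.
rewrite [lam^*^*]conjcK.
have [->|->] := ord2P k; apply: (E _ _ _ (P0 _) (P0 _)).
- exact: (cb_sum cb sz).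
- exact: (cb_prod cb sz).
- by rewrite addrC; exact: (cb_sum cb sz).
- by rewrite mulrC; exact: (cb_prod cb sz).
Qed.

Let sg2 b : sg b * sg b = 1.
Proof. by rewrite /sg; case: b; ring. Qed.

Let v0D b : D (v0 b) /\ D (v0 b + 2).
Proof.
have r0 := td_rho td; apply: (near_left td); rewrite /cball /=.
have -> : v0 b - - 1 = ci * ofR (sg b * (rho / 2)) by apply: cplx_ext; rewrite !reimE; ring.
rewrite cnM cn_ci mul1r cn_ofR normrM.
have -> : `|sg b| = 1 by rewrite /sg; case: b; rewrite ?normrN normr1.
by rewrite mul1r ger0_norm; lra.
Qed.

Let Uv b : U b (v0 b).
Proof.
have r0 := td_rho td; have [h _] := v0D b.
by apply/UE; split => //; rewrite im_cpx mulrA sg2 mul1r divr_gt0.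
Qed.

Let Uv2 b : U b (v0 b + 2).
Proof.
have r0 := td_rho td; have [_ h] := v0D b.
by apply/UE; split => //; rewrite im2 im_cpx mulrA sg2 mul1r divr_gt0.
Qed.

Let rho01 : 0 <= rho0 < 1.
Proof.
rewrite expR_ge0 /rho0 -[X in _ < X]expR0 ltr_expR mulNr oppr_lt0.
by rewrite !mulr_gt0 ?pi_gt0 ?(td_rho td)// invr_gt0.
Qed.

Let line b (t : R) : 0 <= t <= 1 -> cn (PP b (v0 b + ofR t * 2)) <= rho0.
Proof.
move=> _; rewrite cnPP; have -> : im (v0 b + ofR t * 2) = sg b * (rho / 2).
  by rewrite imD im_cpx -(ofRn R 2) -ofRM im_ofR addr0.
by rewrite mulrA sg2 mul1r.
Qed.

Let lfb b h G := lf (U b) (PP b) (v0 b) h G.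

Lemma PP_small b (e : R) z : 0 < e -> e^-1 < sg b * im z -> cn (PP b z) <= e.
Proof.
move=> e0 h; rewrite cnPP mulNr expRN -[e]invrK.
have e1 : 0 < e^-1 by rewrite invr_gt0.
rewrite lef_pV2 ?posrE ?expR_gt0//; apply: le_trans (expR_ge1Dx _).
have p1 : 1 <= (pi : R) by have := pi_ge2 R; lra.
have : sg b * im z <= pi * (sg b * im z) by rewrite ler_peMl// ltW// (lt_trans e1).
by move: h; lra.
Qed.

Let PP_pow_holo b n : exists f : Hinf D, forall z, D z -> f z = (PP b z) ^- n.
Proof.
apply: (@Hinf_exists R D _ (expR (pi * eps) ^+ n)).
- move=> z Dz; have [d hd] := derPP b z; eexists.
  exact: (@cderV R (fun w => PP b w ^+ n) z _ (expf_neq0 n (PPn b z)) (cderX n hd)).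
- exact: (td_open td).
- move=> z Dz; rewrite -exprVn cnX; apply: lerXn2r; rewrite ?nnegrE ?cn_ge0 ?expR_ge0//.
  by rewrite /PP; case: b; rewrite ?invrK; [exact: (circle_boundV lam1 td Dz)|exact: (circle_bound lam1 td Dz)].
Qed.

(** The integrand is defined on the whole half plane, not merely on D, and is O([PP]) far away from
    the real line, so its integral over a period is 0. *)
Let lf_pow_vanish b n f G : (forall z, D z -> f z = (PP b z) ^- n) ->
  vanish_at0 n.+1 G -> lfb b f G = 0.
Proof.
move=> hf [hG hb]; pose H z := (PP b z) ^- n * G (PP b z).
have Hup z : hplane (s b) 0 z -> 0 < sg b * im z by rewrite -hplE.
have [Q hQ] : exists Q, forall z, hplane (s b) 0 z -> cder Q z (H z).
  apply: convex_primitive; [exact: hplane_convex| |exact: hplane_open].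
  move=> z /Hup hz; have [d hd] := derPP b z; have [g hg] := hG _ (PP1 hz).
  by eexists; exact: (cderM (@cderV R (fun w => PP b w ^+ n) z _ (expf_neq0 n (PPn b z)) (cderX n hd)) (cder_comp hd hg)).
have h2 : 0 <= (2^-1 : R) < 1 by apply/andP; split; lra.
have [B B0 hB] := hb _ h2.
have lim0 (e : R) : 0 < e -> exists Y : R, forall z, hplane (s b) 0 z ->
    Y < re (s b * (z - 0)) -> cn (H z - 0) <= e.
  move=> e0; pose e1 := Num.min 2^-1 (e / (B + 1)).
  have e1p : 0 < e1 by rewrite lt_min invr_gt0 ltr0n/= divr_gt0// ltr_wpDl.
  exists e1^-1 => z _; rewrite hplE => /(PP_small e1p) hz; rewrite subr0 /H cnM.
  have hz2 : cn (PP b z) <= 2^-1 by apply: le_trans hz _; rewrite ge_min lexx.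
  have hz3 : cn (PP b z) <= e / (B + 1) by apply: le_trans hz _; rewrite ge_min lexx orbT.
  have p0 : 0 < cn (PP b z) by rewrite cn_gt0.
  rewrite cnV cnX mulrC ler_pdivrMr ?exprn_gt0//.
  apply: le_trans (hB _ hz2) _; rewrite exprS mulrA; apply: ler_wpM2r; first exact/exprn_ge0/ltW.
  apply: le_trans (_ : (B + 1) * cn (PP b z) <= _); first by apply: ler_wpM2r; [exact: ltW|rewrite lerDl].
  by rewrite mulrC -ler_pdivlMr ?ltr_wpDl.
have sc : s b = ci \/ s b = - ci by rewrite /s; clear; case: b; [right|left].
have hper z : hplane (s b) 0 z -> H (z + 2) = H z by rewrite /H PPper.
have hv : hplane (s b) 0 (v0 b) by have [] := Uv b.
have E := period_limit sc hQ hper lim0 hv.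
rewrite /lfb (@lf_eq R (U b) (PP b) (v0 b) (@cU b) (Uv b) (Uv2 b) f G Q) ?E ?mulr0//.
by move=> z Uz; rewrite (hf _ (UD Uz)); apply: hQ; case: Uz.
Qed.

Let lf_pow b n f : (forall z, D z -> f z = (PP b z) ^- n) ->
  lfb b f (fun z => z ^+ n) = 2.
Proof.
move=> hf; rewrite /lfb (@lf_eq R (U b) (PP b) (v0 b) (@cU b) (Uv b) (Uv2 b) f _ id).
  by rewrite addrAC subrr add0r.
move=> z Uz; rewrite (hf _ (UD Uz)) mulVf; first exact: cder_id.
by rewrite expf_neq0.
Qed.

Let h_holo b (h : Hinf D) : holo_on (U b) h.
Proof. by move=> z /UD; exact: Hinf_cder. Qed.

Let h_bnd b (h : Hinf D) z : U b z -> cn (h z) <= vn h.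
Proof. by move=> /UD; exact: Hinf_norm_ubR. Qed.

Let nu_eqn b (h : Hinf D) f nu : (forall z, D z -> nu * h z - L h z = f z) -> forall z, U b z ->
  nu * h z - (derive1 (ph ord0) z * h (ph ord0 z) + derive1 (ph ord_max) z * h (ph ord_max z)) = f z.
Proof. by move=> e z /UD Dz; rewrite -e// (transferE hL h Dz). Qed.

Lemma lam_pow_spectrum b n : (0 < n)%N -> lam_ b ^+ n != 0 -> spectrum L (lam_ b ^+ n).
Proof.
(* When the power is also one of mu, [jump_zero] cannot make the solution periodic, but the value is
   already known to be spectral. *)
move=> n0 nz; have [[m /andP[/= m0 /eqP e]]|hm] := pselect (exists m, (0 < m)%N && (lam_ b ^+ n == ofR mu ^+ m)).
  by rewrite e; exact: (mu_pow_spectrum lam1 cb td hL m0).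
move=> /resolvent_solution hres.
have [f hf] := PP_pow_holo b n; have [h hh] := hres f.
have nmu m : (0 < m)%N -> lam_ b ^+ n != ofR mu ^+ m.
  by move=> m0; apply/negP => e; apply: hm; exists m; rewrite m0.
have fper z : D z -> D (z + 2) -> f (z + 2) = f z by move=> Dz Dz2; rewrite !hf// PPper.
have hper := jump_zero lam1 cb td hL hh fper nz nmu.
have hperU : periodic_on (U b) h by move=> z /UD Dz /UD Dz2; exact: hper.
have := @lf_obstruction R (U b) ph (fun k => derive1 (ph k)) (PP b) (lam_ b) (v0 b) rho0
  (@cU b) (@oU b) (@hph b) (@phU b) (@sh0 b) (@sh1 b) (fun z _ => derPP b z) (@PPper b) (@PP1U b)
  (@tauP b) (lam_1 b) (Uv b) (Uv2 b) rho01 (@line b) h f (lam_ b ^+ n) (vn h)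
  (@h_holo b h) (@h_holo b f) hperU (@h_bnd b h) (nu_eqn hh) nz n n0 erefl.
move=> /(_ (fun G => lf_pow_vanish hf)); rewrite -/(lfb b _ _) (lf_pow hf) => /eqP.
by apply/negP.
Qed.

Section Eigenvector.
Variables (h : Hinf D) (nu : C).
Hypothesis eqh : forall z, D z -> L h z = nu * h z.
Hypotheses (nu0 : nu != 0) (nul : forall b n, nu != lam_ b ^+ n).
Hypothesis num : forall n, (0 < n)%N -> nu != ofR mu ^+ n.

Let eq0 z : D z -> nu * h z - L h z = (0 : Hinf D) z.
Proof. by move=> Dz; rewrite eqh// subrr. Qed.

Lemma eigenvector_periodic z : D z -> D (z + 2) -> h (z + 2) = h z.
Proof. exact: (jump_zero lam1 cb td hL eq0 (fun _ _ _ => erefl) nu0 num). Qed.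

Let hperU b : periodic_on (U b) h.
Proof. by move=> z /UD Dz /UD Dz2; exact: eigenvector_periodic. Qed.

Let lf0 b G : lfb b (0 : Hinf D) G = 0.
Proof.
rewrite /lfb (@lf_eq R (U b) (PP b) (v0 b) (@cU b) (Uv b) (Uv2 b) _ _ (fun=> 0)) ?subrr//.
by move=> z _; rewrite mul0r; exact: cder_cst.
Qed.

(** These are the forms that the Cauchy kernel takes in terms of [PP]. The second summand has order
    1, where [lf_vanish] applies; constants are invariant under composition with tau, so nu
    different from 1 = lam^0 disposes of c. *)
Let lf_kernel b (c d a : C) : cn a <= 1 ->
  lfb b h (fun w => c + d * (w / (1 - a * w))) = 0.
Proof.
move=> a1.
have den w : cn w < 1 -> 1 - a * w != 0.
  move=> w1; rewrite subr_eq0; apply/eqP => e; have := cn1 R; rewrite e cnM => e2.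
  by have := ler_wpM2r (cn_ge0 w) a1; rewrite e2 mul1r leNgt w1.
have hE : disc_holo (fun w => w / (1 - a * w)).
  move=> w w1; eexists.
  exact: cderM (cder_id w) (@cderV R (fun w => 1 - a * w) w _ (den w w1) (cderB (cder_cst 1 w) (cderZ a (cder_id w)))).
have vE : vanish_at0 1 (fun w => w / (1 - a * w)).
  split=> // r /andP[r0 r1]; exists (1 - r)^-1; first by rewrite invr_ge0 subr_ge0 ltW.
  move=> w wr; rewrite cnM cnV expr1 mulrC; apply: ler_wpM2r; first exact: cn_ge0.
  have hl : 1 - r <= cn (1 - a * w).
    have := cn_ge 1 (a * w); rewrite cn1 cnM => h1.
    by have := ler_wpM2r (cn_ge0 w) a1; rewrite mul1r => h2; lra.
  have p : 0 < 1 - r by rewrite subr_gt0.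
  by rewrite lef_pV2 ?posrE// (lt_le_trans p hl).
have hc : disc_holo (fun=> c) by move=> w _; exists 0; exact: cder_cst.
rewrite /lfb (lf_lin (@cU b) (@oU b) (fun z _ => derPP b z) (@PP1U b) (Uv b) (Uv2 b) d (@h_holo b h) hc hE).
have := @lf_vanish R (U b) ph (fun k => derive1 (ph k)) (PP b) (lam_ b) (v0 b) rho0
  (@cU b) (@oU b) (@hph b) (@phU b) (@sh0 b) (@sh1 b) (fun z _ => derPP b z) (@PPper b) (@PP1U b)
  (@tauP b) (lam_1 b) (Uv b) (Uv2 b) rho01 (@line b) h (0 : Hinf D) nu (vn h)
  (@h_holo b h) (@h_holo b 0) (@hperU b) (@h_bnd b h) (nu_eqn eq0) nu0 1.
move=> /(_ (fun G _ => lf0 b G) (fun k _ => nul b k) _ vE) ->.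
have := @lf_tau R (U b) ph (fun k => derive1 (ph k)) (PP b) (lam_ b) (v0 b)
  (@cU b) (@oU b) (@hph b) (@phU b) (@sh0 b) (@sh1 b) (fun z _ => derPP b z) (@PPper b) (@PP1U b)
  (@tauP b) (lam_1 b) (Uv b) (Uv2 b) h (0 : Hinf D) nu
  (@h_holo b h) (@h_holo b 0) (@hperU b) (nu_eqn eq0) _ hc.
rewrite -/(lfb b (0 : Hinf D) _) lf0 addr0 mulr0 addr0 => /eqP.
rewrite -subr_eq0 -{2}[lf _ _ _ _ _]mul1r -mulrBl mulf_eq0 subr_eq0.
by rewrite -[1](expr0 (lam_ b)) (negbTE (nul b 0)) => /eqP.
Qed.

Lemma eigenvector_zero_real x : x \in `[-1, 1] -> h (ofR x) = 0.
Proof.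
rewrite in_itv /= => /andP[x1 x2].
have Dx : D (ofR x) by apply: (td_real td); rewrite ler_norml; apply/andP; split; lra.
have Dx2 : D (ofR x + 2).
  have -> : ofR x + 2 = ofR (x + 2) by rewrite !ofRE.
  by apply: (td_real td); rewrite ler_norml; apply/andP; split; lra.
pose p0 := c0 * ce (ofR x).
have cp : cn p0 = 1 by exact: (cn_circle lam1 x).
have p00 : p0 != 0 := P0 _.
have kE z : ckern (ofR x) z = (1 - p0 / (c0 * ce z))^-1.
  rewrite /ckern ceB /p0; congr (_ - _)^-1.
  by rewrite invfM mulrACA divff ?mul1r// (c0_neq0 lam1).
(* The kernel as a function of [PP]: its pole has modulus 1, since x is real, and so stays outside
   the open disc. The lower half differs by the constant term 1. *)
have ku z : U true z -> h z * ckern (ofR x) z =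
    h z * (0 + (- p0^-1) * (PP true z / (1 - p0^-1 * PP true z))).
  move=> Uz; congr (_ * _); rewrite kE add0r /PP; have := PP1U Uz; rewrite /PP /=.
  have := P0 z; move: (c0 * ce z) => q q0 q1; have qp : q - p0 != 0.
    by rewrite subr_eq0; apply/eqP => e; move: q1; rewrite e cp ltxx.
  have qp' : p0 - q != 0 by rewrite subr_eq0 eq_sym -subr_eq0.
  by field; rewrite ?qp ?qp' ?p00 ?q0.
have kl z : U false z -> h z * ckern (ofR x) z =
    h z * (1 + p0 * (PP false z / (1 - p0 * PP false z))).
  move=> Uz; congr (_ * _); rewrite kE /PP; have := PP1U Uz; rewrite /PP /=.
  have := P0 z; move: (c0 * ce z) => q q0 q1; have qp : q - p0 != 0.
    by rewrite subr_eq0; apply/eqP => e; move: q1; rewrite e cnV cp invr1 ltxx.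
  by field; rewrite ?qp ?p00 ?q0.
have a1 : cn p0^-1 <= 1 by rewrite cnV cp invr1.
have a2 : cn p0 <= 1 by rewrite cp.
have Ut z : (D `&` hplane (- ci) (ofR x)) z <-> U true z.
  rewrite UE /sg mul1r; split => -[Dz hz]; first by split => //; move/upE: hz.
  by split => //; apply/upE.
have Uf z : (D `&` hplane ci (ofR x)) z <-> U false z.
  rewrite UE /sg mulN1r oppr_gt0; split => -[Dz hz]; first by split => //; move/loE: hz.
  by split => //; apply/loE.
have hol b c d a : cn a <= 1 -> disc_holo (fun w => c + d * (w / (1 - a * w))).
  move=> ha w w1; have den : 1 - a * w != 0.
    rewrite subr_eq0; apply/eqP => e; have := cn1 R; rewrite e cnM => e2.
    by have := ler_wpM2r (cn_ge0 w) ha; rewrite e2 mul1r leNgt w1.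
  eexists; apply: cderD (cder_cst c w) (cderZ d (cderM (cder_id w) _)).
  exact: (@cderV R (fun w => 1 - a * w) w _ den (cderB (cder_cst 1 w) (cderZ a (cder_id w)))).
have prim b c d a : cn a <= 1 -> (forall z, U b z ->
      h z * ckern (ofR x) z = h z * (c + d * (PP b z / (1 - a * PP b z)))) ->
    exists2 Q, (forall z, U b z -> cder Q z (h z * ckern (ofR x) z)) &
      Q (v0 b + 2) - Q (v0 b) = 0.
  move=> ha e; have [Q hQ eQ] := lf_prim (@cU b) (@oU b) (fun z _ => derPP b z) (@PP1U b)
    (Uv b) (Uv2 b) (@h_holo b h) (hol b c d a ha).
  exists Q; last by rewrite -eQ; exact: lf_kernel.
  by move=> z Uz; rewrite e//; exact: hQ.
have [Qp hQp ep] := prim true _ _ _ a1 ku; have [Qm hQm em] := prim false _ _ _ a2 kl.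
have := @strip_cauchy R D h (ofR x) Qp Qm (v0 true) (v0 false) (td_convex td) (td_open td)
  (fun z Dz => Hinf_cder h Dz) eigenvector_periodic Dx Dx2
  (fun z hz => hQp z ((Ut z).1 hz)) (fun z hz => hQm z ((Uf z).1 hz))
  ((Ut _).2 (Uv true)) ((Ut _).2 (Uv2 true)) ((Uf _).2 (Uv false)) ((Uf _).2 (Uv2 false)).
rewrite ep em subrr => /esym/eqP; rewrite mulf_eq0 => /orP[|/eqP//].
by rewrite pnatr_eq0.
Qed.

(** The identity theorem spreads the zeros on the interval to balls of a fixed radius around its
    points. Under the branches every point of D approaches the interval, and the eigenvalue equation
    pulls the vanishing back. *)
Lemma eigenvector_zero z : D z -> h z = 0.
Proof.
have r0 := td_rho td.
have near x w : x \in `[-1, 1] -> cn (w - ofR x) < rho / 4 -> h w = 0.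
  move=> hx; have := hx; rewrite in_itv /= => /andP[x1 x2].
  have x3 : `|x| <= 3 by rewrite ler_norml; apply/andP; split; lra.
  have hD u : cball (ofR x) rho u -> D u by exact: (td_real_ball td x3).
  have [c _ hc] := taylor r0 (fun u hu => Hinf_cder h (hD u hu)) (fun u hu => Hinf_norm_ubR h (hD u hu)).
  apply: (taylor_identity r0 (vn_ge0 h) hc) => e e0.
  pose d := Num.min 2^-1 (e / 2).
  have d0 : 0 < d by rewrite lt_min invr_gt0 ltr0n divr_gt0.
  have d1 : d <= 2^-1 by rewrite ge_min lexx.
  have de : d < e by apply: le_lt_trans (_ : e / 2 < e); [rewrite ge_min lexx orbT|lra].
  (* Moving towards the middle by at most 1/2 keeps y inside the interval even when x is an end
     point. *)
  pose y := if x <= 0 then x + d else x - d.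
  have yx : `|y - x| = d.
    rewrite /y; case: ifP => _; first by rewrite addrAC subrr add0r gtr0_norm.
    by rewrite addrAC subrr add0r normrN gtr0_norm.
  exists (ofR y); split.
  - apply/eqP => /(@ofR_inj R) e'; move: yx; rewrite e' subrr normr0 => e''.
    by move: d0; rewrite -e'' ltxx.
  - by rewrite -ofRB cn_ofR yx.
  apply: eigenvector_zero_real; rewrite in_itv /= /y.
  by case: (lerP x 0) => hx0; apply/andP; split; lra.
have aux (a c : C) : a * 0 + c * 0 = 0 by rewrite !mulr0 addr0.
pose ct := (1 + kap) / 2.
have ct01 : 0 <= ct < 1 by have /andP[k0 k1] := cb_kap cb; rewrite /ct; apply/andP; split; lra.
have dyn N : forall x z, x \in `[-1, 1] -> D z -> ct ^+ N * cn (z - ofR x) < rho / 4 -> h z = 0.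
  elim: N => [|N IH] x w hx Dw; first by rewrite mul1r; exact: near.
  move=> hw; have step k : h (ph k w) = 0.
    apply: (IH (phr ph k x)).
    - by rewrite in_itv /=; exact: (phr_in cb k hx).
    - exact: (branch_maps td).
    rewrite -(phrE cb k x); apply: le_lt_trans hw; rewrite exprSr -mulrA; apply: ler_wpM2l.
      by apply: exprn_ge0; case/andP: ct01.
    have sr : strip eps (ofR x) := strip_real cb x.
    exact: (branch_contract cb k sr (td_strip td Dw)).
  have e := transferE hL h Dw; rewrite (step ord0) (step ord_max) in e.
  have e2 : nu * h w = 0 := etrans (esym (eqh Dw)) (etrans e (aux _ _)).
  by move/eqP: e2; rewrite mulf_eq0 (negbTE nu0) /= => /eqP.
move=> Dz; have [N hN] := @small_pow R ct (cn (z - ofR 0)) (rho / 4) ct01 ltac:(by rewrite divr_gt0).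
by apply: (dyn N 0) => //; rewrite in_itv /= oppr_le0 ler01.
Qed.

End Eigenvector.

End CircleSpectrum.

(** * Spectrum and eigenvalues *)

Section Eigenvalues.
Variable R : realType.
Local Notation C := (Cplx R).
Variables (V : normedModType C) (L : {linear V -> V}).

Lemma eigenvalue_spectrum nu : eigenvalues L nu -> spectrum L nu.
Proof.
move=> [v v0 e] [S [_ hS _]]; move: v0.
by rewrite -(hS v) e subrr linear0 eqxx.
Qed.

Lemma spectrum_eigenvalue nu : compact_operator L -> nu != 0 -> spectrum L nu -> eigenvalues L nu.
Proof. by move=> cL n0 hs; apply: contrapT => /(riesz_resolvent cL n0). Qed.

(** A bounded inverse of -L bounds every eigenvalue away from 0. *)
Lemma resolvent0_bound : resolvent_set L 0 -> exists2 B : R, 0 < B &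
  forall nu, eigenvalues L nu -> 1 <= B * cn nu.
Proof.
move=> [S [cS hS _]]; have [B B0 hB] := continuous_bounded cS; exists B => // nu [v v0 e].
have := hB (0 *: v - L v); rewrite hS scale0r sub0r vnN e vnZ mulrA.
by rewrite -{1}[vn v]mul1r ler_pM2r// vn_gt0.
Qed.

End Eigenvalues.

(** * The spectrum of the transfer operator *)

Section TransferSpectrum.
Variable R : realType.
Local Notation C := (Cplx R).
Implicit Types (z w nu : C) (x y : R).

Variables (lam : C) (eps kap K : R) (ph : 'I_2 -> C -> C) (D : set C) (rho M : R).
Variable L : {linear Hinf D -> Hinf D}.
Hypothesis lam1 : cn lam < 1.
Let c0 : C := (1 - lam) / (1 - lam^*).
Let mu : R := (1 - cn lam ^+ 2) / (2 * (1 - re lam)).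
Hypothesis cb : complex_branches lam c0 eps kap K mu ph.
Hypothesis td : transfer_domain eps ph D rho M.
Hypothesis hL : is_transfer_operator ph L.

Let cL : compact_operator L.
Proof. exact: (transfer_operator_compact cb td hL). Qed.

(** Logarithmic derivative of [cb_prod]. It shows that constants are fixed by the operator, which
    settles the exponent 0 that [lam_pow_spectrum] leaves out. *)
Lemma branch_der_sum z : D z -> derive1 (ph ord0) z + derive1 (ph ord_max) z = 1.
Proof.
move=> Dz; have [e e0 he] := (copenP D).1 (td_open td) z Dz.
have sz := td_strip td Dz.
have h k := cder_comp (branch_derive1 cb td k Dz) (circle_der lam (ph k z)).
have hP : exists2 a : R, 0 < a & forall w, cn (w - z) < a ->
    c0 * ce (ph ord0 w) * (c0 * ce (ph ord_max w)) = c0 * ce w.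
  by exists e => // w /he Dw; exact: (cb_prod cb (td_strip td Dw)).
have h1 := cder_near hP (cderM (h ord0) (h ord_max)).
have e1 := cder_derive1 h1; rewrite (cder_derive1 (circle_der lam z)) in e1.
have p := cb_prod cb sz.
have pi0 : ofR (pi : R) != 0 by rewrite -cn_eq0 cn_ofR normr_eq0 gt_eqF// pi_gt0.
have q0 : ci * ofR pi * (c0 * ce z) != 0.
  exact: mulf_neq0 (mulf_neq0 (ci_neq0 R) pi0) (mulf_neq0 (c0_neq0 lam1) (ce_neq0 z)).
apply: (mulfI q0); rewrite mulr1.
have -> : ci * ofR pi * (c0 * ce z) = c0 * (ci * ofR pi * ce z) by rewrite mulrCA.
rewrite [RHS]e1.
have -> : c0 * (ci * ofR pi * ce z) = ci * ofR pi * (c0 * ce z) by rewrite mulrCA.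
rewrite -p -/c0; move: (derive1 _ z) (derive1 _ z) (ce (ph ord0 z)) (ce (ph ord_max z)) => a b u v.
move: (ofR pi) c0 => q c; ring.
Qed.

Lemma one_eigenvalue : eigenvalues L 1.
Proof.
have [f hf] : exists f : Hinf D, forall z, D z -> f z = 1.
  apply: (@Hinf_exists R D _ 1); last by move=> z _; rewrite cn1.
    by move=> z _; exists 0; exact: cder_cst.
  exact: (td_open td).
have D0 : D (ofR 0) by apply: (td_real td); rewrite normr0.
exists f; first by apply/eqP => f0; move: (hf _ D0) => /eqP; rewrite f0 eq_sym oner_eq0.
apply: Hinf_ext => z Dz; rewrite scale1r (hf z Dz).
have e := transferE hL f Dz.
rewrite (hf _ (branch_maps td ord0 Dz)) (hf _ (branch_maps td ord_max Dz)) in e.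
have aux (a b : C) : a * 1 + b * 1 = a + b by rewrite !mulr1.
exact: etrans e (etrans (aux _ _) (branch_der_sum Dz)).
Qed.

Lemma ofR_mu_neq0 n : ofR mu ^+ n != 0.
Proof.
have /andP[m0 _] := mu01 lam1.
by rewrite expf_neq0// -cn_eq0 cn_ofR normr_eq0 gt_eqF.
Qed.

(** The eigenvalues mu^n tend to 0, which an invertible operator does not allow. *)
Lemma zero_spectrum : spectrum L 0.
Proof.
move=> /resolvent0_bound[B B0 hB].
have /andP[m0 m1] := mu01 lam1.
have m01 : 0 <= mu < 1 by rewrite ltW.
have [N hN] := @small_pow R mu B 1 m01 ltr01.
have := hB (ofR mu ^+ N.+1) (spectrum_eigenvalue cL (ofR_mu_neq0 _) (mu_pow_spectrum lam1 cb td hL (ltn0Sn N))).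
rewrite cnX cn_ofR gtr0_norm//; apply/negP; rewrite -ltNge mulrC.
apply: le_lt_trans hN; apply: ler_wpM2r; first exact: ltW.
by rewrite exprS ler_piMl ?exprn_ge0 ?ltW.
Qed.

Theorem transfer_spectrum : spectrum L =
  ((range (fun n : nat => lam ^+ n) `|` [set lam^* ^+ n | n in [set n : nat | (0 < n)%N]] `|` [set 0]) `|`
    [set ofR mu ^+ n | n in [set n : nat | (0 < n)%N]]).
Proof.
apply/seteqP; split=> nu.
  move=> hs; apply: contrapT => hn.
  have nu0 : nu != 0 by apply/eqP => e; apply: hn; left; right.
  have [h hne he] := spectrum_eigenvalue cL nu0 hs.
  have nul b n : nu != (if b then lam else lam^*) ^+ n.
    apply/eqP => e; apply: hn; left; left; case: n e => [|n] e.
      by left; exists 0%N => //; rewrite e !expr0.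
    by case: b e => e; [left; exists n.+1|right; exists n.+1].
  have num n : (0 < n)%N -> nu != ofR mu ^+ n.
    by move=> n0; apply/eqP => e; apply: hn; right; exists n.
  move: hne => /eqP; apply; apply: Hinf_ext => z Dz.
  have eqh w : D w -> L h w = nu * h w by rewrite he.
  exact: (eigenvector_zero lam1 cb td hL eqh nu0 nul num Dz).
have nz (b : bool) n : (0 < n)%N -> spectrum L ((if b then lam else lam^*) ^+ n).
  (* The power vanishes when lam = 0. *)
  move=> n0; have [->|ne] := eqVneq ((if b then lam else lam^*) ^+ n) 0; first exact: zero_spectrum.
  exact: (lam_pow_spectrum lam1 cb td hL n0 ne).
move=> [[[[n _ <-]|[n /= n0 <-]]|->]|[n /= n0 <-]].
- case: n => [|n]; first exact: (eigenvalue_spectrum one_eigenvalue).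
  exact: (nz true).
- exact: (nz false).
- exact: zero_spectrum.
- exact: (mu_pow_spectrum lam1 cb td hL n0).
Qed.

(** Reduces infinitude to the existence of non-zero elements of arbitrarily small modulus. *)
Lemma finite_nonzero_bound (A : set C) : finite_set A -> exists2 d : R, 0 < d &
  forall z, A z -> z != 0 -> d <= cn z.
Proof.
move=> /finite_seqP[s ->]; elim: s => [|a s [d d0 hd]]; first by exists 1.
have [->|a0] := eqVneq a 0.
  exists d => // z /=; rewrite inE => /orP[/eqP ->|zs z0]; first by rewrite eqxx.
  exact: hd.
exists (Num.min d (cn a)); first by rewrite lt_min d0 cn_gt0.
move=> z /=; rewrite inE ge_min => /orP[/eqP -> _|zs z0]; first by rewrite lexx orbT.
by rewrite hd.
Qed.

Lemma nonreal_eigenvalues : lam \isn't Num.real ->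
  let N := eigenvalues L `&` [set mu | mu \isn't Num.real] in
  countable N /\ forall e : C, 0 < e -> infinite_set (N `&` [set mu | `|mu| < e]).
Proof.
move=> nr N; split.
  apply: (@sub_countable _ _ _
    (\bigcup_(n in [set: nat]) [set` [:: lam ^+ n; lam^* ^+ n; 0; ofR mu ^+ n]])).
    apply: subset_card_le => nu [/eigenvalue_spectrum]; rewrite transfer_spectrum.
    move=> [[[[n _ <-]|[n _ <-]]|->]|[n _ <-]] _; last 2 first.
    - by exists 0%N; rewrite //= !inE eqxx !orbT.
    - by exists n; rewrite //= !inE eqxx !orbT.
    - by exists n; rewrite //= !inE eqxx.
    - by exists n; rewrite //= !inE eqxx orbT.
  by apply: bigcup_countable => // n _; apply: finite_set_countable; exact: finite_seq.
have l0 : lam != 0 by apply/eqP => e; move: nr; rewrite e real0.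
move=> _ /cpos_ofR[e e0 ->] /finite_nonzero_bound[d d0 hd].
have l01 : 0 <= cn lam < 1 by rewrite cn_ge0.
have [n hn] := @small_pow R (cn lam) 1 (Num.min e d) l01 ltac:(by rewrite lt_min e0).
have small k : (n <= k)%N -> cn (lam ^+ k) < Num.min e d.
  move=> nk; apply: le_lt_trans hn; rewrite mulr1 cnX; by apply: ler_wiXn2l; rewrite ?cn_ge0// ltW.
(* Two consecutive powers of lam cannot both be real, since their quotient is lam. *)
have [k nk kr] : exists2 k, (n <= k.+1)%N & lam ^+ k.+1 \isn't Num.real.
  have [hr|hr] := boolP (lam ^+ n.+1 \is Num.real); last by exists n.
  exists n.+1 => //; first by rewrite ltnW// ltnW.
  apply: contra nr => hr2; have -> : lam = lam ^+ n.+2 / lam ^+ n.+1.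
    by rewrite exprS mulfK// expf_neq0.
  by apply: rpredM => //; rewrite realV.
have := small k.+1 nk; rewrite lt_min => /andP[s1 s2].
have k0 : lam ^+ k.+1 != 0 by rewrite expf_neq0.
have hA : (N `&` [set z | `|z| < ofR e]) (lam ^+ k.+1).
  split; last by rewrite /= cn_lt.
  split => //; apply: (spectrum_eigenvalue cL k0); rewrite transfer_spectrum.
  by left; left; left; exists k.+1.
by have := hd _ hA k0; rewrite leNgt s2.
Qed.

End TransferSpectrum.

(** * Connectedness, the multiplier in terms of alpha, and the theorem *)

Section Conclusion.
Variable R : realType.
Local Notation C := (Cplx R).

(** D is the union of the segments from one of its points to all the others, each a continuous image
    of [0, 1]. *)
Lemma cconvex_connected (D : set C) : cconvex D -> connected D.
Proof.
move=> cD; have [->|/set0P[a Da]] := eqVneq D set0; first exact: connected0.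
pose seg (b : C) := (fun t : R => a + ofR t * (b - a)) @` `[0, 1]%classic.
have -> : D = \bigcup_(b in D) seg b.
  apply/seteqP; split=> [b Db|_ [b Db [t ht <-]]].
    by exists b => //; exists 1; rewrite /= ?in_itv/= ?ler01 ?lexx// ofR1 mul1r addrC subrK.
  by move: ht; rewrite /= in_itv /=; exact: cD.
apply: bigcup_connected => [|b Db].
  exists a => b _; exists 0; rewrite /= ?in_itv /= ?lexx ?ler01//.
  by rewrite ofR0 mul0r addr0.
apply: connected_continuous_connected; first exact: segment_connected.
apply: continuous_subspaceT => t A hA; have [e e0 he] := (cnbhsP _ _).1 hA.
have c1 : 0 < cn (b - a) + 1 by rewrite ltr_wpDl// cn_ge0.
apply/nbhs_ballP; exists (e / (cn (b - a) + 1)); first by rewrite /= divr_gt0.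
move=> u; rewrite /ball /= ltr_pdivlMr// => hu; apply: he.
have -> : a + ofR u * (b - a) - (a + ofR t * (b - a)) = ofR (u - t) * (b - a).
  by rewrite ofRB; ring.
rewrite cnM cn_ofR distrC; apply: le_lt_trans hu; apply: ler_wpM2l => //.
by rewrite lerDl.
Qed.

Lemma transfer_domain_bounded eps (ph : 'I_2 -> C -> C) D rho M :
  transfer_domain eps ph D rho M -> bounded_domain D.
Proof.
move=> td; have [oD bD _] := td_disk td; split => //.
- exact: cconvex_connected (td_convex td).
- by exists (ofR 0); apply: (td_real td); rewrite normr0.
Qed.

Lemma multiplier_ratio (lam : C) (alpha : R) : lam = `|lam| * expi alpha ->
  ofR ((1 - cn lam ^+ 2) / (2 * (1 - re lam))) =
  (`|lam| ^+ 2 - 1) / (2 * (`|lam| * ofR (cos alpha) - 1)).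
Proof.
move=> hlam; have hre : re lam = cn lam * cos alpha.
  by rewrite {1}hlam cnE reM im_ofR mul0r subr0.
rewrite hre cnE -ofRM -ofRX -!ofR1 -(ofRn R 2) -!ofRB -ofRM -ofRV -ofRM; congr ofR.
by rewrite -(opprB 1 (cn lam * cos alpha)) -[in RHS](opprB 1) mulrN invrN mulrNN.
Qed.

End Conclusion.

Unset Implicit Arguments.
Set Strict Implicit.

Theorem mainTheorem2 (R : realType) :
  (forall (lambda : Cplx R) (alpha : R),
     `|lambda| < 1 -> lambda = `|lambda| * expi alpha ->
     (exists (T : R -> R) (Phi : 'I_2 -> R -> R), interval_map lambda T Phi) /\
     forall (T : R -> R) (Phi : 'I_2 -> R -> R), interval_map lambda T Phi ->
     exists (D : set (Cplx R)) (PhiD : 'I_2 -> Cplx R -> Cplx R)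
            (L : {linear Hinf D -> Hinf D}),
       [/\ bounded_topological_disk D,
           forall x : R, x \in `[-1, 1] -> D (ofR x),
           forall k, holomorphic D (PhiD k) /\
             (forall x : R, x \in `[-1, 1] -> PhiD k (ofR x) = ofR (Phi k x)),
           forall k, maps_compactly_into D (PhiD k) &
           is_transfer_operator PhiD L] /\
       [/\ compact_operator L,
           spectrum L =
             ((range (fun n : nat => lambda ^+ n) `|`
               [set lambda^* ^+ n | n in [set n : nat | (0 < n)%N]] `|` [set 0]) `|`
              [set ((`|lambda| ^+ 2 - 1) /
                    (2 * (`|lambda| * ofR (cos alpha) - 1))) ^+ n
                | n in [set n : nat | (0 < n)%N]]),
           forall k, contracting D (PhiD k) /\
             real_fixed_point_and_multiplier D (PhiD k) &
           lambda \isn't Num.real ->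
             let N := eigenvalues L `&` [set mu | mu \isn't Num.real] in
             countable N /\
             forall e : Cplx R, 0 < e -> infinite_set (N `&` [set mu | `|mu| < e])]) /\
  ~ small_eigenvalues_real_assertion R.
Proof.
split=> [lam alpha|H].
  rewrite -[1]/(ofR 1) cn_lt => lam1 hlam.
  have [eps [kap [K [ph cb]]]] := complex_branches_exist lam1.
  have [D [rho [M td]]] := transfer_domain_exists cb.
  have [L hL] := transfer_operator_exists cb td.
  have [T0 hT0] := interval_map_exists lam1 cb.
  split; first by exists T0, (phr ph).
  move=> T Phi hT; exists D, ph, L; split; split.
  - exact: (td_disk td).
  - move=> x; rewrite in_itv /= => /andP[x1 x2]; apply: (td_real td).
    by rewrite ler_norml; apply/andP; split; lra.
  - move=> k; split; first by move=> z; exact: (branch_holomorphic cb td).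
    by move=> x hx; rewrite (interval_map_unique lam1 cb hT k hx); exact: (phrE cb k x).
  - exact: (branch_compactly td).
  - exact: hL.
  - exact: (transfer_operator_compact cb td hL).
  - by rewrite (transfer_spectrum lam1 cb td hL) -(multiplier_ratio hlam).
  - by move=> k; split; [exact: (branch_contracting cb td k)|exact: (branch_fixed_point cb td k)].
  - exact: (nonreal_eigenvalues lam1 cb td hL).
(* One non-real parameter in the disc suffices to refute the assertion. *)
pose lam : Cplx R := ci / 2.
have lam1 : cn lam < 1 by rewrite cnM cn_ci cnV -(ofRn R 2) cn_ofR ger0_norm//; lra.
have nr : lam \isn't Num.real.
  have -> : lam = ci * ofR 2^-1 by rewrite ofRV ofRn.
  rewrite cplx_realP imM im_ofR re_ofR im_ci mulr0 add0r mul1r.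
  by rewrite invr_eq0 pnatr_eq0.
have [eps [kap [K [ph cb]]]] := complex_branches_exist lam1.
have [D [rho [M td]]] := transfer_domain_exists cb.
have [L hL] := transfer_operator_exists cb td.
have D0 : D (ofR 0) by apply: (td_real td); rewrite normr0.
have hph k : [/\ holomorphic D (ph k), contracting D (ph k) &
    real_fixed_point_and_multiplier D (ph k)].
  split; [by move=> z; exact: (branch_holomorphic cb td)|exact: (branch_contracting cb td k)|].
  exact: (branch_fixed_point cb td k).
have [e e0 he] := H D 2%N ph L (transfer_domain_bounded td) (ex_intro _ 0 D0) erefl hph hL.
have [_ /(_ e e0) hinf] := nonreal_eigenvalues lam1 cb td hL nr.
apply: hinf; apply: sub_finite_set (finite_set0 _) => nu [[hnu hnr] hlt].
by move: hnr; rewrite /= (he nu hnu hlt).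
Qed.
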